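(* Assume: (1) (Fully dominated model) There are a probability measure $\lambda$ on $\mathcal X$ and a $\sigma$-finite measure $\mu$ on $\mathcal Y$ such that for all $x\in\mathcal X$, $\theta\in\Theta$: $Q_\theta(x;dx')=q_\theta(x,x')\,\lambda(dx')$ and $G_\theta(x;dy)=g_\theta(x,y)\,\mu(dy)$, with $q_\theta(\cdot,\cdot)$ and $g_\theta(\cdot,\cdot)$ jointly measurable. (2) (Regularity) There are $\sigma^-,\sigma^+\in(0,\infty)$ with $\sigma^-\le q_\theta(x,x')\le\sigma^+$ for all $x,x'\in\mathcal X$, $\theta\in\Theta$; for every $y\in\mathcal Y$, $\inf_{\theta\in\Theta}\int g_\theta(x,y)\lambda(dx)>0$ and $\sup_{\theta\in\Theta}\int g_\theta(x,y)\lambda(dx)<\infty$; and $g_\theta(x,y)>0$ for all $x\in\mathcal X,y\in\mathcal Y,\theta\in\Theta$. (3) $b^+:=1\vee\sup_{\theta}\sup_{x,y}g_\theta(x,y)<\infty$, and, with $b^-(y):=\inf_{\theta}\int g_\theta(x,y)\lambda(dx)$, $\mathbb E_{\theta^\star}|\log b^-(Y_\partial)|<\infty$. (4) $\mathbb E_{\theta^\star}[(\log b^-(Y_\partial))^2]<\infty$. (5) For all $x,x'\in\mathcal X$, $y\in\mathcal Y$, the maps $\theta\mapsto q_\theta(x,x')$ and $\theta\mapsto g_\theta(x,y)$ are continuous on $\Theta$. (6) $\Theta$ is compact and the contrast function $\ell:\Theta\to\mathbb R$ (defined in the context) has a unique maximum (which is then located at $\theta^\star$). Then, for every initial probability distribution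 $\zeta$ on $\mathcal X$ and every $x\in\mathcal X$, the maximum likelihood estimator $\hat\theta'_{n,x}$ computed from $(Y'_u)_{u\in T_n}$ converges $\mathbb P_{\theta^\star,\zeta}$-almost surely to $\theta^\star$ as $n\to\infty$.
   Context: Tree. $T=\bigcup_{n\ge0}\{0,1\}^n$ is the infinite complete plane rooted binary tree with root $\partial$ (the empty word); $u\in T$ has left child $u0$ and right child $u1$. $p(u)$ is the parent of $u$, $p^k(u)$ its $k$-th ancestor, $\mathrm{ht}(u)$ its height ($\mathrm{ht}(\partial)=0$). $T_n=\{u:\mathrm{ht}(u)\le n\}$, $T_n^*=T_n\setminus\{\partial\}$. For a family $(z_u)$ and a set $A$ of vertices, $z_A=(z_u)_{u\in A}$. HMT. $\mathcal X$, $\mathcal Y$ are metric spaces with their Borel $\sigma$-fields; $\Theta\subset\mathbb R^d$; for $\theta\in\Theta$, $Q_\theta$ is a probability kernel on $\mathcal X$ and $G_\theta$ a probability kernel from $\mathcal X$ to $\mathcal Y$. A hidden Markov tree (HMT) with parameter $(Q,G,\nu)$ is a process $(X_u,Y_u)_{u\in T}$ such that for all $n$ the law of $(X_{T_n},Y_{T_n})$ is $\nu(dx_\partial)\prod_{u\in T_n^*}Q(x_{p(u)};dx_u)\prod_{u\in T_n}G(x_u;dy_u)$. $\theta^\star\in\Theta$ is the true parameter. Under (1)-(2), $Q_\theta$ has a unique invariant probability $\pi_\theta$; $\mathbb P_\theta,\mathbb E_\theta$ refer to the stationary HMT $(X,Y)$ with parameter $(Q_\theta,G_\theta,\pi_\theta)$.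 $\mathbb P_{\theta^\star,\zeta}$ is the law of the (possibly non-stationary) HMT $(X',Y')$ with parameter $(Q_{\theta^\star},G_{\theta^\star},\zeta)$. Likelihood and MLE. For $x\in\mathcal X$, with $x_\partial=x$, $p_\theta(y_{T_n}\mid X_\partial=x)=g_\theta(x,y_\partial)\int\prod_{v\in T_n^*}q_\theta(x_{p(v)},x_v)g_\theta(x_v,y_v)\lambda(dx_v)$. Put $\ell'_{n,x}(\theta)=\log p_\theta(Y'_{T_n}\mid X_\partial=x)$; $\hat\theta'_{n,x}\in\operatorname{argmax}_{\theta\in\Theta}\ell'_{n,x}(\theta)$ is a measurable choice of a maximizer (a function of $Y'_{T_n}$). Extended tree. $T^\infty\supset T$ is obtained by adding a line of ancestors $u_{-j}=p^j(\partial)$, $j\ge1$ ($u_0=\partial$), and, for each $j\ge1$, grafting a copy $T^{(j)}$ of $T$ whose root is the second child of $u_{-j}$. Heights are extended so that $\mathrm{ht}(u_{-j})=-j$ and a child has height one more than its parent. For $w\in T^\infty$, $T^\infty(w)$ is the set of descendants of $w$ (including $w$). By stationarity, under $\mathbb P_\theta$ the HMT $(X,Y)$ is extended to $T^\infty$ so that on each $T^\infty(w)$ it is an HMT with parameter $(Q_\theta,G_\theta,\pi_\theta)$. Let $\mathcal U=(\mathcal U_j)_{j\le0}$ be i.i.d. Bernoulli$(1/2)$ variables independent of $(X,Y)$, with law $\mathbb P_{\mathcal U}$ and expectation $\mathbb E_{\mathcal U}$. For $j\ge0$, $u_{-j}$ is the left child of $u_{-j-1}$ if $\mathcal U_{-j}=0$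 and the right child otherwise; the children of vertices of $T$ and of $T^{(j)}$ keep their deterministic order. Let $<_{\mathcal U}$ be the breadth-first order on $T^\infty$: $v<_{\mathcal U}u$ iff $\mathrm{ht}(v)<\mathrm{ht}(u)$, or $\mathrm{ht}(v)=\mathrm{ht}(u)$, $v\neq u$, and at the most recent common ancestor of $u,v$ the path to $v$ goes to the left child and the path to $u$ to the right child. Define $\Delta^*_{\mathcal U}(u,k)=\{v\in T^\infty(p^k(u)):v<_{\mathcal U}u\}$ and $\Delta_{\mathcal U}(u,k)=\Delta^*_{\mathcal U}(u,k)\cup\{u\}$. Contrast function. For a finite subtree $\Delta$ of $T^\infty$ with root $w$, put (with $x_w=x$) $p_\theta(y_\Delta\mid X_w=x)=g_\theta(x,y_w)\int\prod_{v\in\Delta\setminus\{w\}}q_\theta(x_{p(v)},x_v)g_\theta(x_v,y_v)\lambda(dx_v)$, and $1$ if $\Delta=\emptyset$. Let $\mathrm h_{u,k,x}(\theta)=\log\dfrac{p_\theta(Y_{\Delta_{\mathcal U}(u,k)}\mid X_{p^k(u)}=x)}{p_\theta(Y_{\Delta^*_{\mathcal U}(u,k)}\mid X_{p^k(u)}=x)}$. Under (1)-(3), $\mathrm h_{\partial,k,x}(\theta)$ converges as $k\to\infty$, $\mathbb P_{\mathcal U}\otimes\mathbb P_{\theta^\star}$-a.s. and in $L^1$, to a limit $\mathrm h_{\partial,\infty}(\theta)$ not depending on $x$. The contrast function is $\ell(\theta)=\mathbb E_{\mathcal U}\otimes\mathbb E_{\theta^\star}[\mathrm h_{\partial,\infty}(\theta)]$.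 *)

(* Defs.v *)
From HB Require Import structures.
From mathcomp Require Import all_boot all_order all_algebra finmap.
From mathcomp Require Import all_classical all_reals all_analysis.

Set Implicit Arguments.
Unset Strict Implicit.
Unset Printing Implicit Defensive.
Import Order.TTheory GRing.Theory Num.Theory.
Import numFieldNormedType.Exports.
Local Open Scope classical_set_scope.
Local Open Scope ring_scope.

(* Measurable types are pointed in the library, metric types are not. *)
#[short(type="pmetricType")]
HB.structure Definition PointedMetric (K : numDomainType) :=
  {M of Metric K M & Pointed M}.

Notation borel M := (g_sigma_algebraType (@open M)).

Section words.

(* A vertex of T is the word of edge labels read from the root; its children are
   rcons w false (left) and rcons w true (right). The root gets itself as a junk
   parent. *)
Definition word_parent (w : seq bool) : seq bool :=
  if w is b :: w' then belast b w' else [::].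

Fixpoint words (n : nat) : seq (seq bool) :=
  if n is n'.+1 then [seq rcons w b | w <- words n', b <- [:: false; true]]
  else [:: [::]].

(* The vertices of T_n, every parent occurring before its children. *)
Definition Tn_seq (n : nat) : seq (seq bool) :=
  flatten [seq words k | k <- iota 0 n.+1].

Definition Tn (n : nat) : set (seq bool) := [set w | (size w <= n)%N].

End words.

Section extended_tree.

(* Core w is the vertex w of T, Anc j is u_{-(j+1)}, and Graft j w is the vertex
   w of T^{(j+1)}, whose root Graft j [::] is a child of Anc j. *)
Inductive vertex : Type :=
  | Core of seq bool
  | Anc of nat
  | Graft of nat & seq bool.

Definition vertex_encode (v : vertex) : seq bool + (nat + nat * seq bool) :=
  match v with
  | Core w => inl w
  | Anc j => inr (inl j)
  | Graft j w => inr (inr (j, w))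
  end.

Definition vertex_decode (c : seq bool + (nat + nat * seq bool)) : vertex :=
  match c with
  | inl w => Core w
  | inr (inl j) => Anc j
  | inr (inr (j, w)) => Graft j w
  end.

Lemma vertex_encodeK : cancel vertex_encode vertex_decode.
Proof. by case. Qed.

HB.instance Definition _ := Countable.copy vertex (can_type vertex_encodeK).

Definition origin : vertex := Core [::].

Definition vparent (v : vertex) : vertex :=
  match v with
  | Core [::] => Anc 0
  | Core w => Core (word_parent w)
  | Anc j => Anc j.+1
  | Graft j [::] => Anc j
  | Graft j w => Graft j (word_parent w)
  end.

Definition anc (k : nat) (v : vertex) : vertex := iter k vparent v.

Definition ht (v : vertex) : int :=
  match v with
  | Core w => (size w)%:Z
  | Anc j => - (j.+1)%:Z
  | Graft j w => (size w)%:Z - j%:Z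
  end.

Definition descendants (w : vertex) : set vertex :=
  [set v | exists k, anc k v = w].

(* An enumeration of the two children of a vertex, unrelated to the left/right
   order: for u_{-j}, j >= 1, it lists u_{-j+1} and then the root of T^{(j)}. *)
Definition child (v : vertex) (b : bool) : vertex :=
  match v with
  | Core w => Core (rcons w b)
  | Anc j => if b then Graft j [::] else if j is i.+1 then Anc i else origin
  | Graft j w => Graft j (rcons w b)
  end.

(* The tree isomorphism from T onto descendants w induced by child. *)
Definition descend (w : vertex) (s : seq bool) : vertex := foldl child w s.

(* In what follows U j stands for the variable indexed by -j. *)

(* false when v is a left child, true when it is a right child. *)
Definition side (U : nat -> bool) (v : vertex) : bool :=
  match v with
  | Core w => last (U 0%N) w
  | Anc j => U j.+1
  | Graft j w => last (~~ U j) w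
  end.

(* At equal heights, anc k.+1 u is the most recent common ancestor. *)
Definition bf_lt (U : nat -> bool) (v u : vertex) : Prop :=
  ht v < ht u \/
  ht v = ht u /\
  exists k, [/\ anc k v <> anc k u, anc k.+1 v = anc k.+1 u,
                side U (anc k v) = false & side U (anc k u) = true].

Definition DeltaStar (U : nat -> bool) (u : vertex) (k : nat) : set vertex :=
  descendants (anc k u) `&` [set v | bf_lt U v u].

Definition Delta (U : nat -> bool) (u : vertex) (k : nat) : set vertex :=
  DeltaStar U u k `|` [set u].

End extended_tree.

(* The iterated integral of f over the coordinates listed in s, the first one
   outermost: coordinate v is integrated against mu v z, where z holds the
   coordinates fixed so far. *)
Fixpoint iterated_integral (R : realType) (V : eqType) d (Z : measurableType d)
    (mu : V -> (V -> Z) -> set Z -> \bar R) (s : seq V)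
    (f : (V -> Z) -> \bar R) (z : V -> Z) : \bar R :=
  if s is v :: s' then
    (\int[mu v z]_t iterated_integral mu s' f [eta z with v |-> t])%E
  else f z.

(* The sigma-field generated by the coordinates z_v, v in D. *)
Definition coord_sigma (V : Type) d (Z : measurableType d) (D : set V) :
    set (set (V -> Z)) :=
  <<s [set C | exists v (A : set Z),
        [/\ D v, measurable A & C = [set z | A (z v)]] ]>>.

Section hidden_markov_tree.
Context (R : realType) (dX dY : measure_display).
Context (X : measurableType dX) (Y : measurableType dY).

(* The measure nu(dx_root) prod Q(x_p(u); dx_u) prod G(x_u; dy_u) on T_n. *)
Definition hmt_law (Q : R.-pker X ~> X) (G : R.-pker X ~> Y)
    (nu : probability X R) (n : nat) (C : set (seq bool -> X * Y)) : \bar R :=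
  iterated_integral
    (fun v (x : seq bool -> X) =>
       if v is [::] then (nu : set X -> \bar R) else Q (x (word_parent v)))
    (Tn_seq n)
    (fun x => iterated_integral (fun v (_ : seq bool -> Y) => G (x v)) (Tn_seq n)
       (fun y => (\1_C (fun v => (x v, y v)))%:E) (fun=> point))
    (fun=> point).

Definition is_HMT d (Omega : measurableType d) (P : probability Omega R)
    (Xp : seq bool -> {RV P >-> X}) (Yp : seq bool -> {RV P >-> Y})
    (Q : R.-pker X ~> X) (G : R.-pker X ~> Y) (nu : probability X R) : Prop :=
  forall n (C : set (seq bool -> X * Y)), coord_sigma (Tn n) C ->
    P [set w | C (fun u => (Xp u w, Yp u w))] = hmt_law Q G nu n C.

Definition is_extended_HMT d (Omega : measurableType d)
    (P : probability Omega R)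
    (Xp : vertex -> {RV P >-> X}) (Yp : vertex -> {RV P >-> Y})
    (Q : R.-pker X ~> X) (G : R.-pker X ~> Y) (nu : probability X R) : Prop :=
  forall w : vertex,
    is_HMT (fun s => Xp (descend w s)) (fun s => Yp (descend w s)) Q G nu.

Definition invariant_probability (Q : R.-pker X ~> X) (pi : probability X R) :
    Prop :=
  forall A, measurable A -> (\int[pi]_x Q x A)%E = pi A.

End hidden_markov_tree.

Definition iid_bernoulli_half (R : realType) d (Omega : measurableType d)
    (P : probability Omega R) (U : nat -> {RV P >-> bool}) : Prop :=
  (forall j (A : set bool), P (U j @^-1` A) = bernoulli_prob (2^-1 : R) A) /\
  (forall (J : {fset nat}) (A : nat -> set bool),
     P (\bigcap_(j in [set` J]) U j @^-1` A j) =
     (\prod_(j <- J) P (U j @^-1` A j))%E).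

Section likelihood.
Context (R : realType) (dX dY : measure_display).
Context (X : measurableType dX) (Y : measurableType dY).
Variable lambda : probability X R.

(* p(y_D | X_r = x) for a finite subtree D with root r of a tree on V with parent
   map par. *)
Definition tree_likelihood (V : choiceType) (par : V -> V)
    (q : X -> X -> R) (g : X -> Y -> R) (D : set V) (r : V) (x : X)
    (y : V -> Y) : R :=
  if `[< D = set0 >] then 1 else
  let s : seq V := fset_set (D `\ r) in
  g x (y r) *
  fine (iterated_integral (fun _ _ => lambda : set X -> \bar R) s
    (fun z => (\prod_(v <- s) (q (z (par v)) (z v) * g (z v) (y v)))%:E)
    (fun=> x)).

(* For a parameter set Par, e.g. 'rV[R]_d. *)
Context (Par : Type) (q : Par -> X -> X -> R) (g : Par -> X -> Y -> R).

Definition log_likelihood (n : nat) (x : X) (y : seq bool -> Y) (theta : Par) :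
    R :=
  ln (tree_likelihood word_parent (q theta) (g theta) (Tn n) [::] x y).

Definition h_ (U : nat -> bool) (y : vertex -> Y) (u : vertex) (k : nat) (x : X)
    (theta : Par) : R :=
  ln (tree_likelihood vparent (q theta) (g theta) (Delta U u k) (anc k u) x y /
      tree_likelihood vparent (q theta) (g theta) (DeltaStar U u k) (anc k u) x y).

(* The limit as k goes to infinity common to all x; an arbitrary constant where
   there is none. *)
Definition h_infty (U : nat -> bool) (y : vertex -> Y) (theta : Par) : R :=
  get [set l : R | forall x, (fun k => h_ U y origin k x theta) @ \oo --> l].

Definition contrast dU (OmegaU : measurableType dU) (PU : probability OmegaU R)
    (U : nat -> {RV PU >-> bool})
    d (Omega : measurableType d) (P : probability Omega R)
    (Yp : vertex -> {RV P >-> Y}) (theta : Par) : R :=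
  \int[(PU \x P)%E]_w h_infty (fun j => U j w.1) (fun v => Yp v w.2) theta.

Definition b_minus (Theta : set Par) (y : Y) : R :=
  fine (ereal_inf [set (\int[lambda]_x (g theta x y)%:E)%E | theta in Theta]).

End likelihood.

Definition is_argmax (R : realType) (Par : Type) (Theta : set Par) (f : Par -> R)
    (t : Par) : Prop :=
  Theta t /\ forall t', Theta t' -> f t' <= f t.

(* Main.v *)
Require Import Defs.
From HB Require Import structures.
From mathcomp Require Import all_boot all_order all_algebra finmap.
From mathcomp Require Import all_classical all_reals all_analysis.
From mathcomp Require Import measurable_realfun.
From mathcomp Require Import ring lra.

Set Implicit Arguments.
Unset Strict Implicit.
Unset Printing Implicit Defensive.
Import Order.TTheory GRing.Theory Num.Theory.
Import numFieldNormedType.Exports.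
Import HBNNSimple.
Local Open Scope classical_set_scope.
Local Open Scope ring_scope.

(** This is a proof of consistency by Wald's method. Fix a root state x. For a
parameter theta let L_n be the log-likelihood of the first n levels given x, and
let f_k (flog) be the log-likelihood of the first k levels when the state of the
root is drawn from lambda.

Cutting: q takes its values in [sm, sp], so replacing the density q(x, .) of a
child by the constant 1 changes each branch by a factor in [sm, sp]. Cutting the
2^N edges above level N therefore gives, up to 2^N times the constant cq, that
L_(N+k) is L_N plus the sum of f_k over the subtrees rooted at level N
(ln_lik_cut). Divided by 2^N this is an average over a level, with an error that
is bounded independently of k.

Law of large numbers: for a functional F of finitely many levels, its averages
over level m converge almost surely to the stationary mean of F, for every
initial law (avg_ae_cvg). Conditional means given the root state approach the
stationary mean geometrically (doeblin), and the two subtrees below a vertex are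
independent given its state, so the second moment of the centred average is
halved at each level up to a geometrically small term; it is summable.

Contrast: the ratio inside h_ is the likelihood of the first vertices in
breadth-first order up to a vertex s, divided by the same without s. Over the
words s of length k these log-ratios telescope to L_(k+1) - L_k (sum_hlog). The
coin flips make s uniform on the words of length k, hence the contrast is the
limit of 2^-k a_k, where a_k (alog) is the stationary mean of f_k (contrast_lim);
the limit defining h_infty exists because conditioning on one more ancestor
contracts the oscillation in x of the ratio (ratio_step, hlog_cvg). From
ln z <= z - 1 one gets a_k(theta) <= a_k(theta_star) + sp - 1 (alog_le), so
theta_star maximises the contrast and is the only maximiser.

Separation: if theta0 is not theta_star, then a_k(theta_star) - a_k(theta0) is of
order 2^k and exceeds every constant for k large (block_gap), in particular all
the cutting errors. By dominated convergence the same holds with the supremum of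
f_k over a small enough ball around theta0 in place of f_k(theta0), and the law
of large numbers applied to this supremum shows that the likelihood is eventually
smaller on the whole ball than at theta_star (local_separation). By compactness
finitely many such balls cover the complement of any neighbourhood of theta_star,
which the maximiser therefore eventually avoids (uniform_separation). *)

(** * Configurations and iterated integrals *)

Definition coord_cylinders (V : Type) d (Z : measurableType d) :
    set (set (V -> Z)) :=
  [set C | exists v (A : set Z), measurable A /\ C = [set z | A (z v)]].

Fact config_display : measure_display. Proof. exact. Qed.

(** A separate name for V -> Z, so that it can carry the product sigma-algebra as
its canonical measurable structure. *)
Definition config (V : Type) d (Z : measurableType d) : Type := V -> Z.

Section config_instance.
Context (V : Type) d (Z : measurableType d).
Let G := @coord_cylinders V d Z.

HB.instance Definition _ := Pointed.copy (config V Z) (V -> Z).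
HB.instance Definition _ := @isMeasurable.Build config_display (config V Z)
  <<s G >> (@sigma_algebra0 _ setT G) (@sigma_algebraC (V -> Z) G)
  (@sigma_algebra_bigcup _ setT G).

End config_instance.

Definition upd (V : eqType) (Z : Type) (z : V -> Z) (v : V) (t : Z) : V -> Z :=
  fun w => if w == v then t else z w.

Section config_measurability.
Context (V : eqType) d (Z : measurableType d).

Lemma measurable_coord (v : V) :
  measurable_fun setT (fun z : config V Z => z v : Z).
Proof.
move=> _ A mA; rewrite setTI; apply: sub_gen_smallest.
by exists v, A.
Qed.

Lemma measurable_to_config dT (T : measurableType dT) (f : T -> config V Z) :
  (forall v, measurable_fun setT (fun t => (f t : V -> Z) v)) ->
  measurable_fun setT f.
Proof.
move=> mf; apply: (@measurability _ _ T (config V Z) setT f (@coord_cylinders V _ Z)) => //.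
move=> _ [_ [v [A [mA ->]]] <-].
exact: mf.
Qed.

Lemma measurable_upd (v : V) :
  measurable_fun setT (fun p : config V Z * Z => upd p.1 v p.2 : config V Z).
Proof.
apply: measurable_to_config => w; rewrite /upd; case: (w == v).
  exact: measurable_snd.
exact: (measurableT_comp (measurable_coord w) measurable_fst).
Qed.

Lemma measurable_upd1 (z : V -> Z) (v : V) :
  measurable_fun setT (fun t : Z => upd z v t : config V Z).
Proof.
apply: measurable_to_config => w; rewrite /upd; case: (w == v).
  exact: measurable_id.
exact: measurable_cst.
Qed.

Lemma updC (z : V -> Z) v w t u : v != w ->
  upd (upd z v t) w u = upd (upd z w u) v t.
Proof.
move=> vw; apply/funext => a; rewrite /upd.
by case: (eqVneq a w) => // ->; rewrite eq_sym (negbTE vw).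
Qed.

End config_measurability.

Section integral_functional.
Context (R : realType) d (T : measurableType d).
Local Open Scope ereal_scope.

(** Integration against m is the only additive, homogeneous and monotonically
continuous functional with the values m A on indicators: simple functions
approximate from below. This is used to identify integrals that are only known
on events, such as those against an iterated product of kernels. *)
Lemma ge0_integral_functional (m : {measure set T -> \bar R})
    (I : (T -> \bar R) -> \bar R) :
  (forall f f', (forall t, 0 <= f t) -> measurable_fun setT f ->
     (forall t, 0 <= f' t) -> measurable_fun setT f' ->
     I (fun t => f t + f' t) = I f + I f') ->
  (forall (r : R) f, (0 <= r)%R -> (forall t, 0 <= f t) ->
     measurable_fun setT f -> I (fun t => r%:E * f t) = r%:E * I f) ->
  (forall f : nat -> T -> \bar R, (forall n t, 0 <= f n t) ->
     (forall n, measurable_fun setT (f n)) ->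
     (forall t, {homo f ^~ t : n k / (n <= k)%N >-> n <= k}) ->
     I (fun t => limn (f ^~ t)) = limn (fun n => I (f n))) ->
  (forall A, measurable A -> I (fun t => (\1_A t)%:E) = m A) ->
  forall f, (forall t, 0 <= f t) -> measurable_fun setT f ->
    \int[m]_t f t = I f.
Proof.
move=> ID IZ Ilim Iind f f0 mf.
pose g := nnsfun_approx measurableT mf.
have gf t : limn (fun n => (g n t)%:E) = f t.
  by apply/cvg_lim => //; apply: cvg_nnsfun_approx.
have mg n : measurable_fun setT (fun t => (g n t)%:E) by exact/measurable_EFinP.
have g0 n t : 0 <= (g n t)%:E by rewrite lee_fin.
have ndg t : {homo (fun n => (g n t)%:E) : n m / (n <= m)%N >-> n <= m}.
  by move=> n k nk; rewrite lee_fin; exact/lefP/nd_nnsfun_approx.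
have -> : \int[m]_t f t = limn (fun n => \int[m]_t (g n t)%:E).
  by rewrite -monotone_convergence//; apply: eq_integral => t _; rewrite gf.
have -> : f = (fun t => limn (fun n => (g n t)%:E)) by apply/funext => t; rewrite gf.
rewrite Ilim//; congr (limn _); apply/funext => n.
have mI (A : set T) : measurable A -> measurable_fun setT (fun t => (\1_A t)%:E : \bar R).
  by move=> mA; apply/measurable_EFinP; exact: measurable_indic.
have I0 : I (fun=> 0) = 0.
  have H := Iind _ measurable0; rewrite measure0 in H; rewrite -[RHS]H.
  congr I.
  by apply/funext => t /=; rewrite indicE in_set0.
rewrite integralT_nnsfun sintegralE fsbig_finite//=.
have -> : (fun t => (g n t)%:E) = (fun t => \sum_(r <- fset_set (range (g n)))
    (r%:E * (\1_(g n @^-1` [set r]) t)%:E)).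
  apply/funext => t; rewrite fimfunE fsbig_finite//= -sumEFin.
  by apply: eq_bigr => r _; rewrite EFinM.
have : forall r, r \in enum_fset (fset_set (range (g n))) -> (0 <= r)%R.
  move=> r; rewrite -[_ \in _]/(r \in fset_set (range (g n))).
  by rewrite in_fset_set// inE => -[t _ <-].
elim: (enum_fset (fset_set (range (g n)))) => [|r s IH] s0.
  by rewrite big_nil -[LHS]I0; congr I; apply/funext => t; rewrite big_nil.
have r0 : (0 <= r)%R by apply: s0; rewrite mem_head.
have s0' u : u \in s -> (0 <= u)%R by move=> us; apply: s0; rewrite inE us orbT.
under [in RHS]eq_fun do rewrite big_cons.
rewrite ID ?IZ ?Iind//.
- by rewrite big_cons IH.
- exact: mI.
- by move=> t; apply: mule_ge0; rewrite lee_fin.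
- by apply: emeasurable_funM => //; exact: mI.
- move=> t; rewrite big_seq; apply: sume_ge0 => u us.
  by apply: mule_ge0; rewrite lee_fin// s0'.
- apply: emeasurable_sum => u; apply: emeasurable_funM => //; exact: mI.
Qed.

Lemma ge0_integral_density (m1 m2 : {measure set T -> \bar R}) (w : T -> R)
    (f : T -> \bar R) :
  (forall t, 0 <= w t)%R -> measurable_fun setT w ->
  (forall A, measurable A -> m1 A = \int[m2]_(t in A) (w t)%:E) ->
  (forall t, 0 <= f t) -> measurable_fun setT f ->
  \int[m1]_t f t = \int[m2]_t ((w t)%:E * f t).
Proof.
move=> w0 mw m12 f0 mf.
have mwE : measurable_fun setT (fun t => (w t)%:E) by exact/measurable_EFinP.
have wf0 (h : T -> \bar R) t : (forall t, 0 <= h t) -> 0 <= (w t)%:E * h t.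
  by move=> h0; apply: mule_ge0; rewrite ?lee_fin.
apply: (ge0_integral_functional (I := fun f => \int[m2]_t ((w t)%:E * f t)))
  => //.
- move=> h h' h0 mh h'0 mh'; rewrite -ge0_integralD//; last 4 first.
  + by move=> t _; exact: wf0.
  + exact: emeasurable_funM.
  + by move=> t _; exact: wf0.
  + exact: emeasurable_funM.
  by apply: eq_integral => t _; rewrite ge0_muleDr.
- move=> r h r0 h0 mh; under eq_integral do rewrite muleCA.
  rewrite ge0_integralZl//; first exact: emeasurable_funM.
  by move=> t _; exact: wf0.
- move=> h h0 mh ndh; rewrite -monotone_convergence//.
  + apply: eq_integral => t _; rewrite -limeMl//.
    exact: ereal_nondecreasing_is_cvgn.
  + by move=> n; exact: emeasurable_funM.
  + by move=> n t _; exact: wf0.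
  + by move=> t _ n k nk; rewrite lee_wpmul2l ?lee_fin//; exact: ndh.
- move=> A mA; rewrite m12// [RHS]integral_mkcond/=.
  by apply: eq_integral => t _; rewrite epatch_indic.
Qed.

End integral_functional.

Section multiple_integral.
Context (R : realType) (V : eqType) d (Z : measurableType d).
Variable m : {sigma_finite_measure set Z -> \bar R}.
Local Open Scope ereal_scope.

(** The iterated integral against one fixed measure; unlike the general one it
does not depend on the order of the coordinates (mint_perm). *)
Definition mint (s : seq V) (f : (V -> Z) -> \bar R) (z : V -> Z) : \bar R :=
  iterated_integral (fun _ _ => m : set Z -> \bar R) s f z.

Lemma mint0 f z : mint [::] f z = f z. Proof. by []. Qed.

Lemma mint_cons v s f z : mint (v :: s) f z = \int[m]_t mint s f (upd z v t).
Proof.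
rewrite /mint /=; apply: eq_integral => t _.
by congr iterated_integral; apply/funext => w /=; rewrite /upd.
Qed.

Lemma mint_ge0 s f z : (forall z, 0 <= f z) -> 0 <= mint s f z.
Proof.
move=> f0; elim: s z => [|v s IH] z; first exact: f0.
by rewrite mint_cons; apply: integral_ge0.
Qed.

Lemma mint_cat s1 s2 f z : mint (s1 ++ s2) f z = mint s1 (mint s2 f) z.
Proof.
elim: s1 z => [//|v s1 IH] z; rewrite cat_cons !mint_cons.
by apply: eq_integral => t _; rewrite IH.
Qed.

(** The extra parameter T is what makes the induction on s go through: the
variable integrated first becomes part of the parameter. *)
Lemma measurable_mint_param dT (T : measurableType dT) s
    (f : T -> config V Z -> \bar R) :
  (forall t z, 0 <= f t z) ->
  measurable_fun setT (fun p : T * config V Z => f p.1 p.2) ->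
  measurable_fun setT (fun p : T * config V Z => mint s (f p.1) p.2).
Proof.
move=> f0 mf; elim: s => [//|v s IH].
under eq_fun do rewrite mint_cons.
apply: (measurable_fun_fubini_tonelli_F (m2 := m)
  (fun q : (T * config V Z) * Z => mint s (f q.1.1) (upd q.1.2 v q.2))) => /=.
- apply: (measurableT_comp (f := fun p : T * config V Z => mint s (f p.1) p.2)
    (g := fun q : (T * config V Z) * Z =>
            (q.1.1, upd q.1.2 v q.2 : config V Z))) => //.
  apply: measurable_fun_pair => /=.
    exact: (measurableT_comp measurable_fst measurable_fst).
  apply: (measurableT_comp (@measurable_upd V _ Z v)
    (g := fun q : (T * config V Z) * Z => (q.1.2, q.2))).
  apply: measurable_fun_pair => //=.
  exact: (measurableT_comp measurable_snd measurable_fst).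
- by move=> q; apply: mint_ge0.
Qed.

Lemma measurable_mint s (f : config V Z -> \bar R) :
  (forall z, 0 <= f z) -> measurable_fun setT f ->
  measurable_fun setT (mint s f : config V Z -> \bar R).
Proof.
move=> f0 mf.
have := @measurable_mint_param _ (config V Z) s (fun=> f) (fun=> f0).
move=> /(_ (measurableT_comp mf measurable_snd)) mm.
apply: (measurableT_comp mm (g := fun z => (z, z))).
exact: measurable_fun_pair.
Qed.

(** Coordinates outside s keep the values they have in z, so the integrands need
only agree on such configurations. *)
Lemma mint_eq s f f' z :
  (forall z', (forall w, w \notin s -> z' w = z w) -> f z' = f' z') ->
  mint s f z = mint s f' z.
Proof.
elim: s z => [|v s IH] z ff'; first exact: ff'.
rewrite !mint_cons; apply: eq_integral => t _; apply: IH => z' z'E.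
apply: ff' => w; rewrite inE negb_or => /andP[wv ws].
by rewrite z'E// /upd (negbTE wv).
Qed.

Lemma measurable_mint_upd s (f : config V Z -> \bar R) z v :
  (forall z, 0 <= f z) -> measurable_fun setT f ->
  measurable_fun setT (fun t => mint s f (upd z v t)).
Proof.
move=> f0 mf.
exact: (measurableT_comp (measurable_mint s f0 mf) (measurable_upd1 z v)).
Qed.

Lemma le_mint s (f f' : config V Z -> \bar R) z :
  (forall z, 0 <= f z) -> (forall z, f z <= f' z) ->
  measurable_fun setT f -> measurable_fun setT f' ->
  mint s f z <= mint s f' z.
Proof.
move=> f0 ff' mf mf'; have f'0 z' : 0 <= f' z' by exact: le_trans (ff' _).
elim: s z => [|v s IH] z; first exact: ff'.
rewrite !mint_cons; apply: ge0_le_integral => //.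
- by move=> t _; exact: mint_ge0.
- exact: measurable_mint_upd.
- exact: measurable_mint_upd.
Qed.

Lemma mint_integral dT (T : measurableType dT)
    (nu : {sigma_finite_measure set T -> \bar R}) s
    (f : T -> config V Z -> \bar R) z :
  (forall t z, 0 <= f t z) ->
  measurable_fun setT (fun p : T * config V Z => f p.1 p.2) ->
  \int[nu]_t mint s (f t) z = mint s (fun z => \int[nu]_t f t z) z.
Proof.
move=> f0 mf; elim: s z => [//|v s IH] z.
under eq_integral do rewrite mint_cons.
rewrite mint_cons.
rewrite (fubini_tonelli (fun p : T * Z => mint s (f p.1) (upd z v p.2)))//=.
- by apply: eq_integral => t _; exact: IH.
- apply: (measurableT_comp (measurable_mint_param s f0 mf)
    (g := fun p : T * Z => (p.1, upd z v p.2 : config V Z))) => //.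
  apply: measurable_fun_pair => //=.
  exact: (measurableT_comp (measurable_upd1 z v) measurable_snd).
- by move=> p; exact: mint_ge0.
Qed.

Lemma mint_swap s v w (f : config V Z -> \bar R) z :
  (forall z, 0 <= f z) -> measurable_fun setT f ->
  mint [:: v, w & s] f z = mint [:: w, v & s] f z.
Proof.
move=> f0 mf; have [->//|vw] := eqVneq v w.
rewrite !mint_cons; under eq_integral do rewrite mint_cons.
rewrite (fubini_tonelli (fun p : Z * Z => mint s f (upd (upd z v p.1) w p.2)))/=.
- apply: eq_integral => t _; rewrite mint_cons; apply: eq_integral => u _.
  by rewrite updC.
- apply: (measurableT_comp (measurable_mint s f0 mf)
    (g := fun p : Z * Z => upd (upd z v p.1) w p.2 : config V Z)).
  apply: (measurableT_comp (@measurable_upd _ _ Z w)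
    (g := fun p : Z * Z => (upd z v p.1 : config V Z, p.2))).
  apply: measurable_fun_pair => //=.
  exact: (measurableT_comp (measurable_upd1 z v) measurable_fst).
- by move=> p; exact: mint_ge0.
Qed.

Lemma mint_front s1 s2 v (f : config V Z -> \bar R) z :
  (forall z, 0 <= f z) -> measurable_fun setT f ->
  mint (s1 ++ v :: s2) f z = mint (v :: s1 ++ s2) f z.
Proof.
move=> f0 mf; elim: s1 z => [//|w s1 IH] z.
rewrite /= mint_swap// !(mint_cons w).
by apply: eq_integral => t _; rewrite IH.
Qed.

(** Tonelli, one transposition at a time. *)
Lemma mint_perm s t (f : config V Z -> \bar R) z :
  (forall z, 0 <= f z) -> measurable_fun setT f ->
  perm_eq s t -> mint s f z = mint t f z.
Proof.
move=> f0 mf; elim: s t z => [|v s IH] t z st.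
  by move: st; rewrite perm_sym => /perm_nilP ->.
have vt : v \in t by rewrite -(perm_mem st) mem_head.
case/splitPr: t / vt st => t1 t2 st.
rewrite mint_front// !mint_cons; apply: eq_integral => u _; apply: IH.
by move: st; rewrite perm_sym perm_catC cat_cons perm_cons perm_catC perm_sym.
Qed.

(** A factor that ignores the coordinates being integrated comes out. *)
Lemma mintZ s (h f : config V Z -> \bar R) z :
  (forall z, 0 <= f z) -> measurable_fun setT f -> (forall z, 0 <= h z) ->
  (forall z v t, v \in s -> h (upd z v t) = h z) ->
  mint s (fun z => h z * f z) z = h z * mint s f z.
Proof.
move=> f0 mf h0; elim: s z => [//|v s IH] z hE.
rewrite !mint_cons.
under eq_integral => t _.
  rewrite IH; last by move=> ? ? ? ws; rewrite hE// inE ws orbT.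
  rewrite hE ?mem_head//; over.
rewrite ge0_integralZl//; first exact: measurable_mint_upd.
by move=> t _; exact: mint_ge0.
Qed.

Lemma mintD s (f f' : config V Z -> \bar R) z :
  (forall z, 0 <= f z) -> measurable_fun setT f ->
  (forall z, 0 <= f' z) -> measurable_fun setT f' ->
  mint s (fun z => f z + f' z) z = mint s f z + mint s f' z.
Proof.
move=> f0 mf f'0 mf'; elim: s z => [//|v s IH] z.
rewrite !mint_cons -ge0_integralD//.
- by apply: eq_integral => t _; exact: IH.
- by move=> t _; exact: mint_ge0.
- exact: measurable_mint_upd.
- by move=> t _; exact: mint_ge0.
- exact: measurable_mint_upd.
Qed.

Lemma mint_lim s (f : nat -> config V Z -> \bar R) z :
  (forall n z, 0 <= f n z) -> (forall n, measurable_fun setT (f n)) ->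
  (forall z, {homo f ^~ z : n k / (n <= k)%N >-> n <= k}) ->
  mint s (fun z => limn (f ^~ z)) z = limn (fun n => mint s (f n) z).
Proof.
move=> f0 mf ndf; elim: s z => [//|v s IH] z.
rewrite mint_cons.
under [in RHS]eq_fun do rewrite mint_cons.
rewrite -monotone_convergence//.
- by apply: eq_integral => t _; exact: IH.
- by move=> n; exact: measurable_mint_upd.
- by move=> n t _; exact: mint_ge0.
- by move=> t _ n k nk; apply: le_mint => // z'; exact: ndf.
Qed.

Lemma mint_map (W : eqType) (psi : W -> V) s (f : (W -> Z) -> \bar R) z :
  injective psi ->
  iterated_integral (fun _ _ => m : set Z -> \bar R) (map psi s)
    (fun z => f (z \o psi)) z =
  iterated_integral (fun _ _ => m : set Z -> \bar R) s f (z \o psi).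
Proof.
move=> ipsi; elim: s z => [//|w s IH] z /=.
apply: eq_integral => t _; rewrite IH; congr iterated_integral.
by apply/funext => a /=; rewrite (inj_eq ipsi).
Qed.

End multiple_integral.

Lemma mint_mint (R : realType) (V W : eqType) d (Z : measurableType d)
    d' (Z' : measurableType d') (m : {sigma_finite_measure set Z -> \bar R})
    (m' : {sigma_finite_measure set Z' -> \bar R}) s s'
    (f : config V Z -> config W Z' -> \bar R) z z' :
  (forall z z', 0 <= f z z')%E ->
  measurable_fun setT (fun p : config V Z * config W Z' => f p.1 p.2) ->
  mint m s (fun z => mint m' s' (f z) z') z =
  mint m' s' (fun z' => mint m s (f ^~ z') z) z'.
Proof.
move=> f0 mf; elim: s z => [//|v s IH] z; rewrite mint_cons.
under eq_integral do rewrite IH.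
rewrite mint_integral.
- by apply: mint_eq => z'' _; rewrite mint_cons.
- by move=> *; exact: mint_ge0.
- have mf' : measurable_fun setT (fun p : config W Z' * config V Z => f p.2 p.1).
    apply: (measurableT_comp mf (g := fun p => (p.2, p.1))).
    exact: measurable_fun_pair.
  have /= := measurable_mint_param m s (f := fun z' z => f z z') _ mf'.
  move=> /(_ (fun t z => f0 z t)) mm.
  apply: (measurableT_comp mm
    (g := fun p : Z * config W Z' => (p.2, upd z v p.1 : config V Z))).
  apply: measurable_fun_pair => //=.
  exact: (measurableT_comp (measurable_upd1 z v) measurable_fst).
Qed.

(** * Likelihoods of binary shapes *)

(** Finite subtrees of the binary tree containing the root, by recursion on the
two branches. All subtrees over which a likelihood is taken are of this kind, up
to an embedding of the binary tree, and this makes the likelihood a structural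
recursion. *)
Inductive shape : Type := Empty | Node of shape & shape.

Fixpoint nodes (sh : shape) : seq (seq bool) :=
  if sh is Node l r then
    [::] :: (map (cons false) (nodes l) ++ map (cons true) (nodes r))
  else [::].

Fixpoint full (n : nat) : shape :=
  if n is n'.+1 then Node (full n') (full n') else Empty.

(** Observations on the subtree below the child b of the root. *)
Definition sub (T : Type) (y : seq bool -> T) (b : bool) : seq bool -> T :=
  fun w => y (b :: w).

Lemma cons_inj (b : bool) : injective (cons b).
Proof. by move=> u v []. Qed.

Lemma uniq_nodes sh : uniq (nodes sh).
Proof.
elim: sh => [//|l IHl r IHr] /=.
rewrite cat_uniq !(map_inj_uniq (@cons_inj _)) IHl IHr andbT mem_cat.
apply/andP; split; first by apply/norP; split; apply/mapP => -[].
by apply/hasPn => w /mapP[u _ ->]; apply/mapP => -[].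
Qed.

Lemma mem_nodes_cons l r b w :
  (b :: w \in nodes (Node l r)) = (w \in nodes (if b then r else l)).
Proof.
rewrite /= inE/= mem_cat.
have H c s : (b :: w \in map (cons c) s) = (b == c) && (w \in s).
  apply/mapP/andP => [[u us [-> ->]]|[/eqP-> ws]]; first by [].
  by exists w.
by rewrite !H; case: b {H} => //=; rewrite ?orbF.
Qed.

Lemma mem_full n w : (w \in nodes (full n)) = (size w < n)%N.
Proof.
elim: n w => [|n IH] [|b w] //.
by rewrite [full _]/= mem_nodes_cons if_same IH.
Qed.

Lemma words_size n w : (w \in words n) = (size w == n).
Proof.
elim: n w => [|n IH] w; first by rewrite inE; case: w.
apply/allpairsP/idP => [[[u b] /= [un _ ->]]|].
  by rewrite size_rcons eqSS -IH.
case/lastP: w => [//|w b]; rewrite size_rcons eqSS -IH => wn.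
by exists (w, b); split => //; case: b; rewrite !inE ?eqxx ?orbT.
Qed.

Lemma uniq_words n : uniq (words n).
Proof.
elim: n => [//|n IH]; apply: allpairs_uniq => //.
by move=> [u b] [v c] /= _ _ /rcons_inj[-> ->].
Qed.

Lemma mem_Tn_seq n w : (w \in Tn_seq n) = (size w <= n)%N.
Proof.
apply/flattenP/idP => [[s /mapP[k]]|wn].
  by rewrite mem_iota => /andP[_ kn] ->; rewrite words_size => /eqP->.
exists (words (size w)); last by rewrite words_size.
by apply/mapP; exists (size w) => //; rewrite mem_iota.
Qed.

Lemma uniq_Tn_seq n : uniq (Tn_seq n).
Proof.
rewrite /Tn_seq; move: (iota_uniq 0 n.+1); elim: (iota 0 n.+1) => [//|k s IH].
rewrite /= => /andP[ks us]; rewrite cat_uniq uniq_words IH// andbT.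
apply/hasPn => w /flattenP[t /mapP[j js ->]].
rewrite !words_size => /eqP ->; apply: contraNN ks => /eqP <-//.
Qed.

Lemma perm_full_Tn_seq n : perm_eq (nodes (full n.+1)) (Tn_seq n).
Proof.
apply: uniq_perm; [exact: uniq_nodes|exact: uniq_Tn_seq|].
by move=> w; rewrite mem_full mem_Tn_seq.
Qed.

Section shape_likelihood.
Context (R : realType) (dX dY : measure_display).
Context (X : measurableType dX) (Y : measurableType dY).
Variables (lambda : probability X R) (q : X -> X -> R) (g : X -> Y -> R).
Local Open Scope ereal_scope.

(** Given the state x of the root, the two branches are independent; integrating
out the states of the children gives the likelihood of the observations on sh. *)
Fixpoint likE (sh : shape) (x : X) (y : seq bool -> Y) : \bar R :=
  if sh is Node l r then
    (g x (y [::]))%:E *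
    ((\int[lambda]_x' ((q x x')%:E * likE l x' (sub y false))) *
     (\int[lambda]_x' ((q x x')%:E * likE r x' (sub y true))))
  else 1.

(** The likelihood of the observations on a branch when only the state x of the
parent of its root is given. *)
Definition branchE sh x y := \int[lambda]_x' ((q x x')%:E * likE sh x' y).

Lemma branchE_integral sh x y :
  branchE sh x y = \int[lambda]_x' ((q x x')%:E * likE sh x' y).
Proof. by []. Qed.

Lemma likE_node l r x y : likE (Node l r) x y =
  (g x (y [::]))%:E * (branchE l x (sub y false) * branchE r x (sub y true)).
Proof. by []. Qed.

Hypothesis q0 : forall x x', (0 <= q x x')%R.
Hypothesis g0 : forall x y, (0 <= g x y)%R.
Hypothesis mq : measurable_fun setT (fun z : X * X => q z.1 z.2).
Hypothesis mg : measurable_fun setT (fun z : X * Y => g z.1 z.2).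

Lemma likE_ge0 sh x y : 0 <= likE sh x y.
Proof.
elim: sh x y => [//|l IHl r IHr] x y; rewrite likE_node /branchE.
apply: mule_ge0; first by rewrite lee_fin.
by apply: mule_ge0; apply: integral_ge0 => x' _; apply: mule_ge0;
  rewrite ?lee_fin.
Qed.

Lemma branchE_ge0 sh x y : 0 <= branchE sh x y.
Proof.
apply: integral_ge0 => x' _; apply: mule_ge0; first by rewrite lee_fin.
exact: likE_ge0.
Qed.

Lemma measurable_sub dZ (Z : measurableType dZ) b :
  measurable_fun setT (fun y : config (seq bool) Z =>
    sub y b : config (seq bool) Z).
Proof. by apply: measurable_to_config => w; exact: measurable_coord. Qed.

(** Joint measurability in the state and the observations has to be proved for
both together, since each is defined from the other. *)
Lemma measurable_likE_branchE sh :
  measurable_fun setT (fun p : X * config (seq bool) Y => likE sh p.1 p.2) /\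
  measurable_fun setT (fun p : X * config (seq bool) Y => branchE sh p.1 p.2).
Proof.
have H s : measurable_fun setT
    (fun p : X * config (seq bool) Y => likE s p.1 p.2) ->
  measurable_fun setT (fun p : X * config (seq bool) Y => branchE s p.1 p.2).
  move=> ms; rewrite /branchE.
  apply: (measurable_fun_fubini_tonelli_F (m2 := lambda)
    (fun r : (X * config (seq bool) Y) * X =>
       (q r.1.1 r.2)%:E * likE s r.2 r.1.2)) => /=.
  - apply: emeasurable_funM.
    + apply/measurable_EFinP.
      apply: (measurableT_comp mq
        (g := fun r : (X * config (seq bool) Y) * X => (r.1.1, r.2))).
      apply: measurable_fun_pair => //=.
      exact: (measurableT_comp measurable_fst measurable_fst).
    + apply: (measurableT_comp ms
        (g := fun r : (X * config (seq bool) Y) * X => (r.2, r.1.2))).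
      apply: measurable_fun_pair => //=.
      exact: (measurableT_comp measurable_snd measurable_fst).
  - by move=> r; apply: mule_ge0; rewrite ?lee_fin// likE_ge0.
suff L : measurable_fun setT
    (fun p : X * config (seq bool) Y => likE sh p.1 p.2) by split=> //; exact: H.
elim: sh => [|l IHl r IHr]; first exact: measurable_cst.
under eq_fun do rewrite likE_node.
apply: emeasurable_funM; [|apply: emeasurable_funM].
- apply/measurable_EFinP.
  apply: (measurableT_comp mg
    (g := fun p : X * config (seq bool) Y => (p.1, p.2 [::]))).
  apply: measurable_fun_pair => //=.
  exact: (measurableT_comp (measurable_coord [::]) measurable_snd).
- apply: (measurableT_comp (H _ IHl)
    (g := fun p : X * config (seq bool) Y =>
      (p.1, sub p.2 false : config (seq bool) Y))).
  apply: measurable_fun_pair => //=.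
  exact: (measurableT_comp (measurable_sub false) measurable_snd).
- apply: (measurableT_comp (H _ IHr)
    (g := fun p : X * config (seq bool) Y =>
      (p.1, sub p.2 true : config (seq bool) Y))).
  apply: measurable_fun_pair => //=.
  exact: (measurableT_comp (measurable_sub true) measurable_snd).
Qed.

Lemma measurable_likE2 sh y : measurable_fun setT (likE sh ^~ y).
Proof.
have [mL _] := measurable_likE_branchE sh.
apply: (measurableT_comp mL
  (g := fun x : X => (x, y : config (seq bool) Y))).
by apply: measurable_fun_pair.
Qed.

Lemma measurable_likE1 sh x :
  measurable_fun setT (likE sh x : config (seq bool) Y -> \bar R).
Proof.
have [mL _] := measurable_likE_branchE sh.
apply: (measurableT_comp mL
  (g := fun y : config (seq bool) Y => (x, y))).
by apply: measurable_fun_pair.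
Qed.

Lemma measurable_branchE1 sh x :
  measurable_fun setT (branchE sh x : config (seq bool) Y -> \bar R).
Proof.
have [_ mL] := measurable_likE_branchE sh.
apply: (measurableT_comp mL
  (g := fun y : config (seq bool) Y => (x, y))).
by apply: measurable_fun_pair.
Qed.

Lemma measurable_qx x : measurable_fun setT (q x).
Proof.
apply: (measurableT_comp mq (g := fun x' : X => (x, x'))).
by apply: measurable_fun_pair.
Qed.

Lemma measurable_qlikE sh x y :
  measurable_fun setT (fun x' => (q x x')%:E * likE sh x' y).
Proof.
apply: emeasurable_funM; first by apply/measurable_EFinP; exact: measurable_qx.
exact: measurable_likE2.
Qed.

Hypothesis q1 : forall x, \int[lambda]_x' (q x x')%:E = 1.

Lemma likE_bounded sh : (exists b, forall x y, g x y <= b)%R ->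
  exists2 B : R, (0 <= B)%R & forall x y, likE sh x y <= B%:E.
Proof.
move=> [b gb].
have b0 : (0 <= b)%R by apply: le_trans (g0 point point) (gb _ _).
elim: sh => [|l [Bl Bl0 IHl] r [Br Br0 IHr]].
  by exists 1%R => // x y; rewrite lexx.
have H s B (B0 : (0 <= B)%R) (sB : forall x y, likE s x y <= B%:E) x y :
    branchE s x y <= B%:E.
  rewrite -[B%:E]mule1 -(q1 x) -ge0_integralZl//.
  - apply: ge0_le_integral => //.
    + by move=> x' _; apply: mule_ge0; rewrite ?lee_fin ?likE_ge0.
    + exact: measurable_qlikE.
    + apply: emeasurable_funM => //.
      by apply/measurable_EFinP; exact: measurable_qx.
    + by move=> x' _; rewrite muleC lee_wpmul2r// lee_fin.
  - by apply/measurable_EFinP; exact: measurable_qx.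
  - by move=> x' _; rewrite lee_fin.
exists (b * (Bl * Br))%R; first by rewrite !mulr_ge0.
move=> x y; rewrite likE_node !EFinM; apply: lee_pmul.
- by rewrite lee_fin.
- by apply: mule_ge0; exact: branchE_ge0.
- by rewrite lee_fin.
- by apply: lee_pmul; rewrite ?branchE_ge0//; exact: H.
Qed.

Lemma likE_fin_num sh x y : (exists b, forall x y, g x y <= b)%R ->
  likE sh x y \is a fin_num.
Proof.
move=> /(likE_bounded sh)[B _ LB]; rewrite ge0_fin_numE ?likE_ge0//.
exact: le_lt_trans (LB _ _) (ltry _).
Qed.

Section embedded.
Context (V : eqType) (par : V -> V) (yV : V -> Y).

(** The integrand of tree_likelihood: one factor per edge and its lower vertex. *)
Definition edge_weight (s : seq V) (z : V -> X) : R :=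
  (\prod_(v <- s) (q (z (par v)) (z v) * g (z v) (yV v)))%R.

Lemma edge_weight_ge0 s z : (0 <= edge_weight s z)%R.
Proof. by apply: prodr_ge0 => v _; apply: mulr_ge0. Qed.

Lemma measurable_edge_weight s :
  measurable_fun setT (fun z : config V X => (edge_weight s z)%:E).
Proof.
apply/measurable_EFinP; apply: measurable_prod => v _; apply: measurable_funM.
  apply: (measurableT_comp mq (g := fun z : config V X => (z (par v), z v))).
  by apply: measurable_fun_pair; exact: measurable_coord.
apply: (measurableT_comp mg (g := fun z : config V X => (z v, yV v))).
by apply: measurable_fun_pair; [exact: measurable_coord|exact: measurable_cst].
Qed.

Lemma edge_weight_upd s z v t :
  (forall w, w \in s -> w != v /\ par w != v) ->
  edge_weight s (upd z v t) = edge_weight s z.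
Proof.
move=> H; apply: eq_big_seq => w /H[wv pwv].
by rewrite /upd (negbTE wv) (negbTE pwv).
Qed.

(** Parent preserving injections of the binary tree into another tree: the
identity of T, and the copies of T below the ancestors of the origin. *)
Definition embedding (psi : seq bool -> V) :=
  injective psi /\ forall w b, par (psi (rcons w b)) = psi w.

Lemma embedding_sub psi b : embedding psi -> embedding (sub psi b).
Proof.
move=> [ipsi ppsi]; split; first by move=> u v /ipsi[].
by move=> w c; rewrite /sub -rcons_cons ppsi.
Qed.

Lemma embedding_par_sub psi b : embedding psi -> par (sub psi b [::]) = psi [::].
Proof. by move=> [_ ppsi]; rewrite /sub -[[:: b]]/(rcons [::] b) ppsi. Qed.

Lemma embedding_par psi b w : embedding psi ->
  par (psi (b :: w)) = psi (belast b w).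
Proof. by move=> [_ ppsi]; rewrite lastI ppsi. Qed.

(** The weights of the two branches involve disjoint sets of coordinates apart
from the state of the root, so the integral of the product factorises. *)
Lemma mint_branches l r psi : embedding psi ->
  (forall b z, mint lambda (map (sub psi b) (nodes (if b then r else l)))
     (fun z => (edge_weight
        (map (sub psi b) (nodes (if b then r else l))) z)%:E) z =
     branchE (if b then r else l) (z (psi [::])) (yV \o sub psi b)) ->
  forall z, let sl := map (sub psi false) (nodes l) in
  let sr := map (sub psi true) (nodes r) in
  mint lambda (sl ++ sr) (fun z => (edge_weight (sl ++ sr) z)%:E) z =
  branchE l (z (psi [::])) (yV \o sub psi false) *
  branchE r (z (psi [::])) (yV \o sub psi true).
Proof.
move=> epsi IH z sl sr; have [ipsi _] := epsi.
rewrite mint_cat.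
pose h z := branchE r (z (psi [::])) (yV \o sub psi true).
rewrite (@mint_eq _ _ _ _ _ sl _ (fun z => h z * (edge_weight sl z)%:E)).
  rewrite mintZ.
  - by rewrite (IH false) muleC.
  - by move=> z'; rewrite lee_fin edge_weight_ge0.
  - exact: measurable_edge_weight.
  - by move=> z'; exact: branchE_ge0.
  - move=> z' v t /mapP[w wl ->]; rewrite /h /upd; case: eqP => // /ipsi.
    by [].
move=> z' _.
rewrite (@mint_eq _ _ _ _ _ sr _
    (fun z => (edge_weight sl z)%:E * (edge_weight sr z)%:E)).
  rewrite mintZ.
  - by rewrite (IH true) muleC.
  - by move=> ?; rewrite lee_fin edge_weight_ge0.
  - exact: measurable_edge_weight.
  - by move=> ?; rewrite lee_fin edge_weight_ge0.
  - move=> z'' v t /mapP[w wl ->]; rewrite edge_weight_upd// => u /mapP[w' _ ->].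
    rewrite /sub embedding_par// !(inj_eq ipsi).
    by case/lastP: w' => // w' b'; rewrite belast_rcons.
by move=> z'' _; rewrite /edge_weight big_cat/= EFinM.
Qed.

Lemma mint_edge_weight sh psi z : embedding psi ->
  (forall w, par (psi [::]) != psi w) ->
  mint lambda (map psi (nodes sh))
    (fun z => (edge_weight (map psi (nodes sh)) z)%:E) z =
  branchE sh (z (par (psi [::]))) (yV \o psi).
Proof.
elim: sh psi z => [|l IHl r IHr] psi z epsi fpsi.
  rewrite /= mint0 /edge_weight big_nil /branchE /=.
  under eq_integral do rewrite mule1.
  by rewrite q1.
have [ipsi _] := epsi.
have IH b z' : mint lambda (map (sub psi b) (nodes (if b then r else l)))
     (fun z => (edge_weight
        (map (sub psi b) (nodes (if b then r else l))) z)%:E) z' =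
     branchE (if b then r else l) (z' (psi [::])) (yV \o sub psi b).
  rewrite -(embedding_par_sub b epsi).
  have eb := embedding_sub b epsi.
  have fb w : par (sub psi b [::]) != sub psi b w.
    by rewrite embedding_par_sub// (inj_eq ipsi).
  by case: b eb fb => eb fb; [exact: IHr|exact: IHl].
rewrite /= map_cat -!map_comp mint_cons /branchE.
apply: eq_integral => t _.
set s := _ ++ _.
rewrite (@mint_eq _ _ _ _ _ s _ (fun z => (q (z (par (psi [::]))) (z (psi [::]))
    * g (z (psi [::])) (yV (psi [::])))%:E * (edge_weight s z)%:E)); last first.
  by move=> z' _; rewrite /edge_weight big_cons EFinM.
rewrite mintZ.
- rewrite (mint_branches epsi IH) /upd eqxx (negbTE (fpsi [::])) likE_node.
  by rewrite EFinM -muleA.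
- by move=> z'; rewrite lee_fin edge_weight_ge0.
- exact: measurable_edge_weight.
- by move=> z'; rewrite lee_fin mulr_ge0.
- move=> z' v u vs.
  have [w [-> w0]] : exists w, v = psi w /\ w != [::].
    by move: vs; rewrite mem_cat => /orP[] /mapP[w _ ->]; eexists; split.
  by rewrite /upd (negbTE (fpsi w)) (inj_eq ipsi) eq_sym (negbTE w0).
Qed.

End embedded.

Lemma fine_EFinM (r : R) (e : \bar R) : fine (r%:E * e) = (r * fine e)%R.
Proof.
case: e => [s| |] //=; rewrite mulr_infty; have [-> | r0 | r0] := sgrP r;
  by rewrite ?mul0e ?mul1e ?mulN1e ?mul0r ?mulr0.
Qed.

Lemma perm_edge_weight (V : eqType) (par : V -> V) (yV : V -> Y) s t z :
  perm_eq s t -> edge_weight par yV s z = edge_weight par yV t z.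
Proof. by move=> st; rewrite /edge_weight (perm_big _ st). Qed.

(** The likelihood defined by an iterated integral in an arbitrary enumeration of
the vertices is the recursive one: reorder the coordinates and factorise over the
branches. *)
Lemma tree_likelihood_shape (V : choiceType) (par : V -> V) (psi : seq bool -> V)
    l r x (yV : V -> Y) : embedding par psi ->
  tree_likelihood lambda par q g (psi @` [set` nodes (Node l r)]) (psi [::]) x yV
  = fine (likE (Node l r) x (yV \o psi)).
Proof.
move=> epsi; have [ipsi _] := epsi; rewrite /tree_likelihood; case: asboolP.
  move=> /seteqP[+ _] => /(_ (psi [::])) [].
  by exists [::] => //=; rewrite inE.
move=> _; rewrite likE_node fine_EFinM; congr (_ * fine _)%R.
set s : seq V := fset_set _.
have [sl slE] : exists sl, sl = map (sub psi false) (nodes l) by eexists.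
have [sr srE] : exists sr, sr = map (sub psi true) (nodes r) by eexists.
have st : perm_eq s (sl ++ sr).
  apply: uniq_perm; first exact: fset_uniq.
  - have := uniq_nodes (Node l r) => /= /andP[_].
    rewrite -(map_inj_uniq ipsi) map_cat -!map_comp.
    by rewrite slE srE.
  - move=> v; rewrite mem_cat.
    rewrite in_fset_set; last first.
      apply: finite_setD; apply: finite_image; exact: finite_seq.
    rewrite slE srE /=; apply/idP/idP; rewrite in_setE.
      move=> [[w wn <-] wr]; move: wn; rewrite /mkset/= inE => /orP[/eqP w0|].
        by case: wr; rewrite w0.
      by rewrite mem_cat => /orP[] /mapP[u un ->]; apply/orP; [left|right];
        apply/mapP; exists u.
    move=> /orP[] /mapP[u un ->]; split.
    + by exists (false :: u) => //; rewrite /= inE mem_cat map_f.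
    + by move=> /ipsi.
    + by exists (true :: u) => //; rewrite /= inE mem_cat map_f ?orbT.
    + by move=> /ipsi.
have -> : (fun z => (\prod_(v <- s) (q (z (par v)) (z v) * g (z v) (yV v)))%:E) =
    (fun z => (edge_weight par yV (sl ++ sr) z)%:E).
  by apply/funext => z; rewrite -(perm_edge_weight par yV z st).
rewrite -/(mint lambda s _ _) (mint_perm lambda _ _ _ st).
- rewrite slE srE (mint_branches epsi)//= => b z.
  rewrite mint_edge_weight; [|exact: embedding_sub|].
    by rewrite (embedding_par_sub b epsi).
  by move=> w; rewrite (embedding_par_sub b epsi) (inj_eq ipsi).
- by move=> z; rewrite lee_fin edge_weight_ge0.
- exact: measurable_edge_weight.
Qed.

End shape_likelihood.

(** * Means of functionals of the observations *)

Section observation_expectation.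
Context (R : realType) (dX dY : measure_display).
Context (X : measurableType dX) (Y : measurableType dY).
Variables (lambda : probability X R) (mu : {sigma_finite_measure set Y -> \bar R}).
Variables (q : X -> X -> R) (g : X -> Y -> R).
Local Open Scope ereal_scope.
Hypothesis q0 : forall x x', (0 <= q x x')%R.
Hypothesis g0 : forall x y, (0 <= g x y)%R.
Hypothesis mq : measurable_fun setT (fun z : X * X => q z.1 z.2).
Hypothesis mg : measurable_fun setT (fun z : X * Y => g z.1 z.2).
Hypothesis q1 : forall x, \int[lambda]_x' (q x x')%:E = 1.
Hypothesis gb : (exists b, forall x y, g x y <= b)%R.
Hypothesis g1 : forall x, \int[mu]_y (g x y)%:E = 1.

Local Notation likE := (likE lambda q g).
Local Notation branchE := (branchE lambda q g).
Local Notation cfg := (config (seq bool) Y).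

(** The mean of F over the observations of height less than n given that the root
is in state x; deeper observations are frozen at the default point. *)
Definition obsE n (x : X) (F : cfg -> \bar R) : \bar R :=
  mint mu (nodes (full n)) (fun y => F y * likE (full n) x y) point.

(** The same mean when x is the state of the parent of the root. *)
Definition stepE n (x : X) (F : cfg -> \bar R) : \bar R :=
  \int[lambda]_x' ((q x x')%:E * obsE n x' F).

Lemma measurable_Flik n x (F : cfg -> \bar R) : measurable_fun setT F ->
  measurable_fun setT (fun y : cfg => F y * likE (full n) x y).
Proof.
by move=> mF; apply: emeasurable_funM => //; exact: measurable_likE1.
Qed.

Lemma Flik_ge0 n x (F : cfg -> \bar R) : (forall y, 0 <= F y) ->
  forall y, 0 <= F y * likE (full n) x y.
Proof. by move=> F0 y; apply: mule_ge0 => //; exact: likE_ge0. Qed.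

Lemma obsE_ge0 n x (F : cfg -> \bar R) : (forall y, 0 <= F y) -> 0 <= obsE n x F.
Proof. by move=> F0; apply: mint_ge0; exact: Flik_ge0. Qed.

Lemma measurable_obsE n (F : cfg -> \bar R) : (forall y, 0 <= F y) -> measurable_fun setT F ->
  measurable_fun setT (obsE n ^~ F).
Proof.
move=> F0 mF.
have := @measurable_mint_param _ _ _ _ mu _ _ (nodes (full n))
  (fun x y => F y * likE (full n) x y).
move=> /(_ (fun x => Flik_ge0 n x F0)) mm.
apply: (measurableT_comp (mm _) (g := fun x : X => (x, point : cfg))).
  apply: emeasurable_funM.
    exact: (measurableT_comp mF measurable_snd).
  by have [] := measurable_likE_branchE lambda q0 g0 mq mg (full n).
exact: measurable_fun_pair.
Qed.

Lemma obsED n x (F F' : cfg -> \bar R) : (forall y, 0 <= F y) -> measurable_fun setT F ->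
  (forall y, 0 <= F' y) -> measurable_fun setT F' ->
  obsE n x (fun y => F y + F' y) = obsE n x F + obsE n x F'.
Proof.
move=> F0 mF F'0 mF'; rewrite -mintD.
- by apply: mint_eq => y _; rewrite ge0_muleDl.
- exact: Flik_ge0.
- exact: measurable_Flik.
- exact: Flik_ge0.
- exact: measurable_Flik.
Qed.

Lemma obsEZ n x (r : R) (F : cfg -> \bar R) : (0 <= r)%R -> (forall y, 0 <= F y) ->
  measurable_fun setT F ->
  obsE n x (fun y => r%:E * F y) = r%:E * obsE n x F.
Proof.
move=> r0 F0 mF; rewrite -(@mintZ _ _ _ _ _ _ (fun=> r%:E)).
- by apply: mint_eq => y _; rewrite muleA.
- exact: Flik_ge0.
- exact: measurable_Flik.
- by move=> _; rewrite lee_fin.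
- by [].
Qed.

Lemma le_obsE n x (F F' : cfg -> \bar R) : (forall y, 0 <= F y) -> (forall y, F y <= F' y) ->
  measurable_fun setT F -> measurable_fun setT F' -> obsE n x F <= obsE n x F'.
Proof.
move=> F0 FF' mF mF'; apply: le_mint.
- exact: Flik_ge0.
- by move=> y; apply: lee_wpmul2r => //; exact: likE_ge0.
- exact: measurable_Flik.
- exact: measurable_Flik.
Qed.

Lemma obsE_lim n x (F : nat -> cfg -> \bar R) :
  (forall k y, 0 <= F k y) -> (forall k, measurable_fun setT (F k)) ->
  (forall y, {homo F ^~ y : k m / (k <= m)%N >-> k <= m}) ->
  obsE n x (fun y => limn (F ^~ y)) = limn (fun k => obsE n x (F k)).
Proof.
move=> F0 mF ndF; rewrite -mint_lim.
- apply: mint_eq => y _; rewrite muleC -limeMl.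
  + by congr (limn _); apply/funext => k; rewrite muleC.
  + exact: likE_fin_num.
  + exact: ereal_nondecreasing_is_cvgn.
- by move=> k; exact: Flik_ge0.
- by move=> k; exact: measurable_Flik.
- by move=> y k m km; apply: lee_wpmul2r; [exact: likE_ge0|exact: ndF].
Qed.

Lemma stepE_ge0 n x (F : cfg -> \bar R) : (forall y, 0 <= F y) -> 0 <= stepE n x F.
Proof.
move=> F0; apply: integral_ge0 => x' _; apply: mule_ge0; rewrite ?lee_fin//.
exact: obsE_ge0.
Qed.

Lemma stepE_branchE n x (F : cfg -> \bar R) : (forall y, 0 <= F y) -> measurable_fun setT F ->
  mint mu (nodes (full n)) (fun y => F y * branchE (full n) x y) point =
  stepE n x F.
Proof.
move=> F0 mF; rewrite /stepE /obsE.
have mL x' := measurable_Flik n x' mF.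
under [RHS]eq_integral => x' _.
  rewrite -(@mintZ _ _ _ _ mu _ (fun=> (q x x')%:E))//; last 2 first.
  - exact: Flik_ge0.
  - by rewrite lee_fin.
  over.
rewrite mint_integral.
- apply: mint_eq => y _; rewrite /branchE.
  rewrite -ge0_integralZl//.
  + by apply: eq_integral => x' _; rewrite muleCA.
  + exact: measurable_qlikE.
  + by move=> x' _; apply: mule_ge0; rewrite ?lee_fin ?likE_ge0.
- by move=> x' y; apply: mule_ge0; rewrite ?lee_fin//; exact: Flik_ge0.
- apply: emeasurable_funM.
    apply/measurable_EFinP.
    exact: (measurableT_comp (measurable_qx mq x) measurable_fst).
  apply: emeasurable_funM.
    exact: (measurableT_comp mF measurable_snd).
  by have [] := measurable_likE_branchE lambda q0 g0 mq mg (full n).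
Qed.

(** Given the state of the root, its observation and the two branches are
independent. *)
Lemma obsES n x (C : Y -> \bar R) (A B : cfg -> \bar R) :
  (forall y, 0 <= C y) -> measurable_fun setT C -> (forall y, 0 <= A y) ->
  measurable_fun setT A -> (forall y, 0 <= B y) -> measurable_fun setT B ->
  obsE n.+1 x (fun y => C (y [::]) * (A (sub y false) * B (sub y true))) =
  \int[mu]_y ((g x y)%:E * C y) * (stepE n x A * stepE n x B).
Proof.
move=> C0 mC A0 mA B0 mB; rewrite /obsE [nodes _]/= mint_cons.
pose N := nodes (full n).
pose a (y : cfg) := A y * branchE (full n) x y.
pose b (y : cfg) := B y * branchE (full n) x y.
have a0 y : 0 <= a y by apply: mule_ge0 => //; exact: branchE_ge0.
have b0 y : 0 <= b y by apply: mule_ge0 => //; exact: branchE_ge0.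
have ma : measurable_fun setT a.
  by apply: emeasurable_funM => //; exact: measurable_branchE1.
have mb : measurable_fun setT b.
  by apply: emeasurable_funM => //; exact: measurable_branchE1.
have mas c : measurable_fun setT (fun y : cfg => a (sub y c)).
  exact: (measurableT_comp ma (measurable_sub c)).
have mbs c : measurable_fun setT (fun y : cfg => b (sub y c)).
  exact: (measurableT_comp mb (measurable_sub c)).
have inner y : mint mu (map (cons false) N ++ map (cons true) N)
    (fun y => a (sub y false) * b (sub y true)) y =
    mint mu N a (sub y false) * mint mu N b (sub y true).
  rewrite mint_cat.
  pose h (y : cfg) := mint mu N b (sub y true).
  rewrite (@mint_eq _ _ _ _ mu _ _ (fun y : cfg => h y * a (sub y false))).
    rewrite mintZ//.
    - rewrite muleC; congr (_ * _).
      exact: (mint_map mu N a y (@cons_inj false)).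
    - by move=> y'; exact: mint_ge0.
    - by move=> y' v t /mapP[w _ ->].
  move=> y' _; rewrite mintZ//.
    by rewrite muleC; congr (_ * _); exact: (mint_map mu N b y' (@cons_inj true)).
  by move=> y'' v t /mapP[w _ ->].
have mgC : measurable_fun setT (fun t => (g x t)%:E * C t).
  apply: emeasurable_funM => //; apply/measurable_EFinP.
  apply: (measurableT_comp mg (g := fun y : Y => (x, y))).
  exact: measurable_fun_pair.
have gC0 t : 0 <= (g x t)%:E * C t by apply: mule_ge0; rewrite ?lee_fin.
transitivity (\int[mu]_t (((g x t)%:E * C t) *
    (mint mu N a point * mint mu N b point))).
  apply: eq_integral => t _.
  transitivity (mint mu (map (cons false) N ++ map (cons true) N)
    (fun y => ((g x (y [::]))%:E * C (y [::])) * (a (sub y false) * b (sub y true)))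
    (upd (point : seq bool -> Y) [::] t)).
    apply: mint_eq => y _; rewrite [full n.+1]/= likE_node /a /b.
    rewrite muleCA -[RHS]muleA; congr (_ * _); rewrite -muleA; congr (_ * _).
    by rewrite muleACA.
  rewrite mintZ.
  - have subE c : sub (upd (point : seq bool -> Y) [::] t) c = point.
      by apply: funext => u.
    by rewrite inner !subE /upd eqxx.
  - by move=> y; exact: mule_ge0.
  - exact: emeasurable_funM.
  - by move=> y; exact: gC0.
  - by move=> y v u; rewrite mem_cat => /orP[] /mapP[w _ ->].
rewrite ge0_integralZr//; last by apply: mule_ge0; exact: mint_ge0.
by congr (_ * (_ * _)); exact: stepE_branchE.
Qed.

Lemma stepE_1_of n x : (forall x, obsE n x (cst 1) = 1) ->
  stepE n x (cst 1) = 1.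
Proof.
by move=> H; rewrite /stepE; under eq_integral do rewrite H mule1; exact: q1.
Qed.

Lemma obsE_1 n x : obsE n x (cst 1) = 1.
Proof.
elim: n x => [|n IH] x; first by rewrite /obsE /= mint0 mule1.
transitivity (obsE n.+1 x (fun y => (cst 1) (y [::]) *
    ((cst 1) (sub y false) * (cst 1) (sub y true)))).
  by congr obsE; apply/funext => y; rewrite !mule1.
rewrite obsES// stepE_1_of// !mule1.
by under eq_integral do rewrite mule1; exact: g1.
Qed.

Lemma stepE_1 n x : stepE n x (cst 1) = 1.
Proof. by apply: stepE_1_of => x'; exact: obsE_1. Qed.

Lemma obsE_sub2 n x (A B : cfg -> \bar R) : (forall y, 0 <= A y) ->
  measurable_fun setT A -> (forall y, 0 <= B y) -> measurable_fun setT B ->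
  obsE n.+1 x (fun y => A (sub y false) * B (sub y true)) =
  stepE n x A * stepE n x B.
Proof.
move=> A0 mA B0 mB.
transitivity (obsE n.+1 x (fun y => (cst 1) (y [::]) *
    (A (sub y false) * B (sub y true)))).
  by congr obsE; apply/funext => y; rewrite mul1e.
rewrite obsES//; under eq_integral do rewrite mule1.
by rewrite g1 mul1e.
Qed.

Lemma obsE_sub b n x (A : cfg -> \bar R) : (forall y, 0 <= A y) -> measurable_fun setT A ->
  obsE n.+1 x (fun y => A (sub y b)) = stepE n x A.
Proof.
move=> A0 mA; case: b.
  transitivity (obsE n.+1 x (fun y => (cst 1) (sub y false) * A (sub y true))).
    by congr obsE; apply/funext => y; rewrite mul1e.
  by rewrite obsE_sub2// stepE_1 mul1e.
transitivity (obsE n.+1 x (fun y => A (sub y false) * (cst 1) (sub y true))).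
  by congr obsE; apply/funext => y; rewrite mule1.
by rewrite obsE_sub2// stepE_1 mule1.
Qed.

(** A functional F depends on the first n levels only iff it is invariant under
trunc n; stating it this way keeps measurability and integrals elementary. *)
Definition trunc n (y : cfg) : cfg :=
  fun w => if (size w < n)%N then y w else point.

Lemma measurable_trunc n : measurable_fun setT (trunc n).
Proof.
apply: measurable_to_config => w; rewrite /trunc; case: (size w < n)%N.
  exact: measurable_coord.
exact: measurable_cst.
Qed.

Lemma obsE_trunc n x (F : cfg -> \bar R) : obsE n x (F \o trunc n) = obsE n x F.
Proof.
apply: mint_eq => y yE /=; congr (F _ * _); apply/funext => w.
rewrite /trunc; case: ifPn => [//|wn].
by apply: esym; apply: (yE w); rewrite mem_full.
Qed.

End observation_expectation.

(** * The law of the observations of a hidden Markov tree *)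

Lemma prob_integral_cst (R : realType) d (T : measurableType d)
    (P : probability T R) (c : \bar R) : (\int[P]_t c = c)%E.
Proof.
rewrite (@integral_cst _ _ _ P setT measurableT) -[RHS]mule1; congr (_ * _)%E.
exact: probability_setT.
Qed.

Section observation_law.
Context (R : realType) (V : eqType) dY (Y : measurableType dY).
Context d (Omega : measurableType d) (P : probability Omega R).
Variable Yp : V -> {RV P >-> Y}.

Definition obs_map (w : Omega) : config V Y := fun v => Yp v w.

Lemma measurable_obs_map : measurable_fun setT obs_map.
Proof. by apply: measurable_to_config => v; exact: measurable_funPT. Qed.

HB.instance Definition _ :=
  isMeasurableFun.Build _ _ Omega (config V Y) obs_map measurable_obs_map.

Definition obs_law : probability (config V Y) R := distribution P obs_map.

Local Open Scope ereal_scope.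

Lemma ge0_integral_obs_law (F : config V Y -> \bar R) :
  (forall y, 0 <= F y) -> measurable_fun setT F ->
  \int[obs_law]_y F y = \int[P]_w F (fun v => Yp v w).
Proof. by move=> F0 mF; rewrite ge0_integral_distribution. Qed.

End observation_law.

(** No vertex of the enumeration is repeated, is the root, or comes before its
parent: the kernel used for a vertex is then fixed before it is integrated. *)
Fixpoint topo (s : seq (seq bool)) : bool :=
  if s is v :: s' then
    [&& v != [::], v \notin s', word_parent v \notin v :: s' & topo s']
  else true.

Lemma size_word_parent w : size (word_parent w) = (size w).-1.
Proof. by case: w => [//|b w]; rewrite size_belast. Qed.

Lemma topo_words_cat k t s : uniq t -> (forall v, v \in t -> size v = k.+1) ->
  (forall v, v \in s -> (k.+1 < size v)%N) -> topo s -> topo (t ++ s).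
Proof.
move=> + + sk ts; elim: t => [//|v t IH] /= /andP[vt ut] tk.
have vk : size v = k.+1 by apply: tk; rewrite mem_head.
have tk' u : u \in t -> size u = k.+1 by move=> ut'; apply: tk; rewrite inE ut' orbT.
apply/and4P; split.
- by apply/eqP => v0; rewrite v0 in vk.
- rewrite mem_cat (negbTE vt) /=; apply/negP => /sk.
  by rewrite vk ltnn.
- have pk : size (word_parent v) = k by rewrite size_word_parent vk.
  rewrite inE mem_cat !negb_or; apply/and3P; split.
  + by apply/eqP => pv; move: pk; rewrite pv vk => /eqP; rewrite gtn_eqF.
  + by apply/negP => /tk'; rewrite pk => /eqP; rewrite ltn_eqF.
  + by apply/negP => /sk; rewrite pk ltnNge ltnW.
- by apply: IH => // u ut'; exact: tk'.
Qed.

Definition Tn_rest n := flatten [seq words k | k <- iota 1 n].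

Lemma Tn_seqE n : Tn_seq n = [::] :: Tn_rest n.
Proof. by []. Qed.

Lemma mem_levels k m w : w \in flatten [seq words j | j <- iota k m] ->
  (k <= size w)%N.
Proof.
move=> /flattenP[s /mapP[j]]; rewrite mem_iota => /andP[kj _] ->.
by rewrite words_size => /eqP ->.
Qed.

Lemma topo_Tn_rest n : topo (Tn_rest n).
Proof.
rewrite /Tn_rest; move: (0%N) => k; elim: n k => [//|n IH] k.
rewrite -[flatten _]/(words k.+1 ++ flatten [seq words j | j <- iota k.+2 n]).
apply: topo_words_cat.
- exact: uniq_words.
- by move=> v; rewrite words_size => /eqP ->.
- by move=> v /mem_levels.
- exact: IH.
Qed.

Lemma embedding_word_parent : embedding word_parent id.
Proof. by split => // w b; case: w => [//|a w]; rewrite /= belast_rcons. Qed.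

Section hmt_expectation.
Context (R : realType) (dX dY : measure_display).
Context (X : measurableType dX) (Y : measurableType dY).
Variables (lambda : probability X R) (mu : {sigma_finite_measure set Y -> \bar R}).
Variables (q : X -> X -> R) (g : X -> Y -> R).
Variables (Q : R.-pker X ~> X) (G : R.-pker X ~> Y).
Local Open Scope ereal_scope.
Hypothesis q0 : forall x x', (0 <= q x x')%R.
Hypothesis g0 : forall x y, (0 <= g x y)%R.
Hypothesis mq : measurable_fun setT (fun z : X * X => q z.1 z.2).
Hypothesis mg : measurable_fun setT (fun z : X * Y => g z.1 z.2).
Hypothesis gb : (exists b, forall x y, g x y <= b)%R.
Hypothesis QE : forall x A, measurable A -> Q x A = \int[lambda]_(x' in A) (q x x')%:E.
Hypothesis GE : forall x A, measurable A -> G x A = \int[mu]_(y in A) (g x y)%:E.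

Lemma kernel_density_q1 x : \int[lambda]_x' (q x x')%:E = 1.
Proof. by rewrite -QE// prob_kernel. Qed.

Lemma kernel_density_g1 x : \int[mu]_y (g x y)%:E = 1.
Proof. by rewrite -GE// prob_kernel. Qed.

Lemma measurable_gx x : measurable_fun setT (g x).
Proof.
apply: (measurableT_comp mg (g := fun y : Y => (x, y))).
exact: measurable_fun_pair.
Qed.

(** The kernels may be replaced by their densities one vertex at a time, from the
innermost integral outwards. *)
Lemma iterated_emission (W : eqType) (s : seq W) (x : W -> X)
    (f : config W Y -> \bar R) z : uniq s -> (forall y, 0 <= f y) ->
  measurable_fun setT f ->
  iterated_integral (fun v (_ : W -> Y) => G (x v) : set Y -> \bar R) s f z =
  mint mu s (fun y => (\prod_(v <- s) g (x v) (y v))%:E * f y) z.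
Proof.
move=> + f0 mf; elim: s z => [z _|v s IH z /= /andP[vs us]].
  by rewrite mint0 big_nil mul1e.
have mp : measurable_fun setT
    (fun y : config W Y => (\prod_(v <- s) g (x v) (y v))%:E).
  apply/measurable_EFinP; apply: measurable_prod => u _.
  exact: (measurableT_comp (measurable_gx _) (measurable_coord u)).
have p0 (y : config W Y) : 0 <= (\prod_(v <- s) g (x v) (y v))%:E * f y.
  by apply: mule_ge0 => //; rewrite lee_fin prodr_ge0.
have mpf : measurable_fun setT
    (fun y : config W Y => (\prod_(v <- s) g (x v) (y v))%:E * f y).
  exact: emeasurable_funM.
rewrite mint_cons.
transitivity (\int[G (x v)]_t
    mint mu s (fun y => (\prod_(v <- s) g (x v) (y v))%:E * f y) (upd z v t)).
  by apply: eq_integral => t _; rewrite -IH//; congr iterated_integral; apply/funext.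
rewrite (@ge0_integral_density _ _ _ _ mu (g (x v)))//.
- apply: eq_integral => t _.
  transitivity (mint mu s (fun y => (g (x v) (y v))%:E *
      ((\prod_(v <- s) g (x v) (y v))%:E * f y)) (upd z v t)).
    rewrite [RHS]mintZ//.
    + by rewrite /upd eqxx.
    + by move=> y; rewrite lee_fin.
    + move=> y u t' us'; rewrite /upd; case: eqP => // vu.
      by rewrite vu us' in vs.
  by apply: mint_eq => y _; rewrite big_cons EFinM muleA.
- exact: measurable_gx.
- by move=> A mA; exact: GE.
- by move=> t; exact: mint_ge0.
- exact: measurable_mint_upd.
Qed.

(** The kernel that hmt_law attaches to the vertex v. *)
Definition hmt_transition (nu : probability X R) (v : seq bool)
    (x : seq bool -> X) : set X -> \bar R :=
  if v is [::] then (nu : set X -> \bar R) else Q (x (word_parent v)).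

Lemma iterated_transition nu (s : seq (seq bool))
    (f : config (seq bool) X -> \bar R) z : topo s -> (forall y, 0 <= f y) ->
  measurable_fun setT f ->
  iterated_integral (hmt_transition nu) s f z =
  mint lambda s
    (fun x => (\prod_(v <- s) q (x (word_parent v)) (x v))%:E * f x) z.
Proof.
move=> + f0 mf; elim: s z => [z _|v s IH z /= /and4P[v0 vs pvs ts]].
  by rewrite mint0 big_nil mul1e.
have mp : measurable_fun setT
    (fun x : config (seq bool) X => (\prod_(v <- s) q (x (word_parent v)) (x v))%:E).
  apply/measurable_EFinP; apply: measurable_prod => u _.
  apply: (measurableT_comp mq
    (g := fun x : config (seq bool) X => (x (word_parent u), x u))).
  by apply: measurable_fun_pair; exact: measurable_coord.
have p0 (x : config (seq bool) X) :
    0 <= (\prod_(v <- s) q (x (word_parent v)) (x v))%:E * f x.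
  by apply: mule_ge0 => //; rewrite lee_fin prodr_ge0.
have mpf : measurable_fun setT (fun x : config (seq bool) X =>
    (\prod_(v <- s) q (x (word_parent v)) (x v))%:E * f x).
  exact: emeasurable_funM.
have [pv ps] : word_parent v != v /\ word_parent v \notin s.
  by move: pvs; rewrite inE negb_or => /andP.
rewrite mint_cons.
have -> : hmt_transition nu v z = Q (z (word_parent v)) :> (set X -> \bar R).
  by case: v v0 {vs pvs pv ps}.
transitivity (\int[Q (z (word_parent v))]_t
    mint lambda s (fun x => (\prod_(v <- s) q (x (word_parent v)) (x v))%:E * f x)
    (upd z v t)).
  by apply: eq_integral => t _; rewrite -IH//; congr iterated_integral; apply/funext.
rewrite (@ge0_integral_density _ _ _ _ lambda (q (z (word_parent v))))//.
- apply: eq_integral => t _.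
  transitivity (mint lambda s (fun x => (q (x (word_parent v)) (x v))%:E *
      ((\prod_(v <- s) q (x (word_parent v)) (x v))%:E * f x)) (upd z v t)).
    rewrite [RHS]mintZ//.
    + by rewrite /upd eqxx (negbTE pv).
    + by move=> x; rewrite lee_fin.
    + move=> x u t' us'; rewrite /upd.
      case: eqP => [vu|_]; first by rewrite vu us' in ps.
      by case: eqP => // vu; rewrite vu us' in vs.
  by apply: mint_eq => x _; rewrite big_cons EFinM muleA.
- exact: measurable_qx.
- by move=> A mA; exact: QE.
- by move=> t; exact: mint_ge0.
- exact: measurable_mint_upd.
Qed.

Local Notation cfg := (config (seq bool) Y).
Local Notation obsE := (obsE lambda mu q g).

Lemma mint_Tn_rest n t (y : seq bool -> Y) z :
  mint lambda (Tn_rest n)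
    (fun x => (edge_weight q g word_parent y (Tn_rest n) x)%:E)
    (upd z [::] t) =
  branchE lambda q g (full n) t (sub y false) *
  branchE lambda q g (full n) t (sub y true).
Proof.
have pe : perm_eq (Tn_rest n)
    (map (sub id false) (nodes (full n)) ++ map (sub id true) (nodes (full n))).
  have := perm_full_Tn_seq n; rewrite Tn_seqE [nodes _]/= perm_cons perm_sym.
  by [].
have -> : (fun x => (edge_weight q g word_parent y (Tn_rest n) x)%:E) =
    (fun x => (edge_weight q g word_parent y (map (sub id false) (nodes (full n))
      ++ map (sub id true) (nodes (full n))) x)%:E).
  by apply/funext => x; rewrite (perm_edge_weight _ _ _ _ _ pe).
rewrite (mint_perm lambda _ _ _ pe); last 2 first.
- by move=> x; rewrite lee_fin edge_weight_ge0.
- exact: measurable_edge_weight.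
rewrite (@mint_branches _ _ _ _ _ lambda q g q0 g0 mq mg _ word_parent y (full n)
  (full n) id embedding_word_parent).
  by rewrite /upd /=.
have q1 := kernel_density_q1.
move=> b z'; rewrite if_same (mint_edge_weight q0 g0 mq mg q1); last 2 first.
- exact: (embedding_sub b embedding_word_parent).
- by move=> w; rewrite (embedding_par_sub b embedding_word_parent).
by rewrite (embedding_par_sub b embedding_word_parent).
Qed.

(** All the kernels are replaced by densities, the states are integrated out and
the likelihood of the observations is what remains. *)
Lemma hmt_law_obs nu n (A : set cfg) : measurable A ->
  hmt_law Q G nu n [set c : seq bool -> X * Y | A (trunc n.+1 (snd \o c))] =
  \int[nu]_t obsE n.+1 t (fun y => (\1_A y)%:E).
Proof.
move=> mA; set C := [set c | _].
pose p1 (x : config (seq bool) X) := (\prod_(v <- Tn_rest n) q (x (word_parent v)) (x v))%R.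
pose p2 (x : config (seq bool) X) (y : cfg) := (\prod_(v <- Tn_seq n) g (x v) (y v))%R.
have p10 x : (0 <= p1 x)%R by apply: prodr_ge0.
have p20 x y : (0 <= p2 x y)%R by apply: prodr_ge0.
have mp1 : measurable_fun setT (fun x => (p1 x)%:E).
  apply/measurable_EFinP; apply: measurable_prod => u _.
  apply: (measurableT_comp mq
    (g := fun x : config (seq bool) X => (x (word_parent u), x u))).
  by apply: measurable_fun_pair; exact: measurable_coord.
have mp2 : measurable_fun setT
    (fun p : config (seq bool) X * cfg => (p2 p.1 p.2)%:E).
  apply/measurable_EFinP; apply: measurable_prod => u _.
  apply: (measurableT_comp mg
    (g := fun p : config (seq bool) X * cfg => (p.1 u, p.2 u))).
  apply: measurable_fun_pair.
    exact: (measurableT_comp (measurable_coord u) measurable_fst).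
  exact: (measurableT_comp (measurable_coord u) measurable_snd).
pose IA (y : cfg) : \bar R := (\1_A (trunc n.+1 y))%:E.
have IA0 y : 0 <= IA y by rewrite lee_fin.
have mIA : measurable_fun setT IA.
  apply/measurable_EFinP.
  exact: (measurableT_comp (measurable_indic mA) (measurable_trunc n.+1)).
have mp2x x : measurable_fun setT (fun y => (p2 x y)%:E).
  apply: (measurableT_comp mp2 (g := fun y : cfg => (x, y))).
  exact: measurable_fun_pair.
transitivity (\int[nu]_t mint mu (Tn_seq n)
   (fun y => IA y * likE lambda q g (full n.+1) t y) point); last first.
  apply: eq_integral => t _; rewrite -[RHS]obsE_trunc /obsE.
  rewrite -(mint_perm mu _ _ _ (perm_full_Tn_seq n)) //.
  - by move=> y; apply: mule_ge0 => //; exact: likE_ge0.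
  - by apply: emeasurable_funM => //; exact: measurable_likE1.
rewrite /hmt_law {1}Tn_seqE -/(hmt_transition nu).
transitivity (\int[nu]_t iterated_integral (hmt_transition nu) (Tn_rest n)
   (fun x => mint mu (Tn_seq n) (fun y => (p2 x y)%:E * IA y) point)
   (upd (point : seq bool -> X) [::] t)).
  apply: eq_integral => t _ /=.
  have -> : (fun x : seq bool -> X => iterated_integral
      (fun v (_ : seq bool -> Y) => G (x v) : set Y -> \bar R) (Tn_seq n)
      (fun y => (\1_C (fun v => (x v, y v)))%:E) (fun=> point)) =
      (fun x => mint mu (Tn_seq n) (fun y => (p2 x y)%:E * IA y) point).
    apply/funext => x; rewrite -iterated_emission//; first exact: uniq_Tn_seq.
  by congr iterated_integral; apply/funext.
have p2IA0 x y : 0 <= (p2 x y)%:E * IA y by apply: mule_ge0; rewrite ?lee_fin.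
have mp2IA : measurable_fun setT
    (fun p : config (seq bool) X * cfg => (p2 p.1 p.2)%:E * IA p.2).
  apply: emeasurable_funM => //; exact: (measurableT_comp mIA measurable_snd).
apply: eq_integral => t _; rewrite iterated_transition; first last.
- have mm := measurable_mint_param mu (Tn_seq n) p2IA0 mp2IA.
  apply: (measurableT_comp mm
    (g := fun x : config (seq bool) X => (x, point : cfg))).
  exact: measurable_fun_pair.
- by move=> x; exact: mint_ge0.
- exact: topo_Tn_rest.
transitivity (mint lambda (Tn_rest n) (fun x => mint mu (Tn_seq n)
   (fun y => (p1 x)%:E * ((p2 x y)%:E * IA y)) point) (upd (point : seq bool -> X) [::] t)).
  apply: mint_eq => x _; rewrite [RHS]mintZ//.
  - exact: emeasurable_funM.
  - by move=> y; rewrite lee_fin.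
rewrite mint_mint; last 2 first.
- by move=> x y; rewrite !mule_ge0// lee_fin.
- apply: emeasurable_funM => //.
  exact: (measurableT_comp mp1 measurable_fst).
apply: mint_eq => y _.
transitivity (mint lambda (Tn_rest n) (fun x => (IA y * (g (x [::]) (y [::]))%:E) *
    (edge_weight q g word_parent y (Tn_rest n) x)%:E) (upd (point : seq bool -> X) [::] t)).
  apply: mint_eq => x _; rewrite /p1 /p2 Tn_seqE big_cons.
  rewrite muleA [LHS]muleC -[RHS]muleA; congr (_ * _); rewrite -!EFinM.
  congr (_%:E).
  by rewrite mulrCA -big_split.
rewrite mintZ.
- by rewrite mint_Tn_rest /upd eqxx [full n.+1]/= likE_node -muleA.
- by move=> x; rewrite lee_fin edge_weight_ge0.
- exact: measurable_edge_weight.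
- by move=> x; rewrite mule_ge0// lee_fin.
- move=> x v u vr; rewrite /upd; case: eqP => // v0.
  by have := mem_levels vr; rewrite -v0.
Qed.

Lemma coord_sigma_trunc n (A : set cfg) : measurable A ->
  coord_sigma (Tn n) [set c : seq bool -> X * Y | A (trunc n.+1 (snd \o c))].
Proof.
move=> mA; set gen := [set C : set (seq bool -> X * Y) |
  exists v (A : set (X * Y)), [/\ Tn n v, measurable A & C = [set z | A (z v)]]].
pose T : measurableType _ := g_sigma_algebraType gen.
pose f (c : T) : cfg := trunc n.+1 (snd \o (c : seq bool -> X * Y)).
have mf : measurable_fun setT f.
  apply: measurable_to_config => w; rewrite /f /trunc.
  case: (boolP (size w < n.+1)%N) => wn; last exact: measurable_cst.
  move=> _ B mB; rewrite setTI; apply: sub_gen_smallest.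
  exists w, (setT `*` B); split => //; first exact: measurableX.
  by apply/seteqP; split => c /=; [|case].
have := mf measurableT A mA; rewrite setTI; exact.
Qed.

(** Known on events by hmt_law_obs, extended to all functionals by
ge0_integral_functional. *)
Lemma integral_hmt_obs nu d (Omega : measurableType d) (P : probability Omega R)
    (Xp : seq bool -> {RV P >-> X}) (Yp : seq bool -> {RV P >-> Y}) n
    (F : cfg -> \bar R) : is_HMT Xp Yp Q G nu ->
  (forall y, 0 <= F y) -> measurable_fun setT F ->
  \int[obs_law Yp]_y F (trunc n y) = \int[nu]_t obsE n t F.
Proof.
have q1 := kernel_density_q1; have g1 := kernel_density_g1.
move=> hmm F0 mF; case: n => [|n].
  under [RHS]eq_integral do rewrite /obsE /= mint0 mule1.
  rewrite prob_integral_cst -[RHS](prob_integral_cst (obs_law Yp)).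
  by apply: eq_integral => y _; congr F; apply: funext.
have mt := @measurable_trunc _ Y n.+1.
rewrite -(ge0_integral_pushforward mt (obs_law Yp) measurableT mF)//.
apply: (ge0_integral_functional (I := fun F => \int[nu]_t obsE n.+1 t F)) => //.
- move=> f f' f0 mf f'0 mf'; rewrite -ge0_integralD//.
  + by apply: eq_integral => t _; rewrite obsED.
  + by move=> t _; exact: obsE_ge0.
  + exact: measurable_obsE.
  + by move=> t _; exact: obsE_ge0.
  + exact: measurable_obsE.
- move=> r f r0 f0 mf; rewrite -ge0_integralZl//.
  + by apply: eq_integral => t _; rewrite obsEZ.
  + exact: measurable_obsE.
  + by move=> t _; exact: obsE_ge0.
- move=> f f0 mf ndf; rewrite -monotone_convergence//.
  + by apply: eq_integral => t _; rewrite obsE_lim.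
  + by move=> k; exact: measurable_obsE.
  + by move=> k t _; exact: obsE_ge0.
  + by move=> t _ k m km; apply: le_obsE => // y; exact: ndf.
- move=> A mA; rewrite -hmt_law_obs//.
  rewrite -(hmm n); last exact: coord_sigma_trunc.
  by [].
Qed.

End hmt_expectation.

(** * Integral estimates and Doeblin contraction *)

Section real_integrals.
Context (R : realType) d (T : measurableType d).
Variable m : {measure set T -> \bar R}.
Local Open Scope ereal_scope.

Lemma ge0_integralD_EFin (u v : T -> R) : (forall t, 0 <= u t)%R ->
  measurable_fun setT u -> (forall t, 0 <= v t)%R -> measurable_fun setT v ->
  \int[m]_t (u t + v t)%:E = \int[m]_t (u t)%:E + \int[m]_t (v t)%:E.
Proof.
move=> u0 mu v0 mv; under eq_integral do rewrite EFinD.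
by rewrite ge0_integralD//; do ?[exact/measurable_EFinP|
  by move=> t _; rewrite lee_fin].
Qed.

Lemma ge0_integralZl_EFin' (k : R) (u : T -> R) : (0 <= k)%R ->
  (forall t, 0 <= u t)%R -> measurable_fun setT u ->
  \int[m]_t (k * u t)%:E = k%:E * \int[m]_t (u t)%:E.
Proof.
move=> k0 u0 mu; under eq_integral do rewrite EFinM.
by rewrite ge0_integralZl//; do ?[exact/measurable_EFinP|
  by move=> t _; rewrite lee_fin].
Qed.

Lemma le_integral_EFin (u v : T -> R) : (forall t, 0 <= u t)%R ->
  measurable_fun setT u -> measurable_fun setT v -> (forall t, u t <= v t)%R ->
  \int[m]_t (u t)%:E <= \int[m]_t (v t)%:E.
Proof.
move=> u0 mu mv uv; apply: ge0_le_integral => //; do ?[exact/measurable_EFinP|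
  by move=> t _; rewrite lee_fin].
Qed.

Lemma integral_EFin_ge0 (u : T -> R) : (forall t, 0 <= u t)%R ->
  0 <= \int[m]_t (u t)%:E.
Proof. by move=> u0; apply: integral_ge0 => t _; rewrite lee_fin. Qed.

End real_integrals.

Lemma ge0_lty_EFin (R : realType) (e : \bar R) : (0 <= e)%E -> (e < +oo)%E ->
  exists2 r : R, (0 <= r)%R & e = r%:E.
Proof. by case: e => [r| |]// ; rewrite lee_fin => r0 _; exists r. Qed.

(** The sum of the f_n^2 has a finite mean, hence is almost everywhere finite, and
its terms tend to 0. *)
Lemma ae_cvg0_of_summable (R : realType) d (T : measurableType d)
    (m : {measure set T -> \bar R}) (f : nat -> T -> R) (K r : R) :
  0 <= r < 1 -> (forall n, measurable_fun setT (f n)) ->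
  (forall n, \int[m]_t (f n t ^+ 2)%:E <= (K * r ^+ n)%:E)%E ->
  \forall t \ae m, (fun n => f n t) @ \oo --> (0 : R).
Proof.
move=> /andP[r0 r1] mf fK.
pose F t : \bar R := (\sum_(0 <= n <oo) (f n t ^+ 2)%:E)%E.
have mf2 n : measurable_fun setT (fun t => (f n t ^+ 2)%:E).
  by apply/measurable_EFinP; exact: measurable_funX.
have f20 n t : (0 <= (f n t ^+ 2)%:E)%E by rewrite lee_fin sqr_ge0.
have F0 t : (0 <= F t)%E by apply: nneseries_ge0.
have mF : measurable_fun setT F by apply: ge0_emeasurable_sum.
have intF : (\int[m]_t F t < +oo)%E.
  rewrite integral_nneseries//.
  apply: (@le_lt_trans _ _ (\sum_(0 <= n <oo) (K * r ^+ n)%:E)%E).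
    apply: lee_nneseries => // n _ _; exact: integral_ge0.
  have -> : (\sum_(0 <= n <oo) (K * r ^+ n)%:E)%E = (K / (1 - r))%:E.
    have h : series (geometric K r) @ \oo --> K * (1 - r)^-1.
      by apply: cvg_geometric_series; rewrite ger0_norm.
    apply/cvg_lim => //.
    rewrite (_ : (fun n => _) = EFin \o series (geometric K r)).
      by apply: cvg_EFin => //; exact: nearW.
    by apply/funext => n /=; rewrite /series /= -sumEFin.
  exact: ltry.
have iF : m.-integrable setT F.
  apply/integrableP; split => //.
  by under eq_integral do rewrite gee0_abs//.
have := integrable_ae measurableT iF.
apply: filterS => t /(_ I) Ffin.
have tail : (\sum_(n <= k <oo) (f k t ^+ 2)%:E)%E @[n --> \oo] --> (0 : \bar R).
  by apply: nneseries_tail_cvg => //; rewrite -ge0_fin_numE// F0.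
have sqE : (fun n => (f n t ^+ 2)%:E) @ \oo --> (0 : \bar R).
  apply: (squeeze_cvge _ (cvg_cst _) tail).
  apply: nearW => n; rewrite f20 /=.
  have := @nneseries_lim_ge R (fun k => (f k t ^+ 2)%:E) xpredT n n.+1.
  by rewrite big_nat1; apply.
have sq : (fun n => f n t ^+ 2) @ \oo --> (0 : R) by apply: fine_cvg sqE.
apply/cvgr0Pnorm_lt => e e0.
have e20 : 0 < e ^+ 2 by rewrite exprn_gt0.
move/cvgr0Pnorm_lt: sq => /(_ _ e20); apply: filterS => n.
by rewrite normrX ltr_pXn2r// nnegrE// ltW.
Qed.

Section doeblin.
Context (R : realType) (dX : measure_display) (X : measurableType dX).
Variables (lambda : probability X R) (q : X -> X -> R) (sm sp : R).
Hypothesis sm0 : 0 < sm.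
Hypothesis qb : forall x x', sm <= q x x' <= sp.
Hypothesis mq : measurable_fun setT (fun z : X * X => q z.1 z.2).

Let q0 x x' : 0 <= q x x'.
Proof. by case/andP: (qb x x') => h _; exact: le_trans (ltW sm0) h. Qed.

Lemma smsp : sm <= sp.
Proof. by case/andP: (qb point point) => h /(le_trans h). Qed.

Lemma sp_gt0 : 0 < sp. Proof. exact: lt_le_trans sm0 smsp. Qed.

(** As q is at least sm, the integral of phi - a against the weight q x * L is at
least sm times its integral against L, which does not depend on x, and likewise for
b - phi. This lifts a and lowers b for the weighted means N / D, and the range
shrinks by the factor 1 - sm / sp. *)
Lemma doeblin (L phi : X -> R) (a b l : R) :
  0 <= a -> (forall x, 0 <= L x) -> measurable_fun setT L ->
  measurable_fun setT phi -> (forall x, a <= phi x <= b) ->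
  (\int[lambda]_x (L x)%:E = l%:E)%E -> 0 < l ->
  exists a' b', [/\ a <= a', a' <= b', b' <= b,
    b' - a' = (1 - sm / sp) * (b - a) &
    forall x, exists D N, [/\ (\int[lambda]_x' (q x x' * L x')%:E = D%:E)%E,
      (\int[lambda]_x' (q x x' * L x' * phi x')%:E = N%:E)%E, 0 < D,
      a' * D <= N & N <= b' * D]].
Proof.
move=> a0 L0 mL mphi phib Ll l0.
have ab : a <= b by case/andP: (phib point) => h /(le_trans h).
have b0 := le_trans a0 ab.
have phi0 x : 0 <= phi x by case/andP: (phib x) => h _; exact: le_trans h.
have pa x : 0 <= phi x - a by case/andP: (phib x); rewrite subr_ge0.
have bp x : 0 <= b - phi x by case/andP: (phib x); rewrite subr_ge0.
have mpa : measurable_fun setT (fun x => phi x - a) by exact: measurable_funB.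
have mbp : measurable_fun setT (fun x => b - phi x) by exact: measurable_funB.
have mqx x := measurable_qx mq x.
have Lpa0 x : 0 <= L x * (phi x - a) by rewrite mulr_ge0.
have Lbp0 x : 0 <= L x * (b - phi x) by rewrite mulr_ge0.
have mLpa : measurable_fun setT (fun x => L x * (phi x - a)) by exact: measurable_funM.
have mLbp : measurable_fun setT (fun x => L x * (b - phi x)) by exact: measurable_funM.
have [w [j1 [j2 [Ww J1 J2 [wE1 wE2]]]]] : exists w j1 j2 : R, [/\
    (\int[lambda]_x (L x * phi x)%:E = w%:E)%E,
    (\int[lambda]_x (L x * (phi x - a))%:E = j1%:E)%E,
    (\int[lambda]_x (L x * (b - phi x))%:E = j2%:E)%E &
    w = j1 + a * l /\ b * l = w + j2].
  have mLphi : measurable_fun setT (fun x => L x * phi x) by exact: measurable_funM.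
  have Lphi0 x : 0 <= L x * phi x by rewrite mulr_ge0.
  have E2 : (\int[lambda]_x (L x * phi x)%:E + \int[lambda]_x (L x * (b - phi x))%:E
      = (b * l)%:E)%E.
    rewrite -ge0_integralD_EFin// EFinM -Ll -ge0_integralZl_EFin'//.
    by apply: eq_integral => x _; congr EFin; ring.
  have E1 : (\int[lambda]_x (L x * (phi x - a))%:E + (a * l)%:E
      = \int[lambda]_x (L x * phi x)%:E)%E.
    rewrite EFinM -Ll -ge0_integralZl_EFin'// -ge0_integralD_EFin//.
    - by apply: eq_integral => x _; congr EFin; ring.
    - by move=> x; rewrite mulr_ge0.
    - exact: measurable_funM.
  have /ge0_lty_EFin[|w _ wE] := integral_EFin_ge0 lambda Lphi0.
    apply: (@le_lt_trans _ _ (b * l)%:E); last exact: ltry.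
    by rewrite -E2 leeDl// integral_EFin_ge0.
  have /ge0_lty_EFin[|j2 _ j2E] := integral_EFin_ge0 lambda Lbp0.
    apply: (@le_lt_trans _ _ (b * l)%:E); last exact: ltry.
    by rewrite -E2 leeDr// integral_EFin_ge0.
  have /ge0_lty_EFin[|j1 _ j1E] := integral_EFin_ge0 lambda Lpa0.
    apply: (@le_lt_trans _ _ w%:E); last exact: ltry.
    by rewrite -wE -E1 leeDl// lee_fin mulr_ge0// ltW.
  exists w, j1, j2; split => //; split.
    by apply: EFin_inj; rewrite EFinD -j1E -wE E1.
  by apply: EFin_inj; rewrite EFinD -j2E -wE E2.
have j10 : 0 <= j1 by rewrite -lee_fin -J1 integral_EFin_ge0.
have j20 : 0 <= j2 by rewrite -lee_fin -J2 integral_EFin_ge0.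
have sp0 := sp_gt0; have ss := smsp.
have spl0 : 0 < sp * l by rewrite mulr_gt0.
(* sm * j1 bounds from below the excess of the weighted integral over a, and
   sp * l bounds the total weight from above; symmetrically for b *)
exists (a + sm * j1 / (sp * l)), (b - sm * j2 / (sp * l)).
have e0 : 0 <= sm / (sp * l) by rewrite divr_ge0// ltW.
have lenE : b - sm * j2 / (sp * l) - (a + sm * j1 / (sp * l)) =
    (1 - sm / sp) * (b - a).
  have -> : j1 = w - a * l by rewrite wE1; ring.
  have -> : j2 = b * l - w by rewrite wE2; ring.
  by field; rewrite !gt_eqF.
split => //.
- by rewrite lerDl -mulrA mulrCA mulr_ge0.
- rewrite -subr_ge0 lenE mulr_ge0 ?subr_ge0// ler_pdivrMr// mul1r//.
- by rewrite gerBl -mulrA mulrCA mulr_ge0.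
move=> x.
have qL0 x' : 0 <= q x x' * L x' by rewrite mulr_ge0.
have mqL : measurable_fun setT (fun x' => q x x' * L x') by exact: measurable_funM.
have qLphi0 x' : 0 <= q x x' * L x' * phi x' by rewrite mulr_ge0.
have mqLphi : measurable_fun setT (fun x' => q x x' * L x' * phi x').
  exact: measurable_funM.
have qs x' : sm <= q x x' by case/andP: (qb x x').
have qS x' : q x x' <= sp by case/andP: (qb x x').
have DL : (\int[lambda]_x' (q x x' * L x')%:E <= (sp * l)%:E)%E.
  rewrite EFinM -Ll -ge0_integralZl_EFin' ?(ltW sp0)//; apply: le_integral_EFin => //.
  - exact: measurable_funM.
  - by move=> x'; rewrite ler_wpM2r.
have DG : ((sm * l)%:E <= \int[lambda]_x' (q x x' * L x')%:E)%E.
  rewrite EFinM -Ll -ge0_integralZl_EFin' ?(ltW sm0)//; apply: le_integral_EFin => //.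
  - by move=> x'; rewrite mulr_ge0// ltW.
  - exact: measurable_funM.
  - by move=> x'; rewrite ler_wpM2r.
have /ge0_lty_EFin[|D D0 DE] := integral_EFin_ge0 lambda qL0.
  exact: le_lt_trans DL (ltry _).
move: DL DG; rewrite DE !lee_fin => DL DG.
have qLpa0 x' : 0 <= q x x' * (L x' * (phi x' - a)) by rewrite mulr_ge0.
have mqLpa : measurable_fun setT (fun x' => q x x' * (L x' * (phi x' - a))).
  exact: measurable_funM.
have qLbp0 x' : 0 <= q x x' * (L x' * (b - phi x')) by rewrite mulr_ge0.
have mqLbp : measurable_fun setT (fun x' => q x x' * (L x' * (b - phi x'))).
  exact: measurable_funM.
have E2 : (\int[lambda]_x' (q x x' * L x' * phi x')%:E +
    \int[lambda]_x' (q x x' * (L x' * (b - phi x')))%:E = (b * D)%:E)%E.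
  rewrite -ge0_integralD_EFin// EFinM -DE -ge0_integralZl_EFin'//.
  by apply: eq_integral => x' _; congr EFin; ring.
have E1 : (\int[lambda]_x' (q x x' * (L x' * (phi x' - a)))%:E + (a * D)%:E
    = \int[lambda]_x' (q x x' * L x' * phi x')%:E)%E.
  rewrite EFinM -DE -ge0_integralZl_EFin'// -ge0_integralD_EFin//.
  - by apply: eq_integral => x' _; congr EFin; ring.
  - by move=> x'; rewrite mulr_ge0.
  - exact: measurable_funM.
have F1 : ((sm * j1)%:E <= \int[lambda]_x' (q x x' * (L x' * (phi x' - a)))%:E)%E.
  rewrite EFinM -J1 -ge0_integralZl_EFin' ?(ltW sm0)//; apply: le_integral_EFin => //.
  - by move=> x'; rewrite mulr_ge0// ltW.
  - exact: measurable_funM.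
  - by move=> x'; rewrite ler_wpM2r.
have F2 : ((sm * j2)%:E <= \int[lambda]_x' (q x x' * (L x' * (b - phi x')))%:E)%E.
  rewrite EFinM -J2 -ge0_integralZl_EFin' ?(ltW sm0)//; apply: le_integral_EFin => //.
  - by move=> x'; rewrite mulr_ge0// ltW.
  - exact: measurable_funM.
  - by move=> x'; rewrite ler_wpM2r.
have /ge0_lty_EFin[|N N0 NE] := integral_EFin_ge0 lambda qLphi0.
  apply: (@le_lt_trans _ _ (b * D)%:E); last exact: ltry.
  by rewrite -E2 leeDl// integral_EFin_ge0.
have G1 : sm * j1 + a * D <= N.
  by rewrite -lee_fin EFinD -NE -E1 leeD2r.
have G2 : N + sm * j2 <= b * D.
  by rewrite -lee_fin EFinD -NE -E2 leeD2l.
have Dgt0 : 0 < D by apply: lt_le_trans DG; rewrite mulr_gt0.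
have T j : 0 <= j -> sm * j / (sp * l) * D <= sm * j.
  move=> j0; rewrite mulrAC ler_pdivrMr//; apply: ler_wpM2l => //.
  by rewrite mulr_ge0// ltW.
exists D, N; split => //.
- by rewrite mulrDl; apply: le_trans G1; rewrite addrC lerD2r; exact: T.
- rewrite mulrBl lerBrDr; apply: le_trans G2; rewrite lerD2l; exact: T.
Qed.

End doeblin.

(** * Law of large numbers along the levels *)

Record regular_model (R : realType) dX dY (X : measurableType dX)
    (Y : measurableType dY) (lambda : probability X R)
    (mu : {sigma_finite_measure set Y -> \bar R})
    (sm sp bp : R) (q : X -> X -> R) (g : X -> Y -> R)
    (Q : R.-pker X ~> X) (G : R.-pker X ~> Y) : Prop := RegularModel {
  rm_sm_gt0 : 0 < sm;
  rm_q_bounds : forall x x', sm <= q x x' <= sp;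
  rm_g_gt0 : forall x y, 0 < g x y;
  rm_g_le : forall x y, g x y <= bp;
  rm_mq : measurable_fun setT (fun z : X * X => q z.1 z.2);
  rm_mg : measurable_fun setT (fun z : X * Y => g z.1 z.2);
  rm_QE : forall x A, measurable A -> Q x A = (\int[lambda]_(x' in A) (q x x')%:E)%E;
  rm_GE : forall x A, measurable A -> G x A = (\int[mu]_(y in A) (g x y)%:E)%E }.

Section averages.
Context (R : realType) dY (Y : measurableType dY).
Local Notation cfg := (config (seq bool) Y).

(** The average of F over the 2^m subtrees rooted at height m. *)
Fixpoint avg (F : cfg -> R) (m : nat) (y : cfg) : R :=
  if m is m'.+1 then (avg F m' (sub y false) + avg F m' (sub y true)) / 2
  else F y.

Lemma avg_ge0 F m y : (forall y, 0 <= F y) -> 0 <= avg F m y.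
Proof.
by move=> F0; elim: m y => [//|m IH] y /=; rewrite divr_ge0// addr_ge0.
Qed.

Lemma measurable_avg F m : measurable_fun setT F ->
  measurable_fun setT (avg F m).
Proof.
move=> mF; elim: m => [//|m IH] /=; apply: measurable_funM => //.
by apply: measurable_funD; exact: (measurableT_comp IH (measurable_sub _)).
Qed.

Lemma sub_trunc n (y : cfg) b : sub (trunc n.+1 y) b = trunc n (sub y b).
Proof. exact: funext. Qed.

Lemma avg_trunc F m k y : (forall y, F (trunc k y) = F y) ->
  avg F m (trunc (m + k) y) = avg F m y.
Proof.
move=> Fk; elim: m y => [//|m IH] y.
by rewrite /= addSn !sub_trunc !IH.
Qed.

Lemma le_avg F F' m y : (forall y, F y <= F' y) -> avg F m y <= avg F' m y.
Proof.
by move=> FF'; elim: m y => [//|m IH] y /=; rewrite ler_pM2r// lerD.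
Qed.

Lemma avgD F F' m y : avg (fun y => F y + F' y) m y = avg F m y + avg F' m y.
Proof. by elim: m y => [//|m IH] y /=; rewrite !IH; field. Qed.

End averages.

Section law_of_large_numbers.
Context (R : realType) (dX dY : measure_display).
Context (X : measurableType dX) (Y : measurableType dY).
Variables (lambda : probability X R) (mu : {sigma_finite_measure set Y -> \bar R}).
Variables (sm sp bp : R) (q : X -> X -> R) (g : X -> Y -> R).
Variables (Q : R.-pker X ~> X) (G : R.-pker X ~> Y).
Hypothesis M : regular_model lambda mu sm sp bp q g Q G.
Local Open Scope ereal_scope.

Lemma rm_q0 x x' : (0 <= q x x')%R.
Proof.
by case/andP: (rm_q_bounds M x x') => h _; exact: le_trans (ltW (rm_sm_gt0 M)) h.
Qed.

Lemma rm_g0 x y : (0 <= g x y)%R. Proof. exact: ltW (rm_g_gt0 M x y). Qed.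

Lemma rm_gb : (exists b, forall x y, g x y <= b)%R.
Proof. by exists bp; exact: rm_g_le M. Qed.

Lemma rm_q1 x : \int[lambda]_x' (q x x')%:E = 1.
Proof. exact: kernel_density_q1 (rm_QE M) x. Qed.

Lemma rm_g1 x : \int[mu]_y (g x y)%:E = 1.
Proof. exact: kernel_density_g1 (rm_GE M) x. Qed.

Let q0 := rm_q0.
Let g0 := rm_g0.
Let gb := rm_gb.
Let q1 := rm_q1.
Let g1 := rm_g1.
Let mq := rm_mq M.
Let mg := rm_mg M.
Let sp0 : (0 < sp)%R := sp_gt0 (rm_sm_gt0 M) (rm_q_bounds M).
Let sm0 := rm_sm_gt0 M.

Local Notation cfg := (config (seq bool) Y).
Local Notation obsE := (obsE lambda mu q g).
Local Notation stepE := (stepE lambda mu q g).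

Lemma measurable_q_integral (h : X -> \bar R) : (forall x, 0 <= h x) ->
  measurable_fun setT h ->
  measurable_fun setT (fun x => \int[lambda]_x' ((q x x')%:E * h x')).
Proof.
move=> h0 mh; apply: (measurable_fun_fubini_tonelli_F (m2 := lambda)
  (fun p : X * X => (q p.1 p.2)%:E * h p.2)).
- apply: emeasurable_funM; first exact/measurable_EFinP.
  exact: (measurableT_comp mh measurable_snd).
- by move=> p; apply: mule_ge0; rewrite ?lee_fin.
Qed.

Lemma measurable_qh (h : X -> \bar R) x : measurable_fun setT h ->
  measurable_fun setT (fun x' => (q x x')%:E * h x').
Proof.
by move=> mh; apply: emeasurable_funM => //; apply/measurable_EFinP;
  exact: measurable_qx.
Qed.

Lemma qh_ge0 (h : X -> \bar R) x x' : (forall x, 0 <= h x) ->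
  0 <= (q x x')%:E * h x'.
Proof. by move=> h0; apply: mule_ge0; rewrite ?lee_fin. Qed.

Lemma q_integral_ge (h : X -> \bar R) x : (forall x, 0 <= h x) ->
  measurable_fun setT h ->
  sm%:E * \int[lambda]_x' h x' <= \int[lambda]_x' ((q x x')%:E * h x').
Proof.
move=> h0 mh; rewrite -ge0_integralZl ?lee_fin ?(ltW sm0)//.
apply: ge0_le_integral => //.
- by move=> x' _; apply: mule_ge0; rewrite ?lee_fin// ltW.
- exact: emeasurable_funM.
- exact: measurable_qh.
- move=> x' _; apply: lee_wpmul2r => //; rewrite lee_fin.
  by case/andP: (rm_q_bounds M x x').
Qed.

Lemma q_integral_le (h : X -> \bar R) x : (forall x, 0 <= h x) ->
  measurable_fun setT h ->
  \int[lambda]_x' ((q x x')%:E * h x') <= sp%:E * \int[lambda]_x' h x'.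
Proof.
move=> h0 mh; rewrite -ge0_integralZl ?lee_fin ?(ltW sp0)//.
apply: ge0_le_integral => //.
- by move=> x' _; exact: qh_ge0.
- exact: measurable_qh.
- exact: emeasurable_funM.
- move=> x' _; apply: lee_wpmul2r => //; rewrite lee_fin.
  by case/andP: (rm_q_bounds M x x').
Qed.

Variable pi : probability X R.
Hypothesis pi_inv : invariant_probability Q pi.

Lemma invariant_integral (h : X -> \bar R) : (forall x, 0 <= h x) ->
  measurable_fun setT h ->
  \int[pi]_x \int[lambda]_x' ((q x x')%:E * h x') = \int[pi]_x h x.
Proof.
move=> h0 mh; symmetry.
apply: (ge0_integral_functional
  (I := fun h => \int[pi]_x \int[lambda]_x' ((q x x')%:E * h x'))) => //.
- move=> f f' f0 mf f'0 mf'; rewrite -ge0_integralD//.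
  + apply: eq_integral => x _; rewrite -ge0_integralD//.
    * by apply: eq_integral => x' _; rewrite ge0_muleDr.
    * by move=> x' _; exact: qh_ge0.
    * exact: measurable_qh.
    * by move=> x' _; exact: qh_ge0.
    * exact: measurable_qh.
  + by move=> x _; apply: integral_ge0 => x' _; exact: qh_ge0.
  + exact: measurable_q_integral.
  + by move=> x _; apply: integral_ge0 => x' _; exact: qh_ge0.
  + exact: measurable_q_integral.
- move=> r f r0 f0 mf; rewrite -ge0_integralZl//.
  + apply: eq_integral => x _; rewrite -ge0_integralZl//.
    * by apply: eq_integral => x' _; rewrite muleCA.
    * exact: measurable_qh.
    * by move=> x' _; exact: qh_ge0.
  + exact: measurable_q_integral.
  + by move=> x _; apply: integral_ge0 => x' _; exact: qh_ge0.
- move=> f f0 mf ndf; rewrite -monotone_convergence//.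
  + apply: eq_integral => x _; rewrite -monotone_convergence//.
    * apply: eq_integral => x' _; rewrite -limeMl//.
      exact: ereal_nondecreasing_is_cvgn.
    * by move=> n; exact: measurable_qh.
    * by move=> n x' _; exact: qh_ge0.
    * by move=> x' _ n k nk; apply: lee_wpmul2l; rewrite ?lee_fin//; exact: ndf.
  + by move=> n; exact: measurable_q_integral.
  + by move=> n x _; apply: integral_ge0 => x' _; exact: qh_ge0.
  + move=> x _ n k nk; apply: ge0_le_integral => //.
    * by move=> x' _; exact: qh_ge0.
    * exact: measurable_qh.
    * exact: measurable_qh.
    * by move=> x' _; apply: lee_wpmul2l; rewrite ?lee_fin//; exact: ndf.
- move=> A mA; apply: eq_trans (pi_inv mA); apply: eq_integral => x _.
  rewrite (rm_QE M)// [RHS]integral_mkcond/=.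
  by apply: eq_integral => x' _; rewrite epatch_indic.
Qed.

Lemma lambda_le_pi (h : X -> \bar R) : (forall x, 0 <= h x) ->
  measurable_fun setT h -> sm%:E * \int[lambda]_x h x <= \int[pi]_x h x.
Proof.
move=> h0 mh; rewrite -[leLHS](prob_integral_cst pi) -(invariant_integral h0 mh).
apply: ge0_le_integral => //.
- move=> x _; apply: mule_ge0; first by rewrite lee_fin ltW.
  exact: integral_ge0.
- exact: measurable_q_integral.
- by move=> x _; exact: q_integral_ge.
Qed.

Lemma q_integral_le_pi (h : X -> \bar R) x : (forall x, 0 <= h x) ->
  measurable_fun setT h ->
  \int[lambda]_x' ((q x x')%:E * h x') <= (sp / sm)%:E * \int[pi]_x h x.
Proof.
move=> h0 mh; apply: le_trans (q_integral_le x h0 mh) _.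
rewrite EFinM -muleA; apply: lee_wpmul2l; first by rewrite lee_fin ltW.
rewrite -[leLHS]mul1e -(@mulVf _ sm) ?gt_eqF// EFinM -muleA.
by apply: lee_wpmul2l; [rewrite lee_fin invr_ge0 ltW|exact: lambda_le_pi].
Qed.

Section moments.
Variables (F : cfg -> R) (k : nat).
Hypothesis F0 : forall y, (0 <= F y)%R.
Hypothesis mF : measurable_fun setT F.
Hypothesis Fk : forall y, F (trunc k y) = F y.

(** meanE and sqE are the first two moments of the average over level m given the
state of the root. *)
Definition meanE m x := obsE (m + k) x (fun y => (avg F m y)%:E).
Definition sqE m x := obsE (m + k) x (fun y => (avg F m y ^+ 2)%:E).

Let A0 m y : 0 <= (avg F m y)%:E.
Proof. by rewrite lee_fin avg_ge0. Qed.
Let A20 m y : 0 <= (avg F m y ^+ 2)%:E.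
Proof. by rewrite lee_fin sqr_ge0. Qed.
Let mA m : measurable_fun setT (fun y => (avg F m y)%:E).
Proof. by apply/measurable_EFinP; exact: measurable_avg. Qed.
Let mA2 m : measurable_fun setT (fun y => (avg F m y ^+ 2)%:E).
Proof. by apply/measurable_EFinP; apply: measurable_funX; exact: measurable_avg. Qed.

Lemma meanE_ge0 m x : 0 <= meanE m x. Proof. exact: obsE_ge0. Qed.
Lemma sqE_ge0 m x : 0 <= sqE m x. Proof. exact: obsE_ge0. Qed.
Lemma measurable_meanE m : measurable_fun setT (meanE m).
Proof. exact: measurable_obsE. Qed.
Lemma measurable_sqE m : measurable_fun setT (sqE m).
Proof. exact: measurable_obsE. Qed.

Lemma half_double (s : \bar R) : 0 <= s -> (2^-1)%:E * (s + s) = s.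
Proof.
case: s => [r| |]// _; first by rewrite -EFinD -EFinM; congr EFin; field.
by rewrite addey// gt0_muley// lte_fin invr_gt0.
Qed.

(** Both halves of the average have the same conditional mean. *)
Lemma meanES m x : meanE m.+1 x = \int[lambda]_x' ((q x x')%:E * meanE m x').
Proof.
transitivity (stepE (m + k) x (fun y => (avg F m y)%:E)); last by [].
rewrite /meanE.
transitivity (obsE (m + k).+1 x (fun y => (2^-1)%:E *
    ((avg F m (sub y false))%:E + (avg F m (sub y true))%:E))).
  by congr obsE; apply/funext => y; rewrite -EFinD -EFinM mulrC.
have mAs b : measurable_fun setT (fun y : cfg => (avg F m (sub y b))%:E).
  exact: (measurableT_comp (mA m) (measurable_sub b)).
rewrite obsEZ//; last 2 first.
- by move=> y; exact: adde_ge0.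
- exact: emeasurable_funD.
have HS b : obsE (m + k).+1 x (fun y => (avg F m (sub y b))%:E) =
    stepE (m + k) x (fun y => (avg F m y)%:E).
  by apply: (obsE_sub q0 g0 mq mg q1 g1 _ _ _ (A := fun y => (avg F m y)%:E)).
rewrite obsED// !HS.
by rewrite half_double// stepE_ge0.
Qed.

(** Expand the square of the average of two conditionally independent halves: the
cross term is the square of the mean. *)
Lemma sqES m x : sqE m.+1 x =
  (2^-1)%:E * \int[lambda]_x' ((q x x')%:E * sqE m x') +
  (2^-1)%:E * (meanE m.+1 x * meanE m.+1 x).
Proof.
rewrite meanES.
transitivity ((2^-1)%:E * stepE (m + k) x (fun y => (avg F m y ^+ 2)%:E) +
  (2^-1)%:E * (stepE (m + k) x (fun y => (avg F m y)%:E) *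
               stepE (m + k) x (fun y => (avg F m y)%:E))); last by [].
have mAs b : measurable_fun setT (fun y : cfg => (avg F m (sub y b))%:E).
  exact: (measurableT_comp (mA m) (measurable_sub b)).
have mA2s b : measurable_fun setT (fun y : cfg => (avg F m (sub y b) ^+ 2)%:E).
  exact: (measurableT_comp (mA2 m) (measurable_sub b)).
rewrite /sqE.
transitivity (obsE (m + k).+1 x (fun y => (2^-1)%:E *
   ((2^-1)%:E * ((avg F m (sub y false) ^+ 2)%:E + (avg F m (sub y true) ^+ 2)%:E) +
   (avg F m (sub y false))%:E * (avg F m (sub y true))%:E))).
  congr obsE; apply/funext => y; rewrite -!(EFinD, EFinM) /=; congr EFin.
  by field.
have h0 : (0 <= 2^-1 :> R)%R by [].
have h0e : 0 <= (2^-1 : R)%:E by rewrite lee_fin.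
have s0 y : 0 <= (avg F m (sub y false) ^+ 2)%:E + (avg F m (sub y true) ^+ 2)%:E.
  exact: adde_ge0.
have ms : measurable_fun setT (fun y : cfg =>
    (avg F m (sub y false) ^+ 2)%:E + (avg F m (sub y true) ^+ 2)%:E).
  exact: emeasurable_funD.
have mp : measurable_fun setT (fun y : cfg =>
    (avg F m (sub y false))%:E * (avg F m (sub y true))%:E).
  exact: emeasurable_funM.
rewrite obsEZ//; last 2 first.
- by move=> y; apply: adde_ge0; apply: mule_ge0.
- by apply: emeasurable_funD => //; exact: emeasurable_funM.
rewrite obsED//; last 3 first.
- by move=> y; apply: mule_ge0.
- exact: emeasurable_funM.
- by move=> y; exact: mule_ge0.
have HS2 b : obsE (m + k).+1 x (fun y => (avg F m (sub y b) ^+ 2)%:E) =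
    stepE (m + k) x (fun y => (avg F m y ^+ 2)%:E).
  by apply: (obsE_sub q0 g0 mq mg q1 g1 _ _ _ (A := fun y => (avg F m y ^+ 2)%:E)).
have HP : obsE (m + k).+1 x (fun y =>
    (avg F m (sub y false))%:E * (avg F m (sub y true))%:E) =
    stepE (m + k) x (fun y => (avg F m y)%:E) *
    stepE (m + k) x (fun y => (avg F m y)%:E).
  exact: (obsE_sub2 lambda q0 g0 mq mg g1 (m + k) x (A0 m) (mA m) (A0 m) (mA m)).
rewrite obsEZ// obsED// !HS2 HP.
rewrite half_double ?stepE_ge0// ge0_muleDr//.
- exact: stepE_ge0.
- by apply: mule_ge0; exact: stepE_ge0.
Qed.

Variables c c2 : R.
Hypothesis cE : \int[pi]_x obsE k x (fun y => (F y)%:E) = c%:E.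
Hypothesis c2E : \int[pi]_x obsE k x (fun y => (F y ^+ 2)%:E) = c2%:E.

Let rho : R := (1 - sm / sp)%R.
Let b1 : R := (sp / sm * c)%R.

Let rho0 : (0 <= rho)%R.
Proof.
rewrite subr_ge0 ler_pdivrMr// mul1r.
exact: (smsp (rm_q_bounds M)).
Qed.

Let rho1 : (rho < 1)%R.
Proof. by rewrite ltrBlDr ltrDl divr_gt0. Qed.

Let c0 : (0 <= c)%R.
Proof.
by rewrite -lee_fin -cE; apply: integral_ge0 => x _; exact: (meanE_ge0 0).
Qed.

Let c20 : (0 <= c2)%R.
Proof.
by rewrite -lee_fin -c2E; apply: integral_ge0 => x _; exact: (sqE_ge0 0).
Qed.

Lemma pi_meanE m : \int[pi]_x meanE m x = c%:E.
Proof.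
elim: m => [|m IH]; first exact: cE.
under eq_integral do rewrite meanES.
rewrite invariant_integral//; last exact: measurable_meanE.
by move=> x; exact: meanE_ge0.
Qed.

(** The conditional mean given the root state is the function meanE 0 transported
m + 1 times by the Markov kernel; each transport contracts its range. *)
Lemma mean_interval m : exists a b : R, [/\ (0 <= a)%R,
  (b - a = rho ^+ m * b1)%R & forall x, exists2 r : R, meanE m.+1 x = r%:E &
    (a <= r <= b)%R].
Proof.
elim: m => [|m [a [b [a0 ba H]]]].
  exists 0%R, b1; split => //; first by rewrite expr0 mul1r subr0.
  move=> x; have : meanE 1 x <= b1%:E.
    rewrite meanES /b1 EFinM -(pi_meanE 0).
    by apply: q_integral_le_pi; [exact: meanE_ge0|exact: measurable_meanE].
  move=> mb; have [|r r0 rE] := ge0_lty_EFin (meanE_ge0 1 x).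
    exact: le_lt_trans mb (ltry _).
  by exists r => //; rewrite r0 -lee_fin -rE.
pose phi x := fine (meanE m.+1 x).
have phiE x : meanE m.+1 x = (phi x)%:E.
  by have [r rE _] := H x; rewrite /phi rE.
have mphi : measurable_fun setT phi.
  by apply: measurableT_comp => //; exact: measurable_meanE.
have phib x : (a <= phi x <= b)%R.
  by have [r rE rab] := H x; rewrite /phi rE.
have L1 : \int[lambda]_x ((cst 1 : X -> R) x)%:E = 1%:E
  by rewrite -[RHS](prob_integral_cst lambda).
have [a' [b' [aa' ab' bb' ba' H']]] := doeblin sm0 (rm_q_bounds M) mq a0
  (fun=> ler01) (@measurable_cst _ _ _ _ _ _) mphi phib L1 ltr01.
exists a', b'; split; first exact: le_trans aa'.
  by rewrite ba' ba exprS mulrA.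
move=> x; have [D [N [DE NE D0 DN ND]]] := H' x.
have D1 : D = 1%R.
  apply: EFin_inj; rewrite -DE -(q1 x); apply: eq_integral => x' _.
  by rewrite mulr1.
exists N; last by move: DN ND; rewrite D1 !mulr1 => -> ->.
rewrite meanES -NE; apply: eq_integral => x' _.
by rewrite mulr1 EFinM phiE.
Qed.

(** The stationary mean of meanE is c, so c lies in the same interval. *)
Lemma mean_err m x : exists2 r : R, meanE m.+1 x = r%:E &
  (0 <= r /\ `|r - c| <= rho ^+ m * b1)%R.
Proof.
have [a [b [a0 ba H]]] := mean_interval m.
have ac : (a <= c)%R.
  rewrite -lee_fin -(pi_meanE m.+1) -[leLHS](prob_integral_cst pi).
  apply: ge0_le_integral => //.
  - exact: measurable_meanE.
  - by move=> x' _; have [r -> /andP[ar _]] := H x'; rewrite lee_fin.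
have cb : (c <= b)%R.
  rewrite -lee_fin -(pi_meanE m.+1) -[leRHS](prob_integral_cst pi).
  apply: ge0_le_integral => //.
  - by move=> x' _; exact: meanE_ge0.
  - exact: measurable_meanE.
  - by move=> x' _; have [r -> /andP[_ rb]] := H x'; rewrite lee_fin.
have [r rE /andP[ar rb]] := H x; exists r => //; split.
  exact: le_trans ar.
by rewrite -ba ler_norml; apply/andP; split; lra.
Qed.

(* r0 < 1 is at least 3/4 and at least rho: a rate above both 1/2 and rho absorbs
   the two terms of the recursion for the variance *)
Let r0 : R := ((3 + rho) / 4)%R.
Let K0 : R := (sp / sm * c2 + b1 ^+ 2 + c ^+ 2)%R.
Let K : R := (K0 + 2 * b1 ^+ 2)%R.

Let b10 : (0 <= b1)%R.
Proof. by rewrite mulr_ge0// divr_ge0// ltW. Qed.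

Let K00 : (0 <= K0)%R.
Proof. by rewrite !addr_ge0 ?sqr_ge0// mulr_ge0// divr_ge0// ltW. Qed.

Let K_ge0 : (0 <= K)%R.
Proof. by rewrite addr_ge0// mulr_ge0// sqr_ge0. Qed.

(** This says that the mean of (avg F m.+1 - c)^2 given the root state is at most
K * r0 ^+ m, by V_(m+1) = V_m / 2 + (mean - c)^2 / 2. The square is expanded and
the negative term moved to the other side so that only nonnegative functions are
integrated. *)
Lemma sq_err m x : exists S r : R, [/\ sqE m.+1 x = S%:E, meanE m.+1 x = r%:E &
  (S + c ^+ 2 <= K * r0 ^+ m + 2 * c * r)%R].
Proof.
have r00 : (0 <= r0)%R by rewrite divr_ge0// addr_ge0.
have r034 : (3 / 4 <= r0)%R by rewrite /r0; have := rho0; lra.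
have rhor : (rho <= r0)%R by rewrite /r0; have := rho1; lra.
have sb : (0 <= b1 ^+ 2)%R by exact: sqr_ge0.
elim: m x => [|m IH] x.
  have [r rE [rge0 rc]] := mean_err 0 x.
  have [a [b [a0 ba H]]] := mean_interval 0.
  have r1 : (r <= b1)%R.
    have : meanE 1 x <= b1%:E.
      rewrite meanES /b1 EFinM -(pi_meanE 0).
      by apply: q_integral_le_pi; [exact: meanE_ge0|exact: measurable_meanE].
    by rewrite rE lee_fin.
  have Q2 : \int[lambda]_x' ((q x x')%:E * sqE 0 x') <= (sp / sm * c2)%:E.
    rewrite EFinM -c2E.
    by apply: q_integral_le_pi; [exact: sqE_ge0|exact: measurable_sqE].
  have [||S S0 SE] := @ge0_lty_EFin _ (\int[lambda]_x' ((q x x')%:E * sqE 0 x')).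
  - by apply: integral_ge0 => x' _; apply: qh_ge0; exact: sqE_ge0.
  - exact: le_lt_trans Q2 (ltry _).
  exists (2^-1 * S + 2^-1 * (r * r))%R, r; split => //.
    by rewrite sqES SE rE -!EFinM -EFinD.
  rewrite expr0 mulr1 /K /K0; move: Q2; rewrite SE lee_fin => Q2.
  have rr : (r * r <= b1 ^+ 2)%R by rewrite expr2 ler_pM.
  have := mulr_ge0 c0 rge0; have := sqr_ge0 b1; have := S0.
  have : (0 <= sp / sm * c2)%R by exact: le_trans Q2.
  by move=> ? ? ? ?; nra.
have [r rE [rge0 rc]] := mean_err m.+1 x.
pose f x' := fine (sqE m.+1 x').
pose h x' := fine (meanE m.+1 x').
have fE x' : sqE m.+1 x' = (f x')%:E by have [S [r' [SE _ _]]] := IH x'; rewrite /f SE.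
have hE x' : meanE m.+1 x' = (h x')%:E by have [S [r' [_ h' _]]] := IH x'; rewrite /h h'.
have f0 x' : (0 <= f x')%R by rewrite -lee_fin -fE sqE_ge0.
have h0 x' : (0 <= h x')%R by rewrite -lee_fin -hE meanE_ge0.
have mf : measurable_fun setT f.
  by apply: measurableT_comp => //; exact: measurable_sqE.
have mh : measurable_fun setT h.
  by apply: measurableT_comp => //; exact: measurable_meanE.
have mqx := measurable_qx mq x.
have ineq : \int[lambda]_x' (q x x' * (f x' + c ^+ 2))%:E <=
    \int[lambda]_x' (q x x' * (K * r0 ^+ m + 2 * c * h x'))%:E.
  have fh x' : (f x' + c ^+ 2 <= K * r0 ^+ m + 2 * c * h x')%R.
    have [S [r' [SE r'E le]]] := IH x'.
    by rewrite /f /h SE r'E.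
  apply: le_integral_EFin.
  - by move=> x'; rewrite mulr_ge0// addr_ge0// sqr_ge0.
  - by apply: measurable_funM => //; exact: measurable_funD.
  - apply: measurable_funM => //; apply: measurable_funD => //.
    exact: measurable_funM.
  - by move=> x'; rewrite ler_wpM2l.
have Ih : \int[lambda]_x' (q x x' * h x')%:E = r%:E.
  by rewrite -rE meanES; apply: eq_integral => x' _; rewrite hE EFinM.
have K0' : (0 <= K * r0 ^+ m)%R.
  by apply: mulr_ge0 => //; exact: exprn_ge0.
have R1 : \int[lambda]_x' (q x x' * (K * r0 ^+ m + 2 * c * h x'))%:E =
    (K * r0 ^+ m + 2 * c * r)%:E.
  transitivity (\int[lambda]_x' (K * r0 ^+ m * q x x' + 2 * c * (q x x' * h x'))%:E).
    by apply: eq_integral => x' _; congr EFin; ring.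
  rewrite ge0_integralD_EFin//.
  - rewrite (ge0_integralZl_EFin' _ K0')// ge0_integralZl_EFin' ?mulr_ge0//.
    + by rewrite q1 Ih mule1 -EFinM -EFinD.
    + by move=> x'; rewrite mulr_ge0.
    + exact: measurable_funM.
  - by move=> x'; rewrite mulr_ge0.
  - exact: measurable_funM.
  - by move=> x'; rewrite !mulr_ge0.
  - by apply: measurable_funM => //; exact: measurable_funM.
have R2 : \int[lambda]_x' (q x x' * (f x' + c ^+ 2))%:E =
    \int[lambda]_x' ((q x x')%:E * sqE m.+1 x') + (c ^+ 2)%:E.
  transitivity (\int[lambda]_x' (q x x' * f x' + c ^+ 2 * q x x')%:E).
    by apply: eq_integral => x' _; congr EFin; ring.
  rewrite ge0_integralD_EFin//.
  - rewrite ge0_integralZl_EFin' ?sqr_ge0// q1 mule1; congr (_ + _).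
    by apply: eq_integral => x' _; rewrite fE EFinM.
  - by move=> x'; rewrite mulr_ge0.
  - exact: measurable_funM.
  - by move=> x'; rewrite mulr_ge0// sqr_ge0.
  - exact: measurable_funM.
move: ineq; rewrite R1 R2 => ineq.
have [||S S0 SE] := @ge0_lty_EFin _ (\int[lambda]_x' ((q x x')%:E * sqE m.+1 x')).
- by apply: integral_ge0 => x' _; apply: qh_ge0; exact: sqE_ge0.
- apply: (@le_lt_trans _ _ (K * r0 ^+ m + 2 * c * r)%:E); last exact: ltry.
  by apply: le_trans ineq; rewrite leeDl// lee_fin sqr_ge0.
exists (2^-1 * S + 2^-1 * (r * r))%R, r; split => //.
  by rewrite sqES SE rE -!EFinM -EFinD.
move: ineq; rewrite SE -EFinD lee_fin => ineq.
have rc2 : ((r - c) ^+ 2 <= r0 ^+ m.+1 * b1 ^+ 2)%R.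
  have rho1m : (rho ^+ m.+1 <= 1)%R by rewrite exprn_ile1// ltW.
  have rho0m : (0 <= rho ^+ m.+1)%R by rewrite exprn_ge0.
  rewrite -real_normK ?num_real//.
  apply: (@le_trans _ _ ((rho ^+ m.+1 * b1) ^+ 2)%R); first by rewrite ler_pXn2r// nnegrE mulr_ge0.
  rewrite exprMn ler_wpM2r//.
  apply: (@le_trans _ _ (rho ^+ m.+1)%R).
    by rewrite expr2 ler_piMl.
  by rewrite ler_pXn2r.
have KK : (2^-1 * (K * r0 ^+ m) + 2^-1 * (r0 ^+ m.+1 * b1 ^+ 2) <= K * r0 ^+ m.+1)%R.
  have rm0 : (0 <= r0 ^+ m)%R by exact: exprn_ge0.
  rewrite exprS -subr_ge0.
  have -> : (K * (r0 * r0 ^+ m) - (2^-1 * (K * r0 ^+ m) + 2^-1 * (r0 * r0 ^+ m * b1 ^+ 2))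
    = r0 ^+ m * (K * r0 - 2^-1 * K - 2^-1 * r0 * b1 ^+ 2))%R by field.
  apply: mulr_ge0 => //.
  have -> : (K * r0 - 2^-1 * K - 2^-1 * r0 * b1 ^+ 2 =
    K0 * (r0 - 2^-1) + b1 ^+ 2 * (3 / 2 * r0 - 1))%R by rewrite /K; field.
  by apply: addr_ge0; apply: mulr_ge0 => //; lra.
have cE' : (2^-1 * S + 2^-1 * (r * r) + c ^+ 2 - 2 * c * r =
  2^-1 * (S + c ^+ 2 - 2 * c * r) + 2^-1 * (r - c) ^+ 2)%R by field.
lra.
Qed.

Variables (zeta : probability X R) (d : measure_display) (Omega : measurableType d).
Variables (P : probability Omega R) (Xp : seq bool -> {RV P >-> X}).
Variable Yp : seq bool -> {RV P >-> Y}.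
Hypothesis hmm : is_HMT Xp Yp Q G zeta.

(** Second moments around c are summable whatever the initial law is, because
sq_err is uniform in the state of the root. *)
Lemma avg_ae_cvg : \forall y \ae obs_law Yp,
  (fun m => avg F m y) @ \oo --> c.
Proof.
have r00 : (0 <= r0)%R by rewrite divr_ge0// addr_ge0.
have r01 : (r0 < 1)%R by rewrite /r0; have := rho1; lra.
have mavg m : measurable_fun setT (avg F m) by exact: measurable_avg.
have avg0 m y : (0 <= avg F m y)%R by exact: avg_ge0.
have main m : \int[obs_law Yp]_y ((avg F m.+1 y - c) ^+ 2)%:E <= (K * r0 ^+ m)%:E.
  have EA : \int[obs_law Yp]_y (avg F m.+1 y)%:E = \int[zeta]_x meanE m.+1 x.
    rewrite -(integral_hmt_obs q0 g0 mq mg gb (rm_QE M) (rm_GE M) _ hmm)//.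
    by apply: eq_integral => y _; rewrite avg_trunc.
  have EA2 : \int[obs_law Yp]_y (avg F m.+1 y ^+ 2)%:E = \int[zeta]_x sqE m.+1 x.
    rewrite -(integral_hmt_obs q0 g0 mq mg gb (rm_QE M) (rm_GE M) _ hmm)//.
    by apply: eq_integral => y _; rewrite avg_trunc.
  pose f x' := fine (sqE m.+1 x').
  pose h x' := fine (meanE m.+1 x').
  have IH := sq_err m.
  have fE x' : sqE m.+1 x' = (f x')%:E by have [S [r' [SE _ _]]] := IH x'; rewrite /f SE.
  have hE x' : meanE m.+1 x' = (h x')%:E by have [S [r' [_ h' _]]] := IH x'; rewrite /h h'.
  have f0 x' : (0 <= f x')%R by rewrite -lee_fin -fE sqE_ge0.
  have h0 x' : (0 <= h x')%R by rewrite -lee_fin -hE meanE_ge0.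
  have mf : measurable_fun setT f.
    by apply: measurableT_comp => //; exact: measurable_sqE.
  have mh : measurable_fun setT h.
    by apply: measurableT_comp => //; exact: measurable_meanE.
  have hb x' : (h x' <= rho ^+ m * b1 + c)%R.
    have [r rE [_ rc]] := mean_err m x'; rewrite /h rE /= -lerBlDr.
    exact: le_trans (ler_norm _) rc.
  have [||e e0 eE] := @ge0_lty_EFin _ (\int[zeta]_x (h x)%:E).
  - exact: integral_EFin_ge0.
  - apply: (@le_lt_trans _ _ (rho ^+ m * b1 + c)%:E); last exact: ltry.
    rewrite -[leRHS](prob_integral_cst zeta).
    by apply: le_integral_EFin => //; exact: measurable_cst.
  have K0' : (0 <= K * r0 ^+ m)%R.
    by apply: mulr_ge0 => //; exact: exprn_ge0.
  have ineq : \int[zeta]_x (f x + c ^+ 2)%:E <= (K * r0 ^+ m + 2 * c * e)%:E.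
    have -> : (K * r0 ^+ m + 2 * c * e)%:E =
        \int[zeta]_x (K * r0 ^+ m + 2 * c * h x)%:E.
      rewrite ge0_integralD_EFin//.
      - by rewrite prob_integral_cst ge0_integralZl_EFin' ?mulr_ge0// eE -EFinM -EFinD.
      - by move=> x; rewrite !mulr_ge0.
      - exact: measurable_funM.
    apply: le_integral_EFin.
    - by move=> x; rewrite addr_ge0// sqr_ge0.
    - exact: measurable_funD.
    - by apply: measurable_funD => //; exact: measurable_funM.
    - move=> x; have [S [r' [SE r'E le]]] := IH x.
      by rewrite /f /h SE r'E.
  have ident : \int[obs_law Yp]_y ((avg F m.+1 y - c) ^+ 2)%:E + (2 * c * e)%:E =
      \int[zeta]_x (f x + c ^+ 2)%:E.
    rewrite ge0_integralD_EFin; [|by []|by []|by move=> ?; exact: sqr_ge0|by []].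
    have -> : \int[zeta]_x (f x)%:E = \int[obs_law Yp]_y (avg F m.+1 y ^+ 2)%:E.
      by rewrite EA2; apply: eq_integral => x _; rewrite fE.
    rewrite prob_integral_cst -[X in _ = _ + X](prob_integral_cst (obs_law Yp)).
    rewrite -[RHS]ge0_integralD_EFin; last 4 first.
    - by move=> y; exact: sqr_ge0.
    - exact: measurable_funX.
    - by move=> y; exact: sqr_ge0.
    - by [].
    have -> : (2 * c * e)%:E = \int[obs_law Yp]_y (2 * c * avg F m.+1 y)%:E.
      rewrite ge0_integralZl_EFin' ?mulr_ge0// EA EFinM -eE; congr (_ * _).
      by apply: eq_integral => x _; rewrite hE.
    rewrite -ge0_integralD_EFin.
    - by apply: eq_integral => y _; congr EFin; rewrite /=; ring.
    - by move=> y; exact: sqr_ge0.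
    - by apply: measurable_funX; exact: measurable_funB.
    - by move=> y; apply: mulr_ge0 => //; apply: mulr_ge0.
    - exact: measurable_funM.
  rewrite -(leeD2rE (x := (2 * c * e)%:E))// ident.
  by apply: le_trans ineq _; rewrite EFinD.
have : \forall y \ae obs_law Yp,
    (fun m => (avg F m.+1 y - c)%R) @ \oo --> (0 : R)%R.
  apply: (@ae_cvg0_of_summable _ _ _ _ _ K r0) => //; first by rewrite r00 r01.
  by move=> m; exact: measurable_funB.
apply: filterS => y h.
rewrite -(cvg_shiftS (fun m => avg F m y)).
have h2 : (fun m => (avg F m.+1 y - c + c)%R) @ \oo --> (0 + c)%R.
  by apply: cvgD => //; exact: cvg_cst.
rewrite add0r in h2; apply: cvg_trans h2.
by apply: near_eq_cvg; apply: nearW => m; rewrite /= subrK.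
Qed.

End moments.
End law_of_large_numbers.

(** * Cutting the tree at a level *)

Section likelihood_bounds.
Context (R : realType) (dX dY : measure_display).
Context (X : measurableType dX) (Y : measurableType dY).
Variables (lambda : probability X R) (mu : {sigma_finite_measure set Y -> \bar R}).
Variables (sm sp bp : R) (q : X -> X -> R) (g : X -> Y -> R).
Variables (Q : R.-pker X ~> X) (G : R.-pker X ~> Y).
Hypothesis M : regular_model lambda mu sm sp bp q g Q G.
Variable bm : Y -> R.
Hypothesis bm0 : forall y, 0 < bm y.
Hypothesis bm_le : forall y, ((bm y)%:E <= \int[lambda]_x (g x y)%:E)%E.
Local Open Scope ereal_scope.

Let q0 := rm_q0 M.
Let g0 := rm_g0 M.
Let gb := rm_gb M.
Let q1 := rm_q1 M.
Let mq := rm_mq M.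
Let mg := rm_mg M.
Let sp0 : (0 < sp)%R := sp_gt0 (rm_sm_gt0 M) (rm_q_bounds M).
Let sm0 := rm_sm_gt0 M.

Local Notation cfg := (config (seq bool) Y).
Local Notation likE := (likE lambda q g).
Local Notation branchE := (branchE lambda q g).

(** The likelihood when the state of the root is drawn from lambda. *)
Definition rootE sh (y : cfg) := \int[lambda]_x likE sh x y.
Definition lik sh x y : R := fine (likE sh x y).
Definition branch sh x y : R := fine (branchE sh x y).
Definition root sh (y : cfg) : R := fine (rootE sh y).

Lemma likE_lik sh x y : likE sh x y = (lik sh x y)%:E.
Proof. by rewrite fineK// likE_fin_num. Qed.

Lemma rootE_ge0 sh y : 0 <= rootE sh y.
Proof. by apply: integral_ge0 => x _; exact: likE_ge0. Qed.

Lemma rootE_fin sh y : rootE sh y \is a fin_num.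
Proof.
have [B B0 LB] := likE_bounded q0 g0 mq mg q1 sh gb.
rewrite ge0_fin_numE ?rootE_ge0//; apply: (@le_lt_trans _ _ B%:E); last exact: ltry.
rewrite -[leRHS](prob_integral_cst lambda); apply: ge0_le_integral => //.
- by move=> x _; exact: likE_ge0.
- exact: measurable_likE2.
Qed.

Lemma rootE_root sh y : rootE sh y = (root sh y)%:E.
Proof. by rewrite fineK// rootE_fin. Qed.

Lemma branchE_ge_root sh x y : sm%:E * rootE sh y <= branchE sh x y.
Proof.
apply: (q_integral_ge M) => [x'|]; [exact: likE_ge0|exact: measurable_likE2].
Qed.

Lemma branchE_le_root sh x y : branchE sh x y <= sp%:E * rootE sh y.
Proof.
apply: (q_integral_le M) => [x'|]; [exact: likE_ge0|exact: measurable_likE2].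
Qed.

Lemma branchE_branch sh x y : branchE sh x y = (branch sh x y)%:E.
Proof.
rewrite fineK// ge0_fin_numE ?branchE_ge0//.
by apply: le_lt_trans (branchE_le_root sh x y) _; rewrite rootE_root -EFinM ltry.
Qed.

Lemma branch_ge sh x y : (sm * root sh y <= branch sh x y)%R.
Proof. by rewrite -lee_fin EFinM -rootE_root -branchE_branch branchE_ge_root. Qed.

Lemma branch_le sh x y : (branch sh x y <= sp * root sh y)%R.
Proof. by rewrite -lee_fin EFinM -rootE_root -branchE_branch branchE_le_root. Qed.

Lemma branch_ge0 sh x y : (0 <= branch sh x y)%R.
Proof. by rewrite -lee_fin -branchE_branch branchE_ge0. Qed.

Lemma root_ge0 sh y : (0 <= root sh y)%R.
Proof. by rewrite -lee_fin -rootE_root rootE_ge0. Qed.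

Lemma lik_node l r x y : lik (Node l r) x y =
  (g x (y [::]) * (branch l x (sub y false) * branch r x (sub y true)))%R.
Proof.
apply: EFin_inj; rewrite -likE_lik likE_node.
by rewrite !branchE_branch -!EFinM.
Qed.

Lemma measurable_gy y : measurable_fun setT (g ^~ y).
Proof.
apply: (measurableT_comp mg (g := fun x : X => (x, y))).
exact: measurable_fun_pair.
Qed.

Definition mean_g y : R := fine (\int[lambda]_x (g x y)%:E).

Lemma mean_gE y : \int[lambda]_x (g x y)%:E = (mean_g y)%:E /\
  (bm y <= mean_g y <= bp)%R.
Proof.
have H : \int[lambda]_x (g x y)%:E <= bp%:E.
  rewrite -[leRHS](prob_integral_cst lambda); apply: le_integral_EFin => //.
  - exact: measurable_gy.
  - by move=> x; exact: (rm_g_le M).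
have E : \int[lambda]_x (g x y)%:E = (mean_g y)%:E.
  rewrite fineK// ge0_fin_numE ?integral_EFin_ge0//.
  exact: le_lt_trans H (ltry _).
by split => //; rewrite -!lee_fin -E bm_le.
Qed.

(** Both branches are compared to the case of children drawn from lambda. *)
Lemma root_node l r y :
  (sm ^+ 2 * mean_g (y [::]) * (root l (sub y false) * root r (sub y true)) <=
   root (Node l r) y <=
   sp ^+ 2 * mean_g (y [::]) * (root l (sub y false) * root r (sub y true)))%R.
Proof.
set P := (root l (sub y false) * root r (sub y true))%R.
have P0 : (0 <= P)%R by rewrite mulr_ge0 ?root_ge0.
have [mE _] := mean_gE (y [::]).
have mgy := measurable_gy (y [::]).
have rE : (root (Node l r) y)%:E = \int[lambda]_x (lik (Node l r) x y)%:E.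
  by rewrite -rootE_root; apply: eq_integral => x _; exact: likE_lik.
have ml : measurable_fun setT (lik (Node l r) ^~ y).
  by apply: measurableT_comp => //; exact: measurable_likE2.
have l0 x : (0 <= lik (Node l r) x y)%R.
  by rewrite -lee_fin -likE_lik likE_ge0.
have k0 (s : R) : (0 < s)%R -> (0 <= s ^+ 2 * P)%R.
  by move=> s0; rewrite mulr_ge0// exprn_ge0// ltW.
have E (s : R) : (0 < s)%R -> (s ^+ 2 * mean_g (y [::]) * P)%:E =
    \int[lambda]_x (s ^+ 2 * P * g x (y [::]))%:E.
  move=> s0; rewrite ge0_integralZl_EFin' ?k0//.
  by rewrite mE -EFinM mulrAC.
rewrite -!lee_fin rE !E//; apply/andP; split; apply: le_integral_EFin => //.
- by move=> x; rewrite mulr_ge0 ?k0.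
- exact: measurable_funM.
- move=> x; rewrite lik_node mulrC; apply: ler_wpM2l => //.
  have -> : (sm ^+ 2 * P = (sm * root l (sub y false)) * (sm * root r (sub y true)))%R.
    by rewrite /P; ring.
  by apply: ler_pM; rewrite ?branch_ge// mulr_ge0 ?root_ge0// ltW.
- exact: measurable_funM.
- move=> x; rewrite lik_node [leRHS]mulrC; apply: ler_wpM2l => //.
  have -> : (sp ^+ 2 * P = (sp * root l (sub y false)) * (sp * root r (sub y true)))%R.
    by rewrite /P; ring.
  by apply: ler_pM; rewrite ?branch_le ?branch_ge0.
Qed.

Lemma mean_g_gt0 y : (0 < mean_g y)%R.
Proof. by have [_ /andP[h _]] := mean_gE y; exact: lt_le_trans h. Qed.

Lemma root_empty y : root Empty y = 1%R.
Proof. by apply: EFin_inj; rewrite -rootE_root /rootE /= prob_integral_cst. Qed.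

Lemma root_gt0 sh y : (0 < root sh y)%R.
Proof.
elim: sh y => [|l IHl r IHr] y; first by rewrite root_empty.
have /andP[h _] := root_node l r y; apply: lt_le_trans h.
by rewrite !mulr_gt0 ?exprn_gt0 ?mean_g_gt0.
Qed.

Lemma branch_gt0 sh x y : (0 < branch sh x y)%R.
Proof. by apply: lt_le_trans (branch_ge sh x y); rewrite mulr_gt0 ?root_gt0. Qed.

Lemma lik_gt0 sh x y : (0 < lik sh x y)%R.
Proof.
case: sh => [|l r]; first by rewrite /lik /= ltr01.
by rewrite lik_node !mulr_gt0 ?branch_gt0 ?(rm_g_gt0 M).
Qed.

(** A bound for the logarithm of every value of q. *)
Definition cq : R := (`|ln sm| + `|ln sp|)%R.

Lemma cq_ge0 : (0 <= cq)%R. Proof. exact: addr_ge0. Qed.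

Lemma cq_sm : (- cq <= ln sm)%R.
Proof.
rewrite lerNl; apply: le_trans (ler_norm _) _; rewrite normrN.
by rewrite lerDl.
Qed.

Lemma cq_sp : (ln sp <= cq)%R.
Proof. by apply: le_trans (ler_norm _) _; rewrite lerDr. Qed.

Lemma ln_branch sh x y : (`|ln (branch sh x y) - ln (root sh y)| <= cq)%R.
Proof.
have r0 := root_gt0 sh y; have b0 := branch_gt0 sh x y.
have h1 : (ln (sm * root sh y) <= ln (branch sh x y))%R.
  by rewrite ler_ln ?branch_ge// posrE mulr_gt0.
have h2 : (ln (branch sh x y) <= ln (sp * root sh y))%R.
  by rewrite ler_ln ?branch_le// posrE mulr_gt0.
rewrite !lnM ?posrE// in h1 h2; have := cq_sm; have := cq_sp.
rewrite ler_norml => ? ?; apply/andP; split; lra.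
Qed.

(** The cost of cutting both edges below a vertex carrying y, together with a bound
for the logarithm of the mean density of y. *)
Definition vertex_err (y : Y) : R := (2 * cq + `|ln bp| + `|ln (bm y)|)%R.

Lemma vertex_err_ge0 y : (0 <= vertex_err y)%R.
Proof. by rewrite !addr_ge0// mulr_ge0// cq_ge0. Qed.

Lemma ln_mean_g y : (`|ln (mean_g y)| <= `|ln bp| + `|ln (bm y)|)%R.
Proof.
have [_ /andP[h1 h2]] := mean_gE y.
have m0 := mean_g_gt0 y.
have bp0 : (0 < bp)%R by exact: lt_le_trans h2.
have k1 : (ln (bm y) <= ln (mean_g y))%R by rewrite ler_ln ?posrE.
have k2 : (ln (mean_g y) <= ln bp)%R by rewrite ler_ln ?posrE.
have := ler_norm (ln bp); have := ler_norm (- ln (bm y)); rewrite normrN.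
have := normr_ge0 (ln bp); have := normr_ge0 (ln (bm y)).
by move=> ? ? ? ?; rewrite ler_norml; apply/andP; split; lra.
Qed.

Lemma ln_root_node l r y :
  (`|ln (root (Node l r) y) - ln (root l (sub y false)) - ln (root r (sub y true))|
    <= vertex_err (y [::]))%R.
Proof.
have /andP[h1 h2] := root_node l r y.
have [a0 b0 c0] := And3 (root_gt0 l (sub y false)) (root_gt0 r (sub y true))
  (root_gt0 (Node l r) y).
have m0 := mean_g_gt0 (y [::]).
have k1 : (ln (sm ^+ 2 * mean_g (y [::]) * (root l (sub y false) * root r (sub y true)))
   <= ln (root (Node l r) y))%R.
  by rewrite ler_ln ?posrE// !mulr_gt0 ?exprn_gt0.
have k2 : (ln (root (Node l r) y) <=
   ln (sp ^+ 2 * mean_g (y [::]) * (root l (sub y false) * root r (sub y true))))%R.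
  by rewrite ler_ln ?posrE// !mulr_gt0 ?exprn_gt0.
rewrite !lnM ?posrE ?mulr_gt0 ?exprn_gt0// in k1 k2.
have := ln_mean_g (y [::]); rewrite ler_norml => /andP[k3 k4].
have := cq_sm; have := cq_sp; rewrite /vertex_err => ? ?.
by rewrite ler_norml; apply/andP; split; lra.
Qed.

Definition flog n (y : cfg) : R := ln (root (full n) y).

(** Peeling off the vertices one by one bounds flog by the sum of the errors e of
all the vertices in the first n levels. *)
Fixpoint envelope (e : Y -> R) n (y : cfg) : R :=
  if n is n'.+1 then
    (e (y [::]) + (envelope e n' (sub y false) + envelope e n' (sub y true)))%R
  else 0%R.

Lemma flog0 y : flog 0 y = 0%R.
Proof. by rewrite /flog /= root_empty ln1. Qed.

Lemma flogS n y : (`|flog n.+1 y - flog n (sub y false) - flog n (sub y true)|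
  <= vertex_err (y [::]))%R.
Proof. exact: ln_root_node. Qed.

Lemma flog_envelope n y : (`|flog n y| <= envelope vertex_err n y)%R.
Proof.
elim: n y => [|n IH] y; first by rewrite flog0 normr0.
have := flogS n y; have := IH (sub y false); have := IH (sub y true).
rewrite !ler_norml /= => /andP[? ?] /andP[? ?] /andP[? ?].
by apply/andP; split; lra.
Qed.

Lemma ln_lik_node n x y :
  (`|ln (lik (full n.+1) x y) - ln (g x (y [::])) -
     flog n (sub y false) - flog n (sub y true)| <= 2 * cq)%R.
Proof.
have b b' := branch_gt0 (full n) x (sub y b').
rewrite [full _]/= lik_node !lnM ?posrE ?mulr_gt0 ?(rm_g_gt0 M)//.
have := ln_branch (full n) x (sub y false).
have := ln_branch (full n) x (sub y true).
rewrite /flog !ler_norml => /andP[? ?] /andP[? ?].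
by apply/andP; split; lra.
Qed.

(** The product of the likelihoods of the first k levels of the subtrees rooted at
height N, with root states drawn from lambda. *)
Definition cut_weight N k (y : cfg) : R := expR (2 ^+ N * avg (flog k) N y).

Lemma cut_weightS N k y : cut_weight N.+1 k y =
  (cut_weight N k (sub y false) * cut_weight N k (sub y true))%R.
Proof. by rewrite /cut_weight -expRD; congr (expR _); rewrite /= exprS; field. Qed.

(** Each of the 2^N edges entering level N costs a factor in
[expR (- cq), expR cq]; the factors are carried up to the root by the recursion. *)
Lemma branch_cut N k x y :
  (expR (- (2 ^+ N * cq)) * cut_weight N k y)%:E * branchE (full N) x y <=
    branchE (full (N + k)) x y /\
  branchE (full (N + k)) x y <=
    (expR (2 ^+ N * cq) * cut_weight N k y)%:E * branchE (full N) x y.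
Proof.
have cw0 n z : (0 < cut_weight n k z)%R by exact: expR_gt0.
elim: N x y => [|N IH] x y.
  have -> : branchE (full 0) x y = 1.
    by rewrite branchE_integral /=; under eq_integral do rewrite mule1; exact: q1.
  rewrite !mule1 /cut_weight expr0 !mul1r /= lnK ?posrE ?root_gt0//.
  have er : (expR (- cq) <= sm)%R.
    by rewrite -[leRHS]lnK ?posrE// ler_expR cq_sm.
  have er' : (sp <= expR cq)%R.
    by rewrite -[leLHS]lnK ?posrE// ler_expR cq_sp.
  rewrite add0n branchE_branch !lee_fin; split.
    by apply: le_trans (branch_ge _ _ _); rewrite ler_wpM2r ?root_ge0.
  by apply: le_trans (branch_le _ _ _) _; rewrite ler_wpM2r ?root_ge0.
have E (s : R) : (expR (s * (2 ^+ N.+1 * cq)) * cut_weight N.+1 k y =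
   (expR (s * (2 ^+ N * cq)) * cut_weight N k (sub y false)) *
   (expR (s * (2 ^+ N * cq)) * cut_weight N k (sub y true)))%R.
  have -> : (s * (2 ^+ N.+1 * cq) = s * (2 ^+ N * cq) + s * (2 ^+ N * cq))%R.
    by rewrite exprS; ring.
  by rewrite expRD cut_weightS mulrACA.
have E1 := E 1%R; have E2 := E (-1)%R; rewrite !mul1r !mulN1r in E1 E2.
rewrite E1 E2 addSn.
have pos c n z : (0 <= (expR c * cut_weight n k z)%:E :> \bar R).
  by rewrite lee_fin mulr_ge0 ?expR_ge0// ltW.
have posr c n z : (0 <= expR c * cut_weight n k z)%R.
  by rewrite mulr_ge0 ?expR_ge0// ltW.
have b0 n x' z : 0 <= branchE (full n) x' z by exact: branchE_ge0.
have ql x' : 0 <= (q x x')%:E * likE (full N.+1) x' y.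
  by apply: mule_ge0; rewrite ?lee_fin ?likE_ge0.
rewrite !branchE_integral; split.
- rewrite [leLHS](_ : _ = \int[lambda]_x' ((expR (- (2 ^+ N * cq)) * cut_weight N k (sub y false) *
    (expR (- (2 ^+ N * cq)) * cut_weight N k (sub y true)))%:E *
    ((q x x')%:E * likE (full N.+1) x' y))); last first.
    rewrite ge0_integralZl//.
    + exact: measurable_qlikE.
    + by rewrite lee_fin mulr_ge0.
  apply: ge0_le_integral => //.
  + by move=> x' _; apply: mule_ge0 => //; rewrite lee_fin mulr_ge0.
  + by apply: emeasurable_funM => //; exact: measurable_qlikE.
  + exact: measurable_qlikE.
  move=> x' _; rewrite muleCA; apply: lee_wpmul2l; first by rewrite lee_fin.
  rewrite [full N.+1]/= [full (N + k).+1]/= !likE_node muleCA.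
  apply: lee_wpmul2l; first by rewrite lee_fin.
  rewrite EFinM muleACA; apply: lee_pmul.
  + exact: mule_ge0.
  + exact: mule_ge0.
  + by have [] := IH x' (sub y false).
  + by have [] := IH x' (sub y true).
- rewrite [leRHS](_ : _ = \int[lambda]_x' ((expR (2 ^+ N * cq) * cut_weight N k (sub y false) *
    (expR (2 ^+ N * cq) * cut_weight N k (sub y true)))%:E *
    ((q x x')%:E * likE (full N.+1) x' y))); last first.
    rewrite ge0_integralZl//.
    + exact: measurable_qlikE.
    + by rewrite lee_fin mulr_ge0.
  apply: ge0_le_integral => //.
  + by move=> x' _; apply: mule_ge0; rewrite ?lee_fin ?likE_ge0.
  + exact: measurable_qlikE.
  + by apply: emeasurable_funM => //; exact: measurable_qlikE.
  move=> x' _; rewrite [leRHS]muleCA; apply: lee_wpmul2l; first by rewrite lee_fin.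
  rewrite [full N.+1]/= [full (N + k).+1]/= !likE_node [leRHS]muleCA.
  apply: lee_wpmul2l; first by rewrite lee_fin.
  rewrite EFinM muleACA; apply: lee_pmul => //.
  + by have [] := IH x' (sub y false).
  + by have [] := IH x' (sub y true).
Qed.

Lemma ln_branch_cut N k x y :
  (`|ln (branch (full (N + k)) x y) - ln (branch (full N) x y) -
     2 ^+ N * avg (flog k) N y| <= 2 ^+ N * cq)%R.
Proof.
have [] := branch_cut N k x y; rewrite !branchE_branch -!EFinM !lee_fin => h1 h2.
have b0 n := branch_gt0 (full n) x y.
have cw0 : (0 < cut_weight N k y)%R by exact: expR_gt0.
have k1 : (ln (expR (- (2 ^+ N * cq)) * cut_weight N k y * branch (full N) x y)
   <= ln (branch (full (N + k)) x y))%R.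
  by rewrite ler_ln ?posrE// !mulr_gt0 ?expR_gt0.
have k2 : (ln (branch (full (N + k)) x y) <=
   ln (expR (2 ^+ N * cq) * cut_weight N k y * branch (full N) x y))%R.
  by rewrite ler_ln ?posrE// !mulr_gt0 ?expR_gt0.
rewrite !lnM ?posrE ?mulr_gt0 ?expR_gt0// /cut_weight !expRK in k1 k2.
by rewrite ler_norml; apply/andP; split; lra.
Qed.

Lemma ln_lik_cut N k x y :
  (`|ln (lik (full (N.+1 + k)) x y) - ln (lik (full N.+1) x y) -
     2 ^+ N.+1 * avg (flog k) N.+1 y| <= 2 ^+ N.+1 * cq)%R.
Proof.
have b n b' := branch_gt0 (full n) x (sub y b').
rewrite addSn [full _]/= [full N.+1]/= !lik_node !lnM ?posrE ?mulr_gt0 ?(rm_g_gt0 M)//.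
have := ln_branch_cut N k x (sub y false).
have := ln_branch_cut N k x (sub y true).
rewrite !ler_norml => /andP[? ?] /andP[? ?].
rewrite [avg _ _ _]/=.
have -> (a b' : R) : (2 ^+ N.+1 * ((a + b') / 2) = 2 ^+ N * a + 2 ^+ N * b')%R.
  by rewrite exprS; field.
rewrite exprS -mulrA.
by apply/andP; split; lra.
Qed.

Lemma likE_trunc_gen sh n x y :
  (forall w, w \in nodes sh -> (size w < n)%N) ->
  likE sh x (trunc n y) = likE sh x y.
Proof.
elim: sh n x y => [//|l IHl r IHr] [|n] x y sn; first by have := sn [::] isT.
have sb b w : w \in nodes (if b then r else l) -> (size w < n)%N.
  by rewrite -mem_nodes_cons => /sn.
rewrite !likE_node !branchE_integral !sub_trunc.
congr (_ * (_ * _)); apply: eq_integral => x' _.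
  by rewrite IHl//; exact: (sb false).
by rewrite IHr//; exact: (sb true).
Qed.

Lemma likE_trunc n x y : likE (full n) x (trunc n y) = likE (full n) x y.
Proof. by apply: likE_trunc_gen => w; rewrite mem_full. Qed.

Lemma flog_trunc n y : flog n (trunc n y) = flog n y.
Proof.
rewrite /flog /root /rootE; congr (ln (fine _)).
by apply: eq_integral => x _; exact: likE_trunc.
Qed.

Lemma measurable_rootE sh : measurable_fun setT (rootE sh).
Proof.
apply: (measurable_fun_fubini_tonelli_F (m2 := lambda)
  (fun p : cfg * X => likE sh p.2 p.1)).
- have [mL _] := measurable_likE_branchE lambda q0 g0 mq mg sh.
  apply: (measurableT_comp mL (g := fun p : cfg * X => (p.2, p.1))).
  exact: measurable_fun_pair.
- by move=> p; exact: likE_ge0.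
Qed.

Lemma measurable_flog n : measurable_fun setT (flog n).
Proof.
apply: (measurableT_comp (@measurable_ln R)); apply: measurableT_comp => //.
exact: measurable_rootE.
Qed.

End likelihood_bounds.

(** * Conditional likelihoods in breadth-first order *)

(** The subtree of the words preceding s in breadth-first order; cut_le also
contains s. Left of the path to s a branch reaches the level of s, right of it the
branch stops one level above. *)
Fixpoint cut_lt (s : seq bool) : shape :=
  if s is b :: s' then
    if b then Node (full (size s').+1) (cut_lt s')
    else Node (cut_lt s') (full (size s'))
  else Empty.

Fixpoint cut_le (s : seq bool) : shape :=
  if s is b :: s' then
    if b then Node (full (size s').+1) (cut_le s')
    else Node (cut_le s') (full (size s'))
  else Node Empty Empty.

Lemma perm_words_cons k :
  perm_eq (words k.+1) (map (cons false) (words k) ++ map (cons true) (words k)).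
Proof.
apply: uniq_perm; first exact: uniq_words.
  rewrite cat_uniq !(map_inj_uniq (@cons_inj _)) !uniq_words andbT.
  by apply/hasPn => w /mapP[u _ ->]; apply/mapP => -[].
move=> w; rewrite words_size mem_cat; case: w => [|b w].
  by symmetry; apply/norP; split; apply/mapP => -[].
have H c : (b :: w \in map (cons c) (words k)) = (b == c) && (size w == k).
  rewrite -words_size; apply/mapP/andP => [[u us [-> ->]]|[/eqP-> ws]] //.
  by exists w.
by rewrite !H /= eqSS; case: b {H} => //=; rewrite ?orbF.
Qed.

(** In breadth-first order the words of length k are the increments leading from
the first k levels to the first k + 1. The sum may be split over the two branches
because Phi is arbitrary: the left branch grows first, the right one afterwards. *)
Lemma telescope_words (V : zmodType) (Phi : shape -> V) k :
  \sum_(s <- words k) (Phi (cut_le s) - Phi (cut_lt s)) =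
  Phi (full k.+1) - Phi (full k).
Proof.
elim: k Phi => [|k IH] Phi; first by rewrite big_seq1.
rewrite (perm_big _ (perm_words_cons k)) big_cat !big_map /=.
have -> : \sum_(s <- words k) (Phi (Node (cut_le s) (full (size s))) -
    Phi (Node (cut_lt s) (full (size s)))) =
  \sum_(s <- words k) (Phi (Node (cut_le s) (full k)) -
    Phi (Node (cut_lt s) (full k))).
  by apply: eq_big_seq => s; rewrite words_size => /eqP ->.
have -> : \sum_(s <- words k) (Phi (Node (full (size s).+1) (cut_le s)) -
    Phi (Node (full (size s).+1) (cut_lt s))) =
  \sum_(s <- words k) (Phi (Node (full k.+1) (cut_le s)) -
    Phi (Node (full k.+1) (cut_lt s))).
  by apply: eq_big_seq => s; rewrite words_size => /eqP ->.
rewrite (IH (fun sh => Phi (Node sh (full k)))).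
rewrite (IH (fun sh => Phi (Node (full k.+1) sh))).
by rewrite addrC addrA subrK.
Qed.

Section conditional_likelihood.
Context (R : realType) (dX dY : measure_display).
Context (X : measurableType dX) (Y : measurableType dY).
Variables (lambda : probability X R) (mu : {sigma_finite_measure set Y -> \bar R}).
Variables (sm sp bp : R) (q : X -> X -> R) (g : X -> Y -> R).
Variables (Q : R.-pker X ~> X) (G : R.-pker X ~> Y).
Hypothesis M : regular_model lambda mu sm sp bp q g Q G.
Variable bm : Y -> R.
Hypothesis bm0 : forall y, 0 < bm y.
Hypothesis bm_le : forall y, ((bm y)%:E <= \int[lambda]_x (g x y)%:E)%E.

Let q0 := rm_q0 M.
Let g0 := rm_g0 M.
Let gb := rm_gb M.
Let q1 := rm_q1 M.
Let mq := rm_mq M.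
Let mg := rm_mg M.
Let sp0 : 0 < sp := sp_gt0 (rm_sm_gt0 M) (rm_q_bounds M).
Let sm0 := rm_sm_gt0 M.

Local Notation cfg := (config (seq bool) Y).
Local Notation lik := (lik lambda q g).
Local Notation branch := (branch lambda q g).
Local Notation mean_g := (mean_g lambda g).
Let lik_gt0' := lik_gt0 M bm0 bm_le.
Let branch_gt0' := branch_gt0 M bm0 bm_le.

(** The conditional likelihood of the observation at s given those at the words
preceding it and the state x of the root. *)
Definition ratio s x y : R := lik (cut_le s) x y / lik (cut_lt s) x y.
Definition hlog s x y : R := ln (ratio s x y).

Lemma sum_hlog k x y : \sum_(s <- words k) hlog s x y =
  ln (lik (full k.+1) x y) - ln (lik (full k) x y).
Proof.
rewrite -(telescope_words (fun sh => ln (lik sh x y))); apply: eq_bigr => s _.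
by rewrite /hlog /ratio ln_div ?posrE.
Qed.

Lemma ratio_nil x y : ratio [::] x y = g x (y [::]).
Proof.
rewrite /ratio (lik_node M) /lik /= divr1.
have H z : branch Empty x z = 1; last by rewrite !H !mulr1.
by apply: EFin_inj; rewrite -(branchE_branch M) /branchE /=;
  under eq_integral do rewrite mule1; exact: q1.
Qed.

Lemma ratio_cons b s x y : ratio (b :: s) x y =
  branch (cut_le s) x (sub y b) / branch (cut_lt s) x (sub y b).
Proof.
have gn0 : g x (y [::]) != 0 by rewrite gt_eqF// (rm_g_gt0 M).
have bn0 sh z : branch sh x z != 0 by rewrite gt_eqF.
rewrite /ratio /=; case: b; rewrite !(lik_node M).
  by field; rewrite gn0 !bn0.
by field; rewrite gn0 !bn0.
Qed.

Lemma measurable_lik2 sh y : measurable_fun setT (lik sh ^~ y).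
Proof. by apply: measurableT_comp => //; exact: measurable_likE2. Qed.

Lemma measurable_lik1 sh x : measurable_fun setT (lik sh x : cfg -> R).
Proof. by apply: measurableT_comp => //; exact: measurable_likE1. Qed.

Lemma ratio_gt0 s x y : 0 < ratio s x y.
Proof. by rewrite divr_gt0. Qed.

Lemma measurable_ratio s y : measurable_fun setT (ratio s ^~ y).
Proof.
have -> : ratio s ^~ y = (fun x => expR (ln (lik (cut_le s) x y) -
    ln (lik (cut_lt s) x y))).
  by apply/funext => x; rewrite -ln_div ?posrE// lnK// posrE ratio_gt0.
apply: (measurableT_comp (@measurable_expR R)).
by apply: measurable_funB; apply: (measurableT_comp (@measurable_ln R));
  exact: measurable_lik2.
Qed.

(** Seen from one ancestor further up, the ratio at state x is the mean of the
former ratios under the density q x weighted by the likelihood of the past: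
Doeblin's contraction applies. *)
Lemma ratio_step b s y a c : 0 <= a -> (forall x, a <= ratio s x (sub y b) <= c) ->
  exists a' c', [/\ a <= a', c' <= c, c' - a' = (1 - sm / sp) * (c - a) &
    forall x, a' <= ratio (b :: s) x y <= c'].
Proof.
move=> a0 rac.
have L0 x : 0 <= lik (cut_lt s) x (sub y b) by exact: ltW.
have l0 : 0 < root lambda q g (cut_lt s) (sub y b) by exact: (root_gt0 M bm0 bm_le).
have Ll : (\int[lambda]_x (lik (cut_lt s) x (sub y b))%:E =
    (root lambda q g (cut_lt s) (sub y b))%:E)%E.
  rewrite -(rootE_root M); apply: eq_integral => x _.
  by rewrite (likE_lik M).
have [a' [c' [aa' _ cc' ca' H]]] := doeblin sm0 (rm_q_bounds M) mq a0 L0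
  (measurable_lik2 _ _) (measurable_ratio _ _) rac Ll l0.
exists a', c'; split => // x; have [D [N [DE NE D0 DN ND]]] := H x.
have Db : branch (cut_lt s) x (sub y b) = D.
  apply: EFin_inj; rewrite -DE -(branchE_branch M); apply: eq_integral => x' _.
  by rewrite (likE_lik M) EFinM.
have Nb : branch (cut_le s) x (sub y b) = N.
  apply: EFin_inj; rewrite -NE -(branchE_branch M); apply: eq_integral => x' _.
  rewrite (likE_lik M) -EFinM; congr (_%:E); rewrite -mulrA; congr (_ * _).
  by rewrite /ratio mulrCA divff ?mulr1// gt_eqF.
by rewrite ratio_cons Db Nb ler_pdivlMr// ler_pdivrMr// DN ND.
Qed.

Lemma ratio_keep b s y a c : 0 <= a -> (forall x, a <= ratio s x (sub y b) <= c) ->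
  forall x, a <= ratio (b :: s) x y <= c.
Proof.
move=> a0 rac x; have [a' [c' [aa' cc' _ H]]] := ratio_step a0 rac.
have /andP[h1 h2] := H x.
by rewrite (le_trans aa' h1) (le_trans h2 cc').
Qed.

Lemma ratio_single b x y : let m := mean_g (y [:: b]) in
  sm * m <= ratio [:: b] x y <= sp * m.
Proof.
have mE : mean_g (y [:: b]) = root lambda q g (Node Empty Empty) (sub y b).
  congr fine; apply: eq_integral => x' _; rewrite (likE_lik M); congr (_%:E).
  rewrite (lik_node M); have H z : branch Empty x' z = 1; last by rewrite !H !mulr1.
  by apply: EFin_inj; rewrite -(branchE_branch M) /branchE /=;
    under eq_integral do rewrite mule1; exact: q1.
rewrite /= ratio_cons mE.
have -> : branch (cut_lt [::]) x (sub y b) = 1.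
  by apply: EFin_inj; rewrite -(branchE_branch M) /branchE /=;
    under eq_integral do rewrite mule1; exact: q1.
by rewrite divr1 (branch_ge M) (branch_le M).
Qed.

(* Moving up the ancestral line U: yk k is the configuration seen from the k-th
   ancestor and ykS says that going down by U k gives back the previous one. *)
Section ancestral_line.
Variables (U : nat -> bool) (yk : nat -> seq bool -> Y).
Hypothesis ykS : forall k, sub (yk k.+1) (U k) = yk k.

(** The word leading from the k-th ancestor down to the origin. *)
Fixpoint spine (k : nat) : seq bool :=
  if k is k'.+1 then U k' :: spine k' else [::].

Let r k x := ratio (spine k) x (yk k).

Let r_keep k a c : 0 <= a -> (forall x, a <= r k x <= c) ->
  forall j, (k <= j)%N -> forall x, a <= r j x <= c.
Proof.
move=> a0 rac j; elim: j => [|j IH].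
  by rewrite leqn0 => /eqP <-.
rewrite leq_eqVlt => /orP[/eqP <- //|]; rewrite ltnS => /IH H.
by apply: ratio_keep => // x; rewrite ykS; exact: H.
Qed.

Let rho : R := 1 - sm / sp.

(** Nested intervals containing all later ratios; the initial length bp is the
bound on g. *)
Lemma ratio_interval k : exists a c, [/\ 0 <= a, c - a = rho ^+ k * bp &
  forall j, (k <= j)%N -> forall x, a <= r j x <= c].
Proof.
elim: k => [|k [a [c [a0 ca H]]]].
  exists 0, bp; split => //; first by rewrite subr0 expr0 mul1r.
  apply: (r_keep (k := 0)) => // x.
  by rewrite /r ratio_nil g0 (rm_g_le M).
have [|a' [c' [aa' cc' ca' H']]] := @ratio_step (U k) (spine k) (yk k.+1) a c a0.
  by move=> x; rewrite ykS; exact: H.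
exists a', c'; split; first exact: le_trans aa'.
  by rewrite ca' ca exprS mulrA.
by apply: r_keep => //; exact: le_trans aa'.
Qed.

Lemma ratio_bounds k x : sm * mean_g (yk 0 [::]) <= r k.+1 x <= sp * mean_g (yk 0 [::]).
Proof.
have m0 : 0 < mean_g (yk 0 [::]) := mean_g_gt0 M bm0 bm_le _.
apply: (r_keep (k := 1)) => //; first by rewrite mulr_ge0// ltW.
by move=> x'; rewrite /r /= -(ykS 0); exact: ratio_single.
Qed.

Lemma hlog_bound k x : `|hlog (spine k.+1) x (yk k.+1)| <=
  vertex_err sm sp bp bm (yk 0 [::]).
Proof.
have /andP[h1 h2] := ratio_bounds k x.
have m0 : 0 < mean_g (yk 0 [::]) := mean_g_gt0 M bm0 bm_le _.
have r0 : 0 < r k.+1 x by exact: ratio_gt0.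
have k1 : ln (sm * mean_g (yk 0 [::])) <= ln (r k.+1 x).
  by rewrite ler_ln ?posrE// mulr_gt0.
have k2 : ln (r k.+1 x) <= ln (sp * mean_g (yk 0 [::])).
  by rewrite ler_ln ?posrE// mulr_gt0.
have e (s : R) : 0 < s -> ln (s * mean_g (yk 0 [::])) = ln s + ln (mean_g (yk 0 [::])).
  by move=> s0; rewrite lnM ?posrE.
rewrite !e// in k1 k2.
have := ln_mean_g M bm0 bm_le (yk 0 [::]); rewrite ler_norml => /andP[k3 k4].
have := cq_sm sm sp; have := cq_sp sm sp; have := cq_ge0 sm sp => c0 c1 c2.
rewrite /vertex_err -/(r k.+1 x) ler_norml /hlog -/(r k.+1 x).
by apply/andP; split; lra.
Qed.

(** The nested intervals shrink to one point, which is positive by ratio_bounds,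
so the logarithms converge as well, to a limit independent of x. *)
Lemma hlog_cvg : exists l : R, forall x, (fun k => hlog (spine k) x (yk k)) @ \oo --> l.
Proof.
have sspos : 0 < sm / sp by rewrite divr_gt0.
have rho0 : 0 <= rho.
  by rewrite subr_ge0 ler_pdivrMr// mul1r; exact: (smsp (rm_q_bounds M)).
have rho1 : rho < 1 by rewrite ltrBlDr ltrDl.
have bp0 : 0 < bp := lt_le_trans (rm_g_gt0 M point point) (rm_g_le M point point).
have rho_cvg : (fun k => rho ^+ k * bp) @ \oo --> (0 : R).
  rewrite -(mul0r bp); apply: cvgM; last exact: cvg_cst.
  by apply: cvg_expr; rewrite ger0_norm.
have close e : 0 < e -> \forall k \near \oo, forall j, (k <= j)%N ->
    forall x x', `|r k x - r j x'| < e.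
  move=> e0; move/cvgr0Pnorm_lt: rho_cvg => /(_ _ e0); apply: filterS => k.
  have [a [c [a0 ca H]]] := ratio_interval k.
  move=> ke j kj x x'; have /andP[? ?] := H k (leqnn k) x.
  have /andP[? ?] := H j kj x'.
  have p0 : 0 <= rho ^+ k * bp by apply: mulr_ge0; [exact: exprn_ge0|exact: ltW].
  apply: le_lt_trans ke; rewrite [leRHS]ger0_norm// -ca.
  by rewrite ler_norml; apply/andP; split; lra.
have rc : cvg ((fun k => r k point) @ \oo).
  apply/cauchy_cvgP/cauchy_exP => e e0.
  have [k _ /(_ k (leqnn k)) H] := close _ e0.
  exists (r k point); exists k => // j kj /=; exact: H.
pose l := lim ((fun k => r k point) @ \oo).
have rl x : (fun k => r k x) @ \oo --> l.
  apply/cvgrPdist_lt => e e0.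
  have e20 : 0 < e / 2 by rewrite divr_gt0.
  have /cvgrPdist_lt/(_ _ e20) H1 := rc.
  near=> k.
  have h1 : `|l - r k point| < e / 2 by near: k.
  have h2 : `|r k point - r k x| < e / 2.
    near: k; move: (close _ e20); apply: filterS => k Hk; exact: Hk.
  rewrite [ltRHS]splitr; apply: le_lt_trans (ltrD h1 h2).
  by apply: le_trans (ler_normD _ _); rewrite addrA subrK.
have l0 : 0 < l.
  apply: (@lt_le_trans _ _ (sm * mean_g (yk 0 [::]))).
    by rewrite mulr_gt0// (mean_g_gt0 M bm0 bm_le).
  apply: limr_ge => //; exists 1%N => // -[//|k] _ /=.
  by case/andP: (ratio_bounds k point).
exists (ln l) => x; apply: (continuous_cvg _ _ (rl x)).
exact: continuous_ln.
Unshelve. all: by end_near.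
Qed.

End ancestral_line.
End conditional_likelihood.

(** * The extended tree *)

(** When s leads from the ancestor number size s down to the origin, emb s
identifies the binary tree with the descendants of this ancestor, in the plane
order. *)
Fixpoint emb (s w : seq bool) : vertex :=
  if s is b :: s' then
    if w is c :: w' then if c == b then emb s' w' else Graft (size s') w'
    else Anc (size s')
  else Core w.

Lemma emb_Anc s w j : emb s w = Anc j -> (j < size s)%N.
Proof.
elim: s w => [|b s IH] [|c w] //=; first by case=> <-.
by case: eqP => // _ /IH /ltnW.
Qed.

Lemma emb_Graft s w j u : emb s w = Graft j u -> (j < size s)%N.
Proof.
elim: s w => [|b s IH] [|c w] //=.
by case: eqP => [_ /IH /ltnW|_ [<-]].
Qed.

(** A word leaving the path s at depth i ends in the grafted tree whose index is
the remaining length of s; the index determines the exit point. *)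
Lemma emb_inj s : injective (emb s).
Proof.
elim: s => [|b s IH] [|c w] [|c' w'] //=.
- by case=> -> ->.
- case: eqP => // _ /esym /emb_Anc; by rewrite ltnn.
- case: eqP => // _ /emb_Anc; by rewrite ltnn.
- case: eqP => [->|cb]; case: eqP => [->|c'b].
  + by move/IH => ->.
  + by move/emb_Graft; rewrite ltnn.
  + by move/esym/emb_Graft; rewrite ltnn.
  + by case=> ->; case: c c' b cb c'b => [] [] [].
Qed.

Lemma word_parent_rcons w b : word_parent (rcons w b) = w.
Proof. by case: w => [|a w] //=; rewrite belast_rcons. Qed.

Lemma vparent_Core w b : vparent (Core (rcons w b)) = Core w.
Proof. by rewrite -[in RHS](word_parent_rcons w b); case: w. Qed.

Lemma vparent_Graft j w b : vparent (Graft j (rcons w b)) = Graft j w.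
Proof. by rewrite -[in RHS](word_parent_rcons w b); case: w. Qed.

Lemma vparent_emb_nil s : vparent (emb s [::]) = Anc (size s).
Proof. by case: s. Qed.

Lemma emb_embedding s : embedding vparent (emb s).
Proof.
split; first exact: emb_inj.
elim: s => [|c s IH] w b; first exact: vparent_Core.
case: w => [|a w] /=; last by case: eqP => _; [exact: IH|exact: vparent_Graft].
by case: eqP => _ //; exact: vparent_emb_nil.
Qed.

Lemma size_spine U k : size (spine U k) = k.
Proof. by elim: k => //= k ->. Qed.

Lemma anc_origin U k : anc k origin = emb (spine U k) [::].
Proof.
elim: k => [//|k IH].
by rewrite /anc iterS -/(anc k origin) IH vparent_emb_nil.
Qed.

Lemma anc_origin_S k : anc k.+1 origin = Anc k.
Proof. by rewrite (anc_origin (fun=> false)) /= size_spine. Qed.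

Lemma emb_spine U k : emb (spine U k) (spine U k) = origin.
Proof. by elim: k => //= k IH; rewrite eqxx. Qed.

Lemma anc_Anc i j : anc i (Anc j) = Anc (j + i).
Proof. by elim: i => [|i IH]; rewrite ?addn0// /anc iterS -/(anc _ _) IH addnS. Qed.

Lemma take_word (w : seq bool) n : (n < size w)%N ->
  exists b, take n.+1 w = rcons (take n w) b.
Proof. by move=> nw; exists (nth false w n); rewrite (take_nth false nw). Qed.

Lemma anc_Graft i j w : anc i (Graft j w) =
  if (i <= size w)%N then Graft j (take (size w - i) w)
  else Anc (j + (i - (size w).+1)).
Proof.
elim: i => [|i IH]; first by rewrite subn0 take_size.
rewrite /anc iterS -/(anc _ _) IH; case: (ltngtP i (size w)) => iw.
- have [b bE] : exists b, take (size w - i) w = rcons (take (size w - i.+1) w) b.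
    have -> : (size w - i = (size w - i.+1).+1)%N by rewrite subnSK.
    by apply: take_word; rewrite ltn_subrL (leq_ltn_trans _ iw).
  by rewrite bE vparent_Graft.
- by rewrite /= subSn// addnS.
- by rewrite iw subnn take0 /= subnn addn0.
Qed.

(** An explicit form of the set DeltaStar U origin k, in which the order is
replaced by a bound on heights: the grafted tree j lies left of the origin iff
U j holds. *)
Definition before_origin (U : nat -> bool) (k : nat) : set vertex :=
  [set v | match v with
           | Core _ => False
           | Anc j => (j < k)%N
           | Graft j w => (j < k)%N /\ (size w < j + U j)%N
           end].

Lemma side_anc_origin U j : side U (anc j origin) = U j.
Proof. by case: j => [//|j]; rewrite anc_origin_S. Qed.

Lemma bf_lt_Graft U j w : bf_lt U (Graft j w) origin <-> (size w < j + U j)%N.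
Proof.
have h1 : (ht (Graft j w) < ht origin) = (size w < j)%N.
  by rewrite /= subr_lt0 ltz_nat.
have h2 : ht (Graft j w) = ht origin <-> size w = j.
  split=> [/eqP|/= ->]; last by rewrite subrr.
  by rewrite /= subr_eq0 eqz_nat => /eqP.
rewrite /bf_lt h1 h2; split.
  case=> [wj|[wj [i [ne eqS sv so]]]]; first by rewrite (leq_trans wj)// leq_addr.
  have ij : i = j.
    move: eqS ne; rewrite anc_origin_S !anc_Graft wj.
    case: (ltngtP i j) => // ij.
    case: i ij {sv so} => [//|i] ij _; rewrite anc_origin_S subSS.
    by rewrite subnKC.
  have -> : U j = true by rewrite -(side_anc_origin U j) -ij.
  by rewrite wj addn1.
case: (ltngtP (size w) j) => [wj|jw|wj]; first by left.
- case: (U j) => /=; last by rewrite addn0 => /(ltn_trans jw); rewrite ltnn.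
  by rewrite addn1 ltnS leqNgt jw.
- case E : (U j) => /=; last by rewrite addn0 wj ltnn.
  move=> _; right; split => //.
  exists j; split.
  + by rewrite anc_Graft wj leqnn subnn take0; case: (j) => // j'; rewrite anc_origin_S.
  + by rewrite anc_Graft wj leqnn subnn take0 -[RHS]/(anc j.+1 origin) anc_origin_S.
  + by rewrite anc_Graft wj leqnn subnn take0 /= E.
  + by rewrite side_anc_origin.
Qed.

Lemma DeltaStar_before U k : DeltaStar U origin k = before_origin U k.
Proof.
apply/seteqP; split => [v [[i iv] lt]|v].
- case: v iv lt => [w|j|j w] iv lt.
  + case: lt => [//|[/eqP]]; rewrite [_ == _]/= eqz_nat size_eq0 => /eqP w0.
    by move=> [l [+ _ _ _]]; rewrite w0.
  + case: k iv => [|k]; first by rewrite anc_Anc.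
    by rewrite anc_Anc anc_origin_S => -[<-]; rewrite /= ltnS leq_addr.
  + split; last exact/bf_lt_Graft.
    case: k iv => [|k]; rewrite anc_Graft; first by case: ifP.
    rewrite anc_origin_S; case: ifP => // _ [<-].
    by rewrite ltnS leq_addr.
- case: v => [w|j|j w] //=.
  + case: k => // k; rewrite ltnS => jk; split; last by left.
    by exists (k - j)%N; rewrite anc_Anc anc_origin_S subnKC.
  + case: k => [[]//|k] [jk wj]; split; last exact/bf_lt_Graft.
    exists ((size w).+1 + (k - j))%N; rewrite anc_Graft anc_origin_S.
    rewrite leqNgt addSn ltnS leq_addr /=.
    by rewrite subSS addKn subnKC.
Qed.

Lemma mem_nodes_left l r w : (false :: w \in nodes (Node l r)) = (w \in nodes l).
Proof. exact: (mem_nodes_cons l r false). Qed.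

Lemma mem_nodes_right l r w : (true :: w \in nodes (Node l r)) = (w \in nodes r).
Proof. exact: (mem_nodes_cons l r true). Qed.

Lemma mem_cut_lt_cons b s c w :
  (c :: w \in nodes (cut_lt (b :: s))) =
  if c == b then w \in nodes (cut_lt s) else (size w < size s + b)%N.
Proof.
case: b; case: c.
- exact: (mem_nodes_right (full (size s).+1) (cut_lt s) w).
- transitivity (w \in nodes (full (size s).+1)); last by rewrite mem_full addn1.
  exact: (mem_nodes_left (full (size s).+1) (cut_lt s) w).
- transitivity (w \in nodes (full (size s))); last by rewrite mem_full addn0.
  exact: (mem_nodes_right (cut_lt s) (full (size s)) w).
- exact: (mem_nodes_left (cut_lt s) (full (size s)) w).
Qed.

Lemma emb_cut_lt U k : emb (spine U k) @` [set` nodes (cut_lt (spine U k))] =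
  before_origin U k.
Proof.
elim: k => [|k IH].
  apply/seteqP; split => [v [w]//|]; case=> [w|j|j w] //=.
  by case.
apply/seteqP; split => [v [w]|v].
- case: w => [|c w] /=.
    by move=> _ <- /=; rewrite size_spine.
  rewrite -/(cut_lt (U k :: spine U k)) mem_cut_lt_cons; case: eqP => [_ wn <-|cU].
    have : before_origin U k (emb (spine U k) w) by rewrite -IH; exists w.
    case: (emb _ _) => [//|j|j u] /=; first exact: ltnW.
    by move=> [/ltnW].
  by rewrite size_spine => wk <- /=; rewrite ltnS leqnn.
- have sub_k v' : before_origin U k v' -> (emb (spine U k.+1) @`
      [set` nodes (cut_lt (spine U k.+1))]) v'.
    rewrite -IH => -[w wn <-]; exists (U k :: w) => /=; last by rewrite eqxx.
    by rewrite -/(cut_lt (U k :: spine U k)) /mkset mem_cut_lt_cons eqxx.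
  case: v => [w|j|j w] //=.
  + rewrite ltnS leq_eqVlt => /orP[/eqP ->|jk]; last exact: (sub_k (Anc j)).
    exists [::]; last by rewrite /= size_spine.
    by rewrite /=; case: (U k).
  + rewrite ltnS leq_eqVlt => -[/orP[/eqP ->|jk] wj]; last exact: (sub_k (Graft j w)).
    exists (~~ U k :: w) => /=; last by rewrite size_spine; case: (U k).
    rewrite -/(cut_lt (U k :: spine U k)) /mkset mem_cut_lt_cons size_spine.
    by case: (U k) wj.
Qed.

Lemma mem_cut_le s w : (w \in nodes (cut_le s)) = (w \in nodes (cut_lt s)) || (w == s).
Proof.
elim: s w => [|b s IH] [|c w] //.
  by case: b.
have E : (c :: w \in nodes (cut_le (b :: s))) =
    if c == b then w \in nodes (cut_le s) else (size w < size s + b)%N.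
  clear IH; case: b; case: c.
  - exact: (mem_nodes_right (full (size s).+1) (cut_le s) w).
  - transitivity (w \in nodes (full (size s).+1)); last by rewrite mem_full addn1.
    exact: (mem_nodes_left (full (size s).+1) (cut_le s) w).
  - transitivity (w \in nodes (full (size s))); last by rewrite mem_full addn0.
    exact: (mem_nodes_right (cut_le s) (full (size s)) w).
  - exact: (mem_nodes_left (cut_le s) (full (size s)) w).
rewrite E mem_cut_lt_cons eqseq_cons IH; case: eqP => //= _.
by rewrite orbF.
Qed.

Lemma DeltaStar_emb U k :
  DeltaStar U origin k = emb (spine U k) @` [set` nodes (cut_lt (spine U k))].
Proof. by rewrite DeltaStar_before emb_cut_lt. Qed.

Lemma Delta_emb U k :
  Delta U origin k = emb (spine U k) @` [set` nodes (cut_le (spine U k))].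
Proof.
rewrite /Delta DeltaStar_emb; apply/seteqP; split => [v [[w wn <-]|->]|v [w]].
- by exists w => //; rewrite /mkset mem_cut_le wn.
- by exists (spine U k); [rewrite /mkset mem_cut_le eqxx orbT|exact: emb_spine].
- rewrite /mkset mem_cut_le => /orP[wn <-|/eqP -> <-]; first by left; exists w.
  by right; rewrite emb_spine.
Qed.

(** The sets Delta and DeltaStar are the embedded shapes cut_le and cut_lt of the
spine. *)
Lemma h_hlog (R : realType) dX dY (X : measurableType dX) (Y : measurableType dY)
    (lambda : probability X R) (Par : Type) (q : Par -> X -> X -> R)
    (g : Par -> X -> Y -> R) (theta : Par) mu sm sp bp Q G
    (M : regular_model lambda mu sm sp bp (q theta) (g theta) Q G)
    U (y : vertex -> Y) k x :
  h_ lambda q g U y origin k x theta =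
  hlog lambda (q theta) (g theta) (spine U k) x (y \o emb (spine U k)).
Proof.
rewrite /h_ DeltaStar_emb Delta_emb (anc_origin U) /hlog /ratio.
have tl l r := tree_likelihood_shape (rm_q0 M) (rm_g0 M) (rm_mq M) (rm_mg M)
  (rm_q1 M) l r x y (emb_embedding (spine U k)).
congr (ln (_ / _)).
- by case: (spine U k) (tl) => [|b s] tl'; [exact: tl'|rewrite /=; case: b tl' => tl'; exact: tl'].
- case: (spine U k) tl => [|b s] tl'; last by rewrite /=; case: b tl' => tl'; exact: tl'.
  rewrite /tree_likelihood /lik /=; case: asboolP => // -[]; apply/seteqP.
  by split => // v [].
Qed.

(** The tree automorphism that exchanges children along the path s so that s
becomes the leftmost path. The law of the observations is invariant under it,
which is why the coin flips do not affect the law seen from an ancestor. *)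
Fixpoint flip (s w : seq bool) : seq bool :=
  if s is b :: s' then
    if w is c :: w' then if c == b then false :: flip s' w' else true :: w'
    else [::]
  else w.

Lemma emb_flip s w : emb s w = emb (nseq (size s) false) (flip s w).
Proof.
elim: s w => [//|b s IH] [|c w] /=; rewrite ?size_nseq//.
by case: eqP => _ /=; rewrite ?size_nseq.
Qed.

Lemma size_flip s w : size (flip s w) = size w.
Proof. by elim: s w => [//|b s IH] [|c w] //=; case: eqP => _ //=; rewrite IH. Qed.

Lemma flip_inj s : injective (flip s).
Proof.
elim: s => [//|b s IH] [|c w] [|c' w'] //=; do ?by case: eqP.
case: eqP => [->|cb]; case: eqP => [->|c'b] // [].
  by move/IH => ->.
by move=> ->; case: c c' b cb c'b => [] [] [].
Qed.

Lemma perm_flip s n : perm_eq (map (flip s) (nodes (full n))) (nodes (full n)).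
Proof.
apply: uniq_perm.
- by rewrite (map_inj_uniq (@flip_inj s)) uniq_nodes.
- exact: uniq_nodes.
have sub : {subset map (flip s) (nodes (full n)) <= nodes (full n)}.
  by move=> _ /mapP[w + ->]; rewrite !mem_full size_flip.
have [] := uniq_min_size _ sub (eq_leq (esym (size_map _ _))).
  by rewrite (map_inj_uniq (@flip_inj s)) uniq_nodes.
by [].
Qed.

Lemma child_emb k w b : child (emb (nseq k false) w) b =
  emb (nseq k false) (rcons w b).
Proof.
elim: k w b => [//|k IH] [|c w] b /=.
  rewrite size_nseq; case: b => //=; case: k {IH} => //= k.
  by rewrite size_nseq.
by case: c => //=.
Qed.

(** The order in which descend lists the children corresponds to the path made of
left turns only. *)
Lemma descend_emb k w :
  descend (emb (nseq k false) [::]) w = emb (nseq k false) w.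
Proof.
elim/last_ind: w => [//|w b IH].
by rewrite /descend foldl_rcons -/(descend _ _) IH child_emb.
Qed.

Section flip_invariance.
Context (R : realType) (dX dY : measure_display).
Context (X : measurableType dX) (Y : measurableType dY).
Variables (lambda : probability X R) (mu : {sigma_finite_measure set Y -> \bar R}).
Variables (sm sp bp : R) (q : X -> X -> R) (g : X -> Y -> R).
Variables (Q : R.-pker X ~> X) (G : R.-pker X ~> Y).
Hypothesis M : regular_model lambda mu sm sp bp q g Q G.
Local Notation cfg := (config (seq bool) Y).
Local Open Scope ereal_scope.

Lemma likE_flip s n x y :
  likE lambda q g (full n) x (y \o flip s) = likE lambda q g (full n) x y.
Proof.
elim: s n x y => [//|b s IH] [//|n] x y.
rewrite [full _]/= !likE_node.
have H z x' : branchE lambda q g (full n) x' (z \o flip s) =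
    branchE lambda q g (full n) x' z.
  by rewrite /branchE; apply: eq_integral => t _; rewrite IH.
have E1 : sub (y \o flip (b :: s)) b = sub y false \o flip s.
  by apply/funext => w; rewrite /sub /= eqxx.
have E2 : sub (y \o flip (b :: s)) (~~ b) = sub y true.
  by apply/funext => w; rewrite /sub /=; case: (b).
clear IH; case: b E1 E2 => E1 E2.
  by rewrite E1 (E2 : sub _ false = _) H; congr (_ * _); rewrite muleC.
by rewrite E1 (E2 : sub _ true = _) H.
Qed.

Lemma obsE_flip s n x (F : cfg -> \bar R) : (forall y, 0 <= F y) ->
  measurable_fun setT F ->
  obsE lambda mu q g n x (fun y => F (y \o flip s)) = obsE lambda mu q g n x F.
Proof.
move=> F0 mF; rewrite /obsE.
have FL0 (y : cfg) : 0 <= F y * likE lambda q g (full n) x y.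
  by apply: mule_ge0 => //; apply: likE_ge0; [exact: rm_q0 M|exact: rm_g0 M].
have mFL : measurable_fun setT (fun y => F y * likE lambda q g (full n) x y).
  apply: emeasurable_funM => //.
  by apply: measurable_likE1; [exact: rm_q0 M|exact: rm_g0 M|exact: rm_mq M|exact: rm_mg M].
have mflip : measurable_fun setT (fun y : cfg => y \o flip s : cfg).
  by apply: measurable_to_config => w; exact: measurable_coord.
transitivity (mint mu (nodes (full n)) (fun y : cfg =>
    F (y \o flip s) * likE lambda q g (full n) x (y \o flip s)) point).
  by apply: mint_eq => y _; rewrite likE_flip.
rewrite -(mint_perm mu _ _ _ (perm_flip s n)).
- exact: (mint_map mu (nodes (full n))
    (fun y : cfg => F y * likE lambda q g (full n) x y) point (@flip_inj s)).
- by move=> y; exact: (FL0 (y \o flip s)).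
- exact: (measurableT_comp mFL mflip).
Qed.

Lemma trunc_flip s n (y : cfg) : trunc n (y \o flip s) = trunc n y \o flip s :> cfg.
Proof. by apply: funext => w; rewrite /trunc /= size_flip. Qed.

Variable nu : probability X R.
Variables (d : measure_display) (Omega : measurableType d) (P : probability Omega R).
Variables (Xs : vertex -> {RV P >-> X}) (Ys : vertex -> {RV P >-> Y}).
Hypothesis hmm : is_extended_HMT Xs Ys Q G nu.

Lemma integral_emb_obs s n (F : cfg -> \bar R) : (forall y, 0 <= F y) ->
  measurable_fun setT F ->
  \int[obs_law (fun w => Ys (emb s w))]_y F (trunc n y) =
  \int[nu]_t obsE lambda mu q g n t F.
Proof.
move=> F0 mF.
have mflip : measurable_fun setT (fun y : cfg => y \o flip s : cfg).
  by apply: measurable_to_config => w; exact: measurable_coord.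
have mFt : measurable_fun setT (fun y : cfg => F (trunc n y)).
  exact: (measurableT_comp mF (measurable_trunc n)).
pose v := emb (nseq (size s) false) [::].
have hv := hmm v.
have := integral_hmt_obs (rm_q0 M) (rm_g0 M) (rm_mq M) (rm_mg M) (rm_gb M)
  (rm_QE M) (rm_GE M) n hv (fun y => F0 (y \o flip s)) (measurableT_comp mF mflip).
under [X in _ = X -> _]eq_integral do rewrite /comp obsE_flip//.
move=> <-; rewrite !ge0_integral_obs_law//.
- apply: eq_integral => w _; congr F; rewrite /= -trunc_flip; congr trunc.
  by apply: funext => u /=; rewrite descend_emb -emb_flip.
- apply: (measurableT_comp mF); apply: (measurableT_comp mflip).
  exact: measurable_trunc.
Qed.

End flip_invariance.

(** * Stationary observations *)

Lemma integrable_le (R : realType) d (T : measurableType d)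
    (m : {measure set T -> \bar R}) (f E : T -> R) : measurable_fun setT f ->
  m.-integrable setT (EFin \o E) -> (forall t, `|f t| <= E t) ->
  m.-integrable setT (EFin \o f).
Proof.
move=> mf iE fE; apply: (le_integrable measurableT _ _ iE).
  exact/measurable_EFinP.
by move=> t _ /=; rewrite lee_fin (le_trans (fE t))// ler_norm.
Qed.

Section integrable_functions.
Context (R : realType) d (T : measurableType d) (P : probability T R).

Lemma integrable_of_sqr (E : T -> R) : measurable_fun setT E ->
  (\int[P]_t (E t ^+ 2)%:E < +oo)%E -> P.-integrable setT (EFin \o E).
Proof.
move=> mE E2; apply/integrableP; split; first exact/measurable_EFinP.
apply: (@le_lt_trans _ _ (\int[P]_t (1 + E t ^+ 2)%:E)%E).
  apply: ge0_le_integral => //.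
  - by apply/measurable_EFinP; exact: measurableT_comp.
  - by apply/measurable_EFinP; apply: measurable_funD => //; exact: measurable_funX.
  - move=> t _ /=; rewrite lee_fin; have [h|h] := lerP `|E t| 1.
      by rewrite (le_trans h)// lerDl sqr_ge0.
    rewrite -[X in _ <= _ + X]real_normK ?num_real//.
    by apply: le_trans (_ : `|E t| ^+ 2 <= _); rewrite ?lerDr// expr2 ler_peMl// ltW.
rewrite (ge0_integralD_EFin P (u := cst 1))//; last 2 first.
- by move=> t; exact: sqr_ge0.
- exact: measurable_funX.
have I1 : (\int[P]_t ((cst 1 : T -> R) t)%:E = 1)%E.
  by rewrite -[RHS](prob_integral_cst P).
by rewrite I1; exact: lte_add_pinfty (ltry _) E2.
Qed.

Lemma Rintegral_cst_prob (r : R) : \int[P]_t r = r.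
Proof.
by rewrite (Rintegral_cst P measurableT) [X in fine X](probability_setT P) mulr1.
Qed.

Lemma integrable_cst_prob (r : R) : P.-integrable setT (EFin \o (fun=> r)).
Proof.
exact: finite_measure_integrable_cst.
Qed.

Lemma Rintegral_close (f h E : T -> R) :
  P.-integrable setT (EFin \o f) -> P.-integrable setT (EFin \o h) ->
  P.-integrable setT (EFin \o E) -> (forall t, `|f t - h t| <= E t) ->
  `|\int[P]_t f t - \int[P]_t h t| <= \int[P]_t E t.
Proof.
move=> jf jh jE fh; rewrite -RintegralB//.
have jfh : P.-integrable setT (EFin \o (fun t => f t - h t)).
  by apply: eq_integrable (integrableB measurableT jf jh).
apply: le_trans (le_normr_Rintegral measurableT jfh) _.
by apply: le_Rintegral => //; exact: integrable_norm.
Qed.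

End integrable_functions.

Section stationary_observations.
Context (R : realType) (dX dY : measure_display).
Context (X : measurableType dX) (Y : measurableType dY).
Variables (lambda : probability X R) (mu : {sigma_finite_measure set Y -> \bar R}).
Variables (sm sp bp : R) (q : X -> X -> R) (g : X -> Y -> R).
Variables (Q : R.-pker X ~> X) (G : R.-pker X ~> Y).
Hypothesis M : regular_model lambda mu sm sp bp q g Q G.
Variable pi : probability X R.
Hypothesis pi_inv : invariant_probability Q pi.
Variables (d : measure_display) (Omega : measurableType d) (P : probability Omega R).
Variables (Xs : vertex -> {RV P >-> X}) (Ys : vertex -> {RV P >-> Y}).
Hypothesis hmm : is_extended_HMT Xs Ys Q G pi.
Local Notation cfg := (config (seq bool) Y).
Local Open Scope ereal_scope.

(** The law of the stationary observations on the tree below the origin. *)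
Definition stat_law : probability cfg R := obs_law (fun w => Ys (Core w)).
Local Notation eta := stat_law.

Lemma ge0_stat_law n (F : cfg -> \bar R) : (forall y, 0 <= F y) ->
  measurable_fun setT F -> (forall y, F (trunc n y) = F y) ->
  \int[eta]_y F y = \int[pi]_t obsE lambda mu q g n t F.
Proof.
move=> F0 mF Fn; rewrite -(integral_emb_obs M hmm [::] n F0 mF).
by apply: eq_integral => y _; rewrite Fn.
Qed.

Lemma stat_law_emb s n (f : cfg -> \bar R) : measurable_fun setT f ->
  (forall y, f (trunc n y) = f y) ->
  \int[obs_law (fun w => Ys (emb s w))]_y f y = \int[eta]_y f y.
Proof.
move=> mf fn.
have H (F : cfg -> \bar R) : (forall y, 0 <= F y) ->
    measurable_fun setT F -> (forall y, F (trunc n y) = F y) ->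
    \int[obs_law (fun w => Ys (emb s w))]_y F y = \int[eta]_y F y.
  move=> F0 mF Fn; rewrite (ge0_stat_law F0 mF Fn).
  rewrite -(integral_emb_obs M hmm s n F0 mF).
  by apply: eq_integral => y _; rewrite Fn.
rewrite integralE [RHS]integralE; congr (_ - _); apply: H => //.
- exact: measurable_funepos.
- by move=> y; rewrite !funeposE fn.
- exact: measurable_funeneg.
- by move=> y; rewrite !funenegE fn.
Qed.

(** The state of a child of the root again has the invariant law. *)
Lemma stat_law_sub b n (f : cfg -> \bar R) : measurable_fun setT f ->
  (forall y, f (trunc n y) = f y) ->
  \int[eta]_y f (sub y b) = \int[eta]_y f y.
Proof.
move=> mf fn.
have H (F : cfg -> \bar R) : (forall y, 0 <= F y) ->
    measurable_fun setT F -> (forall y, F (trunc n y) = F y) ->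
    \int[eta]_y F (sub y b) = \int[eta]_y F y.
  move=> F0 mF Fn; rewrite (ge0_stat_law F0 mF Fn).
  rewrite (@ge0_stat_law n.+1 (fun y => F (sub y b))); last 3 first.
  - by move=> y; exact: F0.
  - exact: (measurableT_comp mF (measurable_sub b)).
  - by move=> y; rewrite sub_trunc Fn.
  rewrite -[RHS](invariant_integral M pi_inv); last 2 first.
  - by move=> x; apply: obsE_ge0 => //; [exact: rm_q0 M|exact: rm_g0 M].
  - by apply: measurable_obsE => //; [exact: rm_q0 M|exact: rm_g0 M|
      exact: rm_mq M|exact: rm_mg M].
  apply: eq_integral => x _.
  exact: (obsE_sub (rm_q0 M) (rm_g0 M) (rm_mq M) (rm_mg M) (rm_q1 M) (rm_g1 M)).
rewrite integralE [RHS]integralE; congr (_ - _).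
- rewrite -[RHS]H//.
  + by apply: eq_integral => y _; rewrite !funeposE.
  + exact: measurable_funepos.
  + by move=> y; rewrite !funeposE fn.
- rewrite -[RHS]H//.
  + by apply: eq_integral => y _; rewrite !funenegE.
  + exact: measurable_funeneg.
  + by move=> y; rewrite !funenegE fn.
Qed.

Section envelope_moments.
Variable e : Y -> R.
Hypothesis e0 : forall y, (0 <= e y)%R.
Hypothesis me : measurable_fun setT e.
Hypothesis e2 : \int[P]_w (e (Ys origin w) ^+ 2)%:E < +oo.

Lemma measurable_envelope n : measurable_fun setT (envelope e n : cfg -> R).
Proof.
elim: n => [|n IH]; first exact: measurable_cst.
apply: measurable_funD.
  exact: (measurableT_comp me (measurable_coord [::])).
by apply: measurable_funD; exact: (measurableT_comp IH (measurable_sub _)).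
Qed.

Lemma envelope_trunc n y : envelope e n (trunc n y) = envelope e n y.
Proof. by elim: n y => [//|n IH] y /=; rewrite !sub_trunc !IH. Qed.

Lemma envelope_sqr_fin n : \int[eta]_y (envelope e n y ^+ 2)%:E < +oo.
Proof.
elim: n => [|n IH].
  have -> : \int[eta]_y (envelope e 0 y ^+ 2)%:E = 0; last exact: ltry.
  rewrite -[RHS](prob_integral_cst eta).
  by apply: eq_integral => y _; rewrite /= expr0n.
have me2 : measurable_fun setT (fun y : cfg => (envelope e n y ^+ 2)%:E).
  by apply/measurable_EFinP; apply: measurable_funX; exact: measurable_envelope.
have ms b : measurable_fun setT (fun y : cfg => envelope e n (sub y b) ^+ 2)%R.
  apply: measurable_funX.
  exact: (measurableT_comp (measurable_envelope n) (measurable_sub b)).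
have mr : measurable_fun setT (fun y : cfg => e (y [::]) ^+ 2)%R.
  apply: measurable_funX; exact: (measurableT_comp me (measurable_coord [::])).
have S b : \int[eta]_y (envelope e n (sub y b) ^+ 2)%:E < +oo.
  rewrite (@stat_law_sub b n (fun y => (envelope e n y ^+ 2)%:E))//.
  by move=> y; rewrite envelope_trunc.
have r2 : \int[eta]_y (e (y [::]) ^+ 2)%:E < +oo.
  by rewrite ge0_integral_obs_law//; [move=> y; rewrite lee_fin sqr_ge0|exact/measurable_EFinP].
apply: (@le_lt_trans _ _ (\int[eta]_y (3 * (e (y [::]) ^+ 2 +
   (envelope e n (sub y false) ^+ 2 + envelope e n (sub y true) ^+ 2)))%:E)).
  apply: le_integral_EFin.
  - by move=> y; exact: sqr_ge0.
  - by apply: measurable_funX; exact: measurable_envelope.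
  - apply: measurable_funM => //; apply: measurable_funD => //.
    exact: measurable_funD.
(* (u + v + w)^2 <= 3 (u^2 + v^2 + w^2) *)
  - move=> y /=; set u := e _; set v := envelope _ _ _; set w := envelope _ _ _.
    have := sqr_ge0 (u - v)%R; have := sqr_ge0 (v - w)%R; have := sqr_ge0 (u - w)%R.
    by move=> ? ? ?; nra.
have sq (f : cfg -> R) y : (0 <= f y ^+ 2)%R by exact: sqr_ge0.
rewrite ge0_integralZl_EFin'//; last 2 first.
- by move=> y; rewrite !addr_ge0// sqr_ge0.
- by apply: measurable_funD => //; exact: measurable_funD.
rewrite ge0_integralD_EFin; [|by move=> y; exact: sqr_ge0|exact: mr|
  by move=> y; rewrite addr_ge0// sqr_ge0|exact: measurable_funD].
rewrite ge0_integralD_EFin; [|by move=> y; exact: sqr_ge0|exact: ms|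
  by move=> y; exact: sqr_ge0|exact: ms].
apply: lte_mul_pinfty => //.
by apply: lte_add_pinfty => //; exact: lte_add_pinfty.
Qed.

Lemma integrable_envelope n : eta.-integrable setT (EFin \o envelope e n).
Proof.
by apply: integrable_of_sqr; [exact: measurable_envelope|exact: envelope_sqr_fin].
Qed.

End envelope_moments.
End stationary_observations.

(** * The contrast as a limit of block means *)

Lemma increment_close (R : realFieldType) (L1 L0 G u v u0 v0 c : R) :
  `|L1 - G - u - v| <= 2 * c -> `|L0 - G - u0 - v0| <= 2 * c ->
  `|L1 - L0 - (u + v - (u0 + v0))| <= 4 * c.
Proof.
rewrite !ler_norml => /andP[? ?] /andP[? ?].
by apply/andP; split; lra.
Qed.

Lemma double_difference_close (R : realFieldType) (S a b c e : R) :
  `|S - (2 * a - 2 * b)| <= c -> `|a - 2 * b| <= e -> `|S - a| <= c + e.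
Proof.
rewrite !ler_norml => /andP[? ?] /andP[? ?].
by apply/andP; split; lra.
Qed.

Section coin_flips.
Context (R : realType) dU (OmegaU : measurableType dU) (PU : probability OmegaU R).
Variable U : nat -> {RV PU >-> bool}.
Hypothesis U_iid : iid_bernoulli_half U.

Lemma spineE (u : nat -> bool) k : spine u k = rev (mkseq u k).
Proof. by elim: k => //= k ->; rewrite /mkseq -addn1 iotaD map_cat rev_cat. Qed.

Lemma spine_nth s : spine (nth false (rev s)) (size s) = s.
Proof. by rewrite spineE -(size_rev s) mkseq_nth revK. Qed.

Lemma spine_eq (u u' : nat -> bool) k : (spine u k == spine u' k) =
  all (fun j => u j == u' j) (iota 0 k).
Proof.
elim: k => [//|k IH].
rewrite [LHS]/= eqseq_cons IH -addn1 iotaD all_cat /= add0n andbT.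
by rewrite andbC.
Qed.

(** The coins are the letters of the spine, last letter first, so prescribing a
spine of length k has probability 2^-k. *)
Definition spine_event s : set OmegaU :=
  [set w | spine (fun j => U j w) (size s) = s].

Lemma spine_event_prob s :
  measurable (spine_event s) /\ PU (spine_event s) = ((2^-1) ^+ size s)%:E.
Proof.
have [U1 U2] := U_iid.
pose J : {fset nat} := [fset j in iota 0 (size s)]%fset.
pose A j : set bool := [set nth false (rev s) j].
have E : spine_event s = \bigcap_(j in [set` J]) U j @^-1` A j.
  apply/seteqP; split => [w|w].
    rewrite /spine_event /= -[X in _ = X -> _]spine_nth => /eqP.
    rewrite spine_eq => /allP H j /=; rewrite inE /= => /H /eqP.
    by [].
  move=> H; rewrite /spine_event /= -[X in _ = X]spine_nth; apply/eqP.
  rewrite spine_eq; apply/allP => j js; apply/eqP; apply: H.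
  by rewrite /= inE.
split.
  rewrite E; apply: fin_bigcap_measurable; first exact: finite_fset.
  by move=> j _; rewrite -[X in measurable X]setTI; exact: measurable_funPT.
rewrite E U2.
have half j : PU (U j @^-1` A j) = (2^-1)%:E.
  rewrite U1 /A bernoulli_probE; last by rewrite invr_ge0 ler0n invf_le1 ?ler1n.
  rewrite !diracE; case: (nth _ _ _).
    by rewrite mem_set// memNset// mule1 mule0 adde0.
  rewrite memNset// mem_set// mule0 mule1 add0e; congr (_%:E).
  by rewrite /unstable.onem; field.
have pJ : perm_eq J (iota 0 (size s)).
  apply: uniq_perm; [exact: fset_uniq|exact: iota_uniq|].
  by move=> k; rewrite inE.
rewrite (perm_big _ pJ) /=.
under eq_bigr do rewrite half.
have H n i : (\prod_(j <- iota i n) (2^-1 : R)%:E)%E = ((2^-1) ^+ n)%:E.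
  elim: n i => [|n IH] i; first by rewrite big_nil.
  by rewrite [iota _ _]/= big_cons IH exprS EFinM.
exact: H.
Qed.

End coin_flips.

Section finite_sum_integral.
Context (R : realType).

Lemma Rintegral_sum_seq d1 (T1 : measurableType d1) (P1 : probability T1 R)
    (I : eqType) (s : seq I) (f : I -> T1 -> R) :
  (forall i, i \in s -> P1.-integrable setT (EFin \o f i)) ->
  P1.-integrable setT (EFin \o (fun t => \sum_(i <- s) f i t)) /\
  \int[P1]_t (\sum_(i <- s) f i t) = \sum_(i <- s) \int[P1]_t f i t.
Proof.
elim: s => [|i s IH] jf.
  split; last by rewrite big_nil; under eq_Rintegral do rewrite big_nil;
    rewrite Rintegral_cst_prob.
  by apply: eq_integrable (integrable_cst_prob P1 0) => // t _ /=; rewrite big_nil.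
have [|j1 E1] := IH; first by move=> u us; apply: jf; rewrite inE us orbT.
have ji := jf i (mem_head _ _).
split.
  apply: eq_integrable (integrableD measurableT ji j1) => // t _ /=.
  by rewrite big_cons EFinD.
rewrite big_cons -E1 -RintegralD//; apply: eq_Rintegral => t _.
by rewrite big_cons.
Qed.

End finite_sum_integral.

Section product_integral.
Context (R : realType) d1 d2 (T1 : measurableType d1) (T2 : measurableType d2).
Variables (P1 : probability T1 R) (P2 : probability T2 R).

Lemma integrable_snd (E : T2 -> R) : P2.-integrable setT (EFin \o E) ->
  (P1 \x P2)%E.-integrable setT (EFin \o (fun p => E p.2)).
Proof.
move=> /integrableP[mE iE].
have mE2 : measurable_fun setT (EFin \o (fun p : T1 * T2 => E p.2)).
  exact: (measurableT_comp mE measurable_snd).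
apply/integrable12ltyP => //=.
under eq_integral do rewrite -[X in integral _ _ X]/(fun y => `|(EFin \o E) y|)%E.
by rewrite prob_integral_cst.
Qed.

Lemma Rintegral_indic_mul (A : set T1) (r : R) (phi : T2 -> R) :
  measurable A -> P1 A = r%:E -> P2.-integrable setT (EFin \o phi) ->
  (P1 \x P2)%E.-integrable setT (EFin \o (fun p => \1_A p.1 * phi p.2)) /\
  \int[(P1 \x P2)%E]_p (\1_A p.1 * phi p.2) = r * \int[P2]_t phi t.
Proof.
move=> mA PA iphi.
have /integrableP[mphi' _] := iphi.
have mphi : measurable_fun setT phi by exact/measurable_EFinP.
have mf : measurable_fun setT (fun p : T1 * T2 => \1_A p.1 * phi p.2 : R).
  apply: measurable_funM.
    exact: (measurableT_comp (measurable_indic mA) measurable_fst).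
  exact: (measurableT_comp mphi measurable_snd).
have jf : (P1 \x P2)%E.-integrable setT (EFin \o (fun p => \1_A p.1 * phi p.2)).
  apply: (integrable_le mf (integrable_snd (integrable_norm iphi))) => p /=.
  rewrite normrM ler_piMl// indicE; case: (_ \in _) => /=.
    by rewrite normr1.
  by rewrite normr0 ler01.
split; first exact: jf.
rewrite /Rintegral -(integral12_prod_meas1 jf) /fubini_F /=.
have E u : (\int[P2]_y (\1_A u * phi y)%:E = (\1_A u)%:E * \int[P2]_t (phi t)%:E)%E.
  under eq_integral do rewrite EFinM.
  by rewrite integralZl.
under eq_integral do rewrite E.
have fin : (\int[P2]_t (phi t)%:E)%E \is a fin_num by exact: integrable_fin_num.
pose c0 := fine (\int[P2]_t (phi t)%:E)%E.
have -> : (\int[P2]_t (phi t)%:E = c0%:E)%E by rewrite fineK.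
rewrite integralZr//; last by apply: integrable_indic => //; rewrite PA ltry.
by rewrite integral_indic// setIT [X in (X * _)%E]PA -EFinM.
Qed.

End product_integral.

Section contrast_limit.
Context (R : realType) (dX dY : measure_display).
Context (X : measurableType dX) (Y : measurableType dY).
Variables (lambda : probability X R) (mu : {sigma_finite_measure set Y -> \bar R}).
Variables (sm sp bp : R) (bm : Y -> R).
Hypothesis bm0 : forall y, 0 < bm y.
Hypothesis mbm : measurable_fun setT bm.
Variables (qs : X -> X -> R) (gs : X -> Y -> R).
Variables (Qs : R.-pker X ~> X) (Gs : R.-pker X ~> Y).
Hypothesis Ms : regular_model lambda mu sm sp bp qs gs Qs Gs.
Variable pi : probability X R.
Hypothesis pi_inv : invariant_probability Qs pi.
Variables (d : measure_display) (Omega : measurableType d) (P : probability Omega R).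
Variables (Xs : vertex -> {RV P >-> X}) (Ys : vertex -> {RV P >-> Y}).
Hypothesis hmm : is_extended_HMT Xs Ys Qs Gs pi.

Local Notation e := (vertex_err sm sp bp bm).
Hypothesis e2 : (\int[P]_w (e (Ys origin w) ^+ 2)%:E < +oo)%E.

Local Notation cfg := (config (seq bool) Y).
Local Notation eta := (stat_law Ys).

Lemma measurable_vertex_err : measurable_fun setT e.
Proof.
apply: measurable_funD => //; apply: measurableT_comp => //.
exact: (measurableT_comp (@measurable_ln R)).
Qed.
Let me := measurable_vertex_err.
Let e0 y : 0 <= e y. Proof. exact: vertex_err_ge0. Qed.

Lemma integrable_err_origin : P.-integrable setT (EFin \o (fun w => e (Ys origin w))).
Proof.
apply: integrable_of_sqr => //; apply: (measurableT_comp me).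
exact: measurable_funPT.
Qed.

(** By stationarity the observations below any ancestor of the origin have the
same law as those below the origin. *)
Lemma stat_law_transfer s n (f : cfg -> R) : measurable_fun setT f ->
  (forall y, f (trunc n y) = f y) ->
  P.-integrable setT (EFin \o (fun w => f (fun v => Ys (emb s v) w))) ->
  eta.-integrable setT (EFin \o f) /\
  \int[P]_w f (fun v => Ys (emb s v) w) = \int[eta]_y f y.
Proof.
move=> mf fn jf.
have mfE : measurable_fun setT (EFin \o f) by exact/measurable_EFinP.
split.
  apply/integrableP; split => //.
  rewrite -(stat_law_emb Ms hmm s (n := n) (f := fun y => `|(f y)%:E|%E)).
  - rewrite ge0_integral_obs_law//; last exact: measurableT_comp.
    by move/integrableP: jf => [].
  - exact: measurableT_comp.
  - by move=> y; rewrite fn.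
congr fine.
rewrite -(stat_law_emb Ms hmm s (n := n) (f := EFin \o f))//; last first.
  by move=> y /=; rewrite fn.
by rewrite integral_distribution.
Qed.

Section one_parameter.
Variables (q : X -> X -> R) (g : X -> Y -> R).
Variables (Q : R.-pker X ~> X) (G : R.-pker X ~> Y).
Hypothesis M : regular_model lambda mu sm sp bp q g Q G.
Hypothesis bm_le : forall y, ((bm y)%:E <= \int[lambda]_x (g x y)%:E)%E.

Local Notation flog := (flog lambda q g).

Lemma integrable_flog k : eta.-integrable setT (EFin \o flog k).
Proof.
apply: (integrable_le _ (integrable_envelope Ms pi_inv hmm me e2 k)).
  exact: (measurable_flog M).
exact: (flog_envelope M bm0 bm_le).
Qed.

Lemma integrable_sub b n (f : cfg -> R) : measurable_fun setT f ->
  (forall y, f (trunc n y) = f y) -> eta.-integrable setT (EFin \o f) ->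
  eta.-integrable setT (EFin \o (fun y : cfg => f (sub y b))).
Proof.
move=> mf fn /integrableP[mfE jf]; apply/integrableP; split.
  exact: (measurableT_comp mfE (measurable_sub b)).
rewrite (stat_law_sub Ms pi_inv hmm b (n := n) (f := fun y => `|(f y)%:E|%E))//.
  exact: measurableT_comp.
by move=> y; rewrite fn.
Qed.

(** The stationary block means, whose growth rate is the contrast. *)
Definition alog k : R := \int[eta]_y flog k y.

Lemma integrable_flog_sub b k :
  eta.-integrable setT (EFin \o (fun y : cfg => flog k (sub y b))).
Proof.
apply: (@integrable_sub b k) => //; [exact: (measurable_flog M)| |exact: integrable_flog].
exact: flog_trunc.
Qed.

Lemma Rintegral_flog_sub b k : \int[eta]_y flog k (sub y b) = alog k.
Proof.
congr fine; apply: (stat_law_sub Ms pi_inv hmm b (n := k) (f := EFin \o flog k)).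
  by apply/measurable_EFinP; exact: (measurable_flog M).
by move=> y /=; rewrite flog_trunc.
Qed.

Definition ebar : R := \int[eta]_y e (y [::]).

Lemma integrable_err_root :
  eta.-integrable setT (EFin \o (fun y : cfg => e (y [::]))).
Proof.
have [] := @stat_law_transfer [::] 1 (fun y : cfg => e (y [::])); last by [].
- exact: (measurableT_comp me (measurable_coord [::])).
- by [].
- exact: integrable_err_origin.
Qed.

Lemma alog_rec k : `|alog k.+1 - 2 * alog k| <= ebar.
Proof.
have -> : 2 * alog k = \int[eta]_y (flog k (sub y false) + flog k (sub y true)).
  rewrite RintegralD ?Rintegral_flog_sub//; try exact: integrable_flog_sub.
  by ring.
apply: Rintegral_close.
- exact: integrable_flog.
- by apply: eq_integrable (integrableD measurableT (integrable_flog_sub false k)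
    (integrable_flog_sub true k)).
- exact: integrable_err_root.
- by move=> y; rewrite opprD addrA; exact: (flogS M bm0 bm_le).
Qed.

Lemma hlog_abs s x (y : vertex -> Y) : (0 < size s)%N ->
  `|hlog lambda q g s x (y \o emb s)| <= e (y origin).
Proof.
case: s => [//|b s] _.
have := @hlog_bound _ _ _ _ _ lambda mu sm sp bp q g Q G M bm bm0 bm_le
  (nth false (rev (b :: s)))
  (fun k => y \o emb (spine (nth false (rev (b :: s))) k)).
move=> /(_ _ (size s) x).
rewrite -[(size s).+1]/(size (b :: s)) spine_nth; apply.
by move=> k; apply/funext => w; rewrite /sub /= eqxx.
Qed.

Lemma size_cut_lt s w : w \in nodes (cut_lt s) -> (size w <= size s)%N.
Proof.
elim: s w => [//|b s IH] [//|c w]; rewrite mem_cut_lt_cons /= ltnS.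
case: eqP => [_ /IH //|_]; case: (b); rewrite ?addn1 ?addn0 ?ltnS//.
exact: ltnW.
Qed.

Lemma hlog_trunc s x y :
  hlog lambda q g s x (trunc (size s).+1 y) = hlog lambda q g s x y.
Proof.
rewrite /hlog /ratio /lik !likE_trunc_gen// => w.
  by move/size_cut_lt; rewrite ltnS.
by rewrite mem_cut_le => /orP[/size_cut_lt|/eqP ->]; rewrite ltnS.
Qed.

Lemma measurable_hlog s x : measurable_fun setT (hlog lambda q g s x : cfg -> R).
Proof.
have -> : hlog lambda q g s x = (fun y => ln (lik lambda q g (cut_le s) x y) -
    ln (lik lambda q g (cut_lt s) x y)).
  apply/funext => y; rewrite /hlog /ratio ln_div// posrE.
    exact: (lik_gt0 M bm0 bm_le).
  exact: (lik_gt0 M bm0 bm_le).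
by apply: measurable_funB; apply: (measurableT_comp (@measurable_ln R));
  exact: (measurable_lik1 M).
Qed.

Lemma measurable_emb_obs s :
  measurable_fun setT (fun w => (fun v => Ys (emb s v) w) : cfg).
Proof. exact: (measurable_obs_map (fun v => Ys (emb s v))). Qed.

Lemma integrable_hlog_emb s x : (0 < size s)%N ->
  P.-integrable setT (EFin \o (fun w => hlog lambda q g s x (fun v => Ys (emb s v) w))).
Proof.
move=> s0; apply: (integrable_le _ integrable_err_origin).
  exact: (measurableT_comp (measurable_hlog s x) (measurable_emb_obs s)).
by move=> w; exact: (hlog_abs x (fun v => Ys v w) s0).
Qed.

Lemma hlog_transfer s x : (0 < size s)%N ->
  eta.-integrable setT (EFin \o (hlog lambda q g s x : cfg -> R)) /\
  \int[P]_w hlog lambda q g s x (fun v => Ys (emb s v) w) =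
  \int[eta]_y hlog lambda q g s x y.
Proof.
move=> s0; apply: (@stat_law_transfer s (size s).+1) => //.
- exact: measurable_hlog.
- exact: hlog_trunc.
- exact: integrable_hlog_emb.
Qed.

(** The increment of the log-likelihood from k + 1 to k + 2 levels is, up to cutting
errors, the increment of flog from k to k + 1 levels over two subtrees; its mean is
2 a_(k+1) - 2 a_k, which alog_rec compares to a_(k+1). *)
Lemma sum_hlog_close k x :
  `|\sum_(s <- words k.+1) \int[eta]_y hlog lambda q g s x y - alog k.+1|
    <= 4 * cq sm sp + ebar.
Proof.
have jh s : s \in words k.+1 -> eta.-integrable setT
    (EFin \o (hlog lambda q g s x : cfg -> R)).
  by rewrite words_size => /eqP sk; case: (@hlog_transfer s x); rewrite ?sk.
have [jS <-] := Rintegral_sum_seq jh.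
pose h (y : cfg) := flog k.+1 (sub y false) + flog k.+1 (sub y true) -
  (flog k (sub y false) + flog k (sub y true)).
have jD j : eta.-integrable setT (EFin \o (fun y : cfg =>
    flog j (sub y false) + flog j (sub y true))).
  by apply: eq_integrable (integrableD measurableT (integrable_flog_sub false j)
    (integrable_flog_sub true j)).
have jH : eta.-integrable setT (EFin \o h).
  by apply: eq_integrable (integrableB measurableT (jD k.+1) (jD k)).
have hE : \int[eta]_y h y = 2 * alog k.+1 - 2 * alog k.
  rewrite RintegralB// !RintegralD ?Rintegral_flog_sub//;
    try exact: integrable_flog_sub.
  by rewrite !mulr_natl !mulr2n.
have close : `|\int[eta]_y (\sum_(s <- words k.+1) hlog lambda q g s x y) -
    \int[eta]_y h y| <= 4 * cq sm sp.
  rewrite -[leRHS](Rintegral_cst_prob eta); apply: Rintegral_close => //.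
    exact: integrable_cst_prob.
  move=> y; rewrite (sum_hlog M bm0 bm_le).
  exact: (increment_close (ln_lik_node M bm0 bm_le k.+1 x y)
    (ln_lik_node M bm0 bm_le k x y)).
rewrite hE in close; exact: (double_difference_close close (alog_rec k)).
Qed.

End one_parameter.
End contrast_limit.

Section contrast_is_limit.
Context (R : realType) (dX dY : measure_display).
Context (X : measurableType dX) (Y : measurableType dY).
Variables (lambda : probability X R) (mu : {sigma_finite_measure set Y -> \bar R}).
Variables (sm sp bp : R) (bm : Y -> R).
Hypothesis bm0 : forall y, 0 < bm y.
Hypothesis mbm : measurable_fun setT bm.
Variables (qs : X -> X -> R) (gs : X -> Y -> R).
Variables (Qs : R.-pker X ~> X) (Gs : R.-pker X ~> Y).
Hypothesis Ms : regular_model lambda mu sm sp bp qs gs Qs Gs.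
Variable pi : probability X R.
Hypothesis pi_inv : invariant_probability Qs pi.
Variables (d : measure_display) (Omega : measurableType d) (P : probability Omega R).
Variables (Xs : vertex -> {RV P >-> X}) (Ys : vertex -> {RV P >-> Y}).
Hypothesis hmm : is_extended_HMT Xs Ys Qs Gs pi.
Local Notation e := (vertex_err sm sp bp bm).
Hypothesis e2 : (\int[P]_w (e (Ys origin w) ^+ 2)%:E < +oo)%E.
Variables (dU : measure_display) (OmegaU : measurableType dU).
Variables (PU : probability OmegaU R) (U : nat -> {RV PU >-> bool}).
Hypothesis U_iid : iid_bernoulli_half U.
Variables (Par : Type) (q : Par -> X -> X -> R) (g : Par -> X -> Y -> R) (theta : Par).
Variables (Q : R.-pker X ~> X) (G : R.-pker X ~> Y).
Hypothesis M : regular_model lambda mu sm sp bp (q theta) (g theta) Q G.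
Hypothesis bm_le : forall y, ((bm y)%:E <= \int[lambda]_x (g theta x y)%:E)%E.

Local Notation cfg := (config (seq bool) Y).
Local Notation eta := (stat_law Ys).
Local Notation alog := (alog lambda Ys (q theta) (g theta)).

(* u, y and H are the coins, the observations and the conditional log-likelihood
   with k + 1 ancestors, at a point p of the product space. *)
Let u (p : OmegaU * Omega) j := U j p.1.
Let y (p : OmegaU * Omega) v := Ys v p.2.
Let H k (p : OmegaU * Omega) : R :=
  hlog lambda (q theta) (g theta) (spine (u p) k.+1) point
    (y p \o emb (spine (u p) k.+1)).

(* Splitting over the possible spines separates the coins from the
   observations. *)
Let HE k p : H k p = \sum_(s <- words k.+1) \1_(spine_event U s) p.1 *
  hlog lambda (q theta) (g theta) s point (fun v => Ys (emb s v) p.2).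
Proof.
have us : spine (u p) k.+1 \in words k.+1 by rewrite words_size spineE size_rev size_mkseq.
rewrite (bigD1_seq _ us (uniq_words _)) big1_seq.
  have sz : size (spine (u p) k.+1) = k.+1 by rewrite spineE size_rev size_mkseq.
  have ev : spine_event U (spine (u p) k.+1) p.1.
    by rewrite -[spine_event _ _ _]/(spine (u p) (size (spine (u p) k.+1)) = _) sz.
  by rewrite [RHS]addr0 indicE (mem_set ev) mul1r.
move=> s /andP[su]; rewrite words_size => /eqP sk.
rewrite indicE memNset ?mul0r// /spine_event /= sk => E.
by rewrite -E eqxx in su.
Qed.

Let hlog_measurable s : measurable_fun setT (fun w =>
  hlog lambda (q theta) (g theta) s point (fun v => Ys (emb s v) w)).
Proof.
exact: (measurableT_comp (measurable_hlog bm0 M bm_le s point) (measurable_emb_obs Ys s)).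
Qed.

Let mH k : measurable_fun setT (H k).
Proof.
have -> : H k = (fun p => \sum_(s <- words k.+1) \1_(spine_event U s) p.1 *
  hlog lambda (q theta) (g theta) s point (fun v => Ys (emb s v) p.2)).
  by apply/funext => p; exact: HE.
apply: measurable_sum => s; have [ms _] := spine_event_prob U_iid s.
apply: measurable_funM.
  exact: (measurableT_comp (measurable_indic ms) measurable_fst).
exact: (measurableT_comp (hlog_measurable s) measurable_snd).
Qed.

Let cvgH p : (fun k => H k p) @ \oo --> h_infty lambda q g (u p) (y p) theta.
Proof.
have sb k : sub (y p \o emb (spine (u p) k.+1)) (u p k) = y p \o emb (spine (u p) k).
  by apply/funext => w; rewrite /sub /= eqxx.
have [l lP] := hlog_cvg M bm0 bm_le sb.
have : [set l : R | forall x, (fun k => h_ lambda q g (u p) (y p) origin k x theta)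
    @ \oo --> l] (h_infty lambda q g (u p) (y p) theta).
  apply: getPex; exists l => x /=; under eq_fun do rewrite (h_hlog M).
  exact: lP.
move=> /(_ point); under eq_fun do rewrite (h_hlog M).
by rewrite -cvg_shiftS.
Qed.

Let H_le k p : `|H k p| <= e (Ys origin p.2).
Proof.
apply: (hlog_abs bm0 M bm_le point (y p)).
by rewrite spineE size_rev size_mkseq.
Qed.

Let cvg_int : (fun k => \int[(PU \x P)%E]_p H k p) @ \oo --> contrast lambda q g U Ys theta.
Proof.
have jE := integrable_snd PU (integrable_err_origin mbm e2).
have mlim : measurable_fun setT (EFin \o (fun p => h_infty lambda q g (u p) (y p) theta)).
  apply: (@emeasurable_fun_cvg _ _ _ _ (fun k => EFin \o H k)).
    by move=> k; exact/measurable_EFinP.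
  by move=> p _; apply: cvg_EFin; [exact: nearW|exact: cvgH].
have cE : \forall p \ae (PU \x P)%E, setT p ->
    (fun k => (H k p)%:E) @ \oo --> (h_infty lambda q g (u p) (y p) theta)%:E.
  by apply: aeW => p _; apply: cvg_EFin; [exact: nearW|exact: cvgH].
have lE : \forall p \ae (PU \x P)%E, forall k, setT p ->
    (`|(H k p)%:E| <= (e (Ys origin p.2))%:E)%E.
  by apply: aeW => p k _ /=; rewrite lee_fin.
have [jf _ D] := @dominated_convergence _ _ _ (PU \x P)%E setT measurableT
  (fun k => EFin \o H k) _ _ (fun k => (measurable_EFinP _ _).2 (mH k)) mlim cE jE lE.
apply: fine_cvg; rewrite fineK//; last exact: integrable_fin_num jf.
Qed.

(** The mean of h_ with k + 1 ancestors is the average over all words s of length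
k + 1 of the mean of hlog s, that is 2^-(k+1) times a telescoping sum that is within
a constant of a_(k+1). *)
Lemma contrast_lim : (fun k => (2^-1) ^+ k * alog k) @ \oo --> contrast lambda q g U Ys theta.
Proof.
rewrite -cvg_shiftS.
pose C := 4 * cq sm sp + ebar sm sp bp bm Ys.
have intH k : \int[(PU \x P)%E]_p H k p = (2^-1) ^+ k.+1 *
    \sum_(s <- words k.+1) \int[eta]_y hlog lambda (q theta) (g theta) s point y.
  under eq_Rintegral do rewrite HE.
  have split_s s : s \in words k.+1 -> (PU \x P)%E.-integrable setT (EFin \o (fun p =>
      \1_(spine_event U s) p.1 *
      hlog lambda (q theta) (g theta) s point (fun v => Ys (emb s v) p.2))) /\
    \int[(PU \x P)%E]_p (\1_(spine_event U s) p.1 *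
      hlog lambda (q theta) (g theta) s point (fun v => Ys (emb s v) p.2)) =
    (2^-1) ^+ k.+1 * \int[eta]_y hlog lambda (q theta) (g theta) s point y.
    rewrite words_size => /eqP sk.
    have [ms Ps] := spine_event_prob U_iid s.
    have s0 : (0 < size s)%N by rewrite sk.
    have [_ <-] := hlog_transfer bm0 mbm Ms hmm e2 M bm_le point s0.
    rewrite -sk; apply: Rintegral_indic_mul => //.
    exact: (integrable_hlog_emb bm0 mbm e2 M bm_le point s0).
  have [s /split_s[]//|_ ->] := @Rintegral_sum_seq _ _ _ (PU \x P)%E _ (words k.+1)
    (fun s p => \1_(spine_event U s) p.1 *
      hlog lambda (q theta) (g theta) s point (fun v => Ys (emb s v) p.2)).
  by rewrite mulr_sumr; apply: eq_big_seq => s /split_s[].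
have close k : `|(2^-1) ^+ k.+1 * alog k.+1 - \int[(PU \x P)%E]_p H k p| <= (2^-1) ^+ k.+1 * C.
  rewrite intH -mulrBr normrM ger0_norm ?exprn_ge0// ler_wpM2l ?exprn_ge0//.
  by rewrite distrC; exact: (sum_hlog_close bm0 mbm Ms pi_inv hmm e2 M bm_le).
have z : (fun k => (2^-1) ^+ k.+1 * alog k.+1 - \int[(PU \x P)%E]_p H k p) @ \oo --> (0 : R).
  have c0 : (fun k => (2^-1 : R) ^+ k.+1 * C) @ \oo --> (0 : R).
    rewrite -[X in _ --> X](mul0r C); apply: cvgMr_tmp.
    rewrite (@cvg_shiftS _ (fun k => 2^-1 ^+ k : R)); apply: cvg_expr.
    by rewrite ger0_norm// invf_lt1// ltr1n.
  apply/cvgrPdist_lt => eps eps0; near=> k; rewrite sub0r normrN.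
  apply: le_lt_trans (close k) _; near: k.
  apply: cvgr_lt c0 _ eps0.
have -> : (fun k => (2^-1) ^+ k.+1 * alog k.+1) =
    (fun k => (2^-1) ^+ k.+1 * alog k.+1 - \int[(PU \x P)%E]_p H k p) +
    (fun k => \int[(PU \x P)%E]_p H k p).
  by apply/funext => k; rewrite fctE subrK.
have D := cvgD z cvg_int; rewrite add0r in D; exact: D.
Unshelve. all: by end_near.
Qed.
End contrast_is_limit.

(** * Gibbs inequality *)

Section invariant_start.
Context (R : realType) (dX dY : measure_display).
Context (X : measurableType dX) (Y : measurableType dY).
Variables (lambda : probability X R) (mu : {sigma_finite_measure set Y -> \bar R}).
Variables (sm sp bp : R) (q : X -> X -> R) (g : X -> Y -> R).
Variables (Q : R.-pker X ~> X) (G : R.-pker X ~> Y).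
Hypothesis M : regular_model lambda mu sm sp bp q g Q G.
Local Open Scope ereal_scope.

Local Notation cfg := (config (seq bool) Y).

(** With the root state drawn from lambda the observations have density rootE. *)
Lemma integral_obsE k (F : cfg -> \bar R) : (forall y, 0 <= F y) ->
  measurable_fun setT F ->
  \int[lambda]_t obsE lambda mu q g k t F =
  mint mu (nodes (full k)) (fun y => F y * rootE lambda q g (full k) y) point.
Proof.
move=> F0 mF; rewrite /obsE mint_integral.
- apply: mint_eq => y; rewrite /rootE ge0_integralZl//.
    exact: (measurable_likE2 lambda (rm_q0 M) (rm_g0 M) (rm_mq M) (rm_mg M)).
  by move=> x _; exact: (likE_ge0 _ (rm_q0 M) (rm_g0 M)).
- by move=> t y; rewrite mule_ge0// (likE_ge0 _ (rm_q0 M) (rm_g0 M)).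
- apply: emeasurable_funM.
    exact: (measurableT_comp mF measurable_snd).
  by have [] := measurable_likE_branchE lambda (rm_q0 M) (rm_g0 M) (rm_mq M) (rm_mg M) (full k).
Qed.

(** A likelihood is a probability density. *)
Lemma mint_root k :
  mint mu (nodes (full k)) (rootE lambda q g (full k) : cfg -> \bar R) point = 1.
Proof.
have := @integral_obsE k (cst 1) (fun=> lee01) (measurable_cst _).
under eq_integral do rewrite (obsE_1 (rm_q0 M) (rm_g0 M) (rm_mq M) (rm_mg M) (rm_q1 M) (rm_g1 M)).
rewrite prob_integral_cst => ->; apply: mint_eq => y.
by rewrite /= mul1e.
Qed.

Lemma measurable_root sh : measurable_fun setT (root lambda q g sh : cfg -> R).
Proof. by apply: measurableT_comp => //; exact: (measurable_rootE M). Qed.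

Lemma pi_le_lambda (pi : probability X R) (h : X -> \bar R) :
  invariant_probability Q pi -> (forall x, 0 <= h x) -> measurable_fun setT h ->
  \int[pi]_x h x <= sp%:E * \int[lambda]_x h x.
Proof.
move=> pi_inv h0 mh; rewrite -(invariant_integral M pi_inv h0 mh).
rewrite -[leRHS](prob_integral_cst pi); apply: ge0_le_integral => //.
- move=> x _; apply: integral_ge0 => x' _.
  by rewrite mule_ge0// lee_fin (rm_q0 M).
- exact: (measurable_q_integral M).
- by move=> x _; exact: (q_integral_le M).
Qed.

End invariant_start.

Section gibbs.
Context (R : realType) (dX dY : measure_display).
Context (X : measurableType dX) (Y : measurableType dY).
Variables (lambda : probability X R) (mu : {sigma_finite_measure set Y -> \bar R}).
Variables (sm sp bp : R) (bm : Y -> R).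
Hypothesis bm0 : forall y, 0 < bm y.
Hypothesis mbm : measurable_fun setT bm.
Variables (qs : X -> X -> R) (gs : X -> Y -> R).
Variables (Qs : R.-pker X ~> X) (Gs : R.-pker X ~> Y).
Hypothesis Ms : regular_model lambda mu sm sp bp qs gs Qs Gs.
Hypothesis bm_les : forall y, ((bm y)%:E <= \int[lambda]_x (gs x y)%:E)%E.
Variable pi : probability X R.
Hypothesis pi_inv : invariant_probability Qs pi.
Variables (d : measure_display) (Omega : measurableType d) (P : probability Omega R).
Variables (Xs : vertex -> {RV P >-> X}) (Ys : vertex -> {RV P >-> Y}).
Hypothesis hmm : is_extended_HMT Xs Ys Qs Gs pi.
Hypothesis e2 : (\int[P]_w (vertex_err sm sp bp bm (Ys origin w) ^+ 2)%:E < +oo)%E.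
Variables (q : X -> X -> R) (g : X -> Y -> R).
Variables (Q : R.-pker X ~> X) (G : R.-pker X ~> Y).
Hypothesis M : regular_model lambda mu sm sp bp q g Q G.
Hypothesis bm_le : forall y, ((bm y)%:E <= \int[lambda]_x (g x y)%:E)%E.

Local Notation cfg := (config (seq bool) Y).
Local Notation eta := (stat_law Ys).

(** Let Z be the likelihood ratio of the two parameters for a root state drawn from
lambda. Its mean would be 1 if the root were drawn from lambda; under the invariant
law, whose density is at most sp, it is at most sp. Conclude by ln Z <= Z - 1. *)
Lemma alog_le k : alog lambda Ys q g k <= alog lambda Ys qs gs k + (sp - 1).
Proof.
pose Z (y : cfg) := expR (flog lambda q g k y - flog lambda qs gs k y).
have Z0 y : 0 <= Z y by exact: expR_ge0.
have mZ : measurable_fun setT Z.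
  apply: (measurableT_comp (@measurable_expR R)); apply: measurable_funB.
    exact: (measurable_flog M).
  exact: (measurable_flog Ms).
have mZE : measurable_fun setT (EFin \o Z) by exact/measurable_EFinP.
have Zn y : Z (trunc k y) = Z y by rewrite /Z !flog_trunc.
have IZ : (\int[eta]_y (Z y)%:E <= sp%:E)%E.
  have ZE0 y : (0 <= (Z y)%:E)%E by rewrite lee_fin Z0.
  have ZEn y : (Z (trunc k y))%:E = (Z y)%:E by rewrite Zn.
  rewrite (ge0_stat_law Ms hmm ZE0 mZE ZEn).
  apply: le_trans (pi_le_lambda Ms pi_inv _ _) _.
  - by move=> x; apply: (obsE_ge0 _ _ (rm_q0 Ms) (rm_g0 Ms)).
  - exact: (measurable_obsE _ _ (rm_q0 Ms) (rm_g0 Ms) (rm_mq Ms) (rm_mg Ms) _ ZE0 mZE).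
  rewrite (integral_obsE Ms _ ZE0 mZE).
  have -> : mint mu (nodes (full k))
      (fun y => (Z y)%:E * rootE lambda qs gs (full k) y)%E point =
    mint mu (nodes (full k)) (rootE lambda q g (full k) : cfg -> \bar R) point.
    apply: mint_eq => y; rewrite (rootE_root M) (rootE_root Ms) -EFinM.
    rewrite /Z /flog.
    have := root_gt0 M bm0 bm_le (full k) y.
    have := root_gt0 Ms bm0 bm_les (full k) y.
    move: (root _ _ _ _ _) (root _ _ _ _ _) => a b a0 b0.
    by rewrite expRB !lnK ?posrE// divfK// gt_eqF.
  by rewrite (mint_root M) mule1.
have jZ : eta.-integrable setT (EFin \o Z).
  apply/integrableP; split => //=.
  apply: le_lt_trans (ltry sp); apply: le_trans IZ.
  by under eq_integral do rewrite ger0_norm//.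
have jl := integrable_flog bm0 mbm Ms pi_inv hmm e2 M bm_le k.
have js := integrable_flog bm0 mbm Ms pi_inv hmm e2 Ms bm_les k.
have j1 : eta.-integrable setT (EFin \o (fun y => Z y - 1)).
  by apply: eq_integrable (integrableB measurableT jZ (integrable_cst_prob eta 1)).
have jR : eta.-integrable setT (EFin \o (fun y => flog lambda qs gs k y + (Z y - 1))).
  by apply: eq_integrable (integrableD measurableT js j1).
have -> : alog lambda Ys qs gs k + (sp - 1) =
    \int[eta]_y (flog lambda qs gs k y + (Z y - 1)) + (sp - \int[eta]_y Z y).
  rewrite RintegralD//.
  rewrite RintegralB//; last exact: integrable_cst_prob.
  by rewrite Rintegral_cst_prob /alog; ring.
apply: (@le_trans _ _ (\int[eta]_y (flog lambda qs gs k y + (Z y - 1)))); last first.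
  rewrite lerDl subr_ge0 -lee_fin fineK//.
  exact: integrable_fin_num jZ.
apply: (le_Rintegral measurableT jl jR) => y _.
have := expR_ge1Dx (flog lambda q g k y - flog lambda qs gs k y).
by rewrite /Z; move: (flog lambda q g k y) (flog lambda qs gs k y) => a b; lra.
Qed.
End gibbs.

(** * Continuity in the parameter *)

Section sequences_in_a_compact_set.
Context (R : realType) (T : pseudoMetricType R) (K : set T).

(** Finitely many balls of radius 1 / (m + 1) cover K; enumerate their centres for
all m. *)
Lemma compact_dense_seq x0 : cover_compact K -> K x0 ->
  exists t : nat -> T, (forall n, K (t n)) /\
    forall z eps, K z -> 0 < eps -> exists n, ball z eps (t n).
Proof.
move=> cK Kx0.
have cov m : finite_subset_cover K (fun z => (ball z m.+1%:R^-1)°) K.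
  apply: cK => [z _|z Kz]; first exact: open_interior.
  by exists z => //; apply: nbhs_singleton; apply: nbhs_interior; apply: nbhsx_ballx.
pose D m : {fset T} := projT1 (cid2 (cov m)).
have [DK Dcov] : (forall m, {subset D m <= K}) /\
    forall m, K `<=` cover [set` D m] (fun z => (ball z m.+1%:R^-1)°).
  by split=> m; rewrite /D; case: cid2.
(* n codes a pair (m, i), standing for the i-th centre of the m-th cover *)
exists (fun n => if choice.unpickle n is Some p then nth x0 (D p.1) p.2 else x0); split.
  move=> n; case: choice.unpickle => [[m i]|//] /=.
  have [iD|Di] := ltnP i (size (D m)); last by rewrite nth_default.
  by have := DK m _ (mem_nth x0 iD); rewrite inE.
move=> z eps Kz eps0.
have [m mP] : exists m : nat, m.+1%:R^-1 < eps.
  have [//|m mP] := @ltr_add_invr R 0 eps; last by exists m; rewrite add0r in mP.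
have [w wD /interior_subset zw] := Dcov m z Kz.
exists (choice.pickle (m, index w (D m))); rewrite choice.pickleK /= nth_index//.
by apply: ball_sym; apply: le_ball zw; exact: ltW.
Qed.

Lemma within_cvg_seq (f : T -> R) (u : nat -> T) z :
  {within K, continuous f} -> K z -> (forall n, K (u n)) -> u @ \oo --> z ->
  f \o u @ \oo --> f z.
Proof.
move=> /subspace_continuousP cf Kz Ku uz.
apply: cvg_comp (cf z Kz) => P /= wP.
have [N _ NP] := uz _ wP; exists N => // n Nn; exact: (NP n Nn (Ku n)).
Qed.

(** Sequential continuity gives continuity: otherwise pick a bad point in every
ball of radius 1 / (n + 1). *)
Lemma ball_of_cvg_seq (f : T -> R) z eps : K z ->
  (forall u : nat -> T, (forall n, K (u n)) -> u @ \oo --> z -> f \o u @ \oo --> f z) ->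
  0 < eps -> exists2 delta, 0 < delta &
    forall z', K z' -> ball z delta z' -> `|f z' - f z| < eps.
Proof.
move=> Kz seqf eps0; apply: contrapT => N.
have U n : exists z', [/\ K z', ball z n.+1%:R^-1 z' & eps <= `|f z' - f z|].
  apply: contrapT => Nn; apply: N; exists n.+1%:R^-1 => // z' Kz' bz'.
  by rewrite ltNge; apply/negP => h; apply: Nn; exists z'.
have [u uP] := choice U.
have uz : u @ \oo --> z.
  apply/cvg_ballP => r r0; near=> n; have [_ un _] := uP n.
  apply: le_ball un; apply/ltW; near: n; exact: near_infty_natSinv_lt (PosNum r0).
have /cvgr_dist_lt /(_ _ eps0) [n _ /(_ n (leqnn n))] :=
  seqf u (fun n => let: And3 a _ _ := uP n in a) uz.
by rewrite /= distrC => h; have [_ _] := uP n; rewrite leNgt h.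
Unshelve. all: by end_near.
Qed.

End sequences_in_a_compact_set.

Section bounded_convergence.
Context (R : realType) d (X : measurableType d) (lambda : probability X R).

Lemma bounded_cvg (f : nat -> X -> R) (h : X -> R) B :
  (forall n, measurable_fun setT (f n)) -> measurable_fun setT h ->
  (forall n x, `|f n x| <= B) -> (forall x, f ^~ x @ \oo --> h x) ->
  (fun n => \int[lambda]_x f n x) @ \oo --> \int[lambda]_x h x.
Proof.
move=> mf mh fB fh.
have cE : \forall x \ae lambda, setT x ->
    (fun n => (f n x)%:E) @ \oo --> (h x)%:E.
  by apply: aeW => x _; apply: cvg_EFin; [exact: nearW|exact: fh].
have lE : \forall x \ae lambda, forall n, setT x -> (`|(f n x)%:E| <= B%:E)%E.
  by apply: aeW => x n _ /=; rewrite lee_fin.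
have mhE : measurable_fun setT (EFin \o h) by exact/measurable_EFinP.
have [jh _ D] := @dominated_convergence _ _ _ lambda setT measurableT
  (fun n => EFin \o f n) _ _ (fun n => (measurable_EFinP _ _).2 (mf n)) mhE cE
  (integrable_cst_prob lambda B) lE.
apply: fine_cvg; rewrite fineK//; last exact: integrable_fin_num jh.
Qed.

End bounded_convergence.

Section likelihood_continuity.
Context (R : realType) (dX dY : measure_display).
Context (X : measurableType dX) (Y : measurableType dY).
Variables (lambda : probability X R) (mu : {sigma_finite_measure set Y -> \bar R}).
Variables (sm sp bp : R).

(** A bound for the likelihoods that is the same for all the models with a given
bp, as dominated convergence requires. *)
Fixpoint lik_bound sh : R :=
  if sh is Node l r then bp * (lik_bound l * lik_bound r) else 1.

Section one_model.
Variables (q : X -> X -> R) (g : X -> Y -> R).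
Variables (Q : R.-pker X ~> X) (G : R.-pker X ~> Y).
Hypothesis M : regular_model lambda mu sm sp bp q g Q G.

Lemma lik_ge0 sh x y : 0 <= lik lambda q g sh x y.
Proof. by rewrite -lee_fin -(likE_lik M) likE_ge0//; [exact: rm_q0 M|exact: rm_g0 M]. Qed.

Lemma branch_integral sh x y :
  branch lambda q g sh x y = \int[lambda]_x' (q x x' * lik lambda q g sh x' y).
Proof.
by congr fine; apply: eq_integral => x' _; rewrite (likE_lik M) EFinM.
Qed.

Lemma root_integral sh y : root lambda q g sh y = \int[lambda]_x lik lambda q g sh x y.
Proof. by congr fine; apply: eq_integral => x _; rewrite (likE_lik M). Qed.

Lemma lik_le sh x y : lik lambda q g sh x y <= lik_bound sh.
Proof.
have bp0 : 0 <= bp := le_trans (rm_g0 M point point) (rm_g_le M point point).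
elim: sh x y => [|l IHl r IHr] x y; first by rewrite /lik /=.
have br sh b : (forall x y, lik lambda q g sh x y <= b) ->
    forall x y, branch lambda q g sh x y <= b.
  move=> shb x0 y0; have b0 : 0 <= b := le_trans (lik_ge0 sh point y0) (shb _ _).
  rewrite -lee_fin -(branchE_branch M).
  rewrite -[leRHS]mule1 -(rm_q1 M x0) -ge0_integralZl//;
    [|by apply/measurable_EFinP; exact: (measurable_qx (rm_mq M))|
     by move=> x' _; rewrite lee_fin (rm_q0 M)].
  apply: ge0_le_integral => //.
  - by move=> x' _; rewrite mule_ge0 ?lee_fin ?(rm_q0 M)// (likE_lik M) lee_fin lik_ge0.
  - exact: (measurable_qlikE _ (rm_q0 M) (rm_g0 M) (rm_mq M) (rm_mg M)).
  - apply: emeasurable_funM => //.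
    by apply/measurable_EFinP; exact: (measurable_qx (rm_mq M)).
  - by move=> x' _; rewrite (likE_lik M) -!EFinM lee_fin mulrC ler_wpM2r ?(rm_q0 M).
rewrite (lik_node M) /=; apply: ler_pM.
- exact: (rm_g0 M).
- by rewrite mulr_ge0// (branch_ge0 M).
- exact: (rm_g_le M).
- by apply: ler_pM; rewrite ?(branch_ge0 M) ?br.
Qed.

Lemma lik_norm_le sh x y : `|lik lambda q g sh x y| <= lik_bound sh.
Proof. by rewrite ger0_norm ?lik_ge0 ?lik_le. Qed.

End one_model.

Variables (q : nat -> X -> X -> R) (g : nat -> X -> Y -> R).
Variables (Q : nat -> R.-pker X ~> X) (G : nat -> R.-pker X ~> Y).
Hypothesis M : forall n, regular_model lambda mu sm sp bp (q n) (g n) (Q n) (G n).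
Variables (q' : X -> X -> R) (g' : X -> Y -> R).
Variables (Q' : R.-pker X ~> X) (G' : R.-pker X ~> Y).
Hypothesis M' : regular_model lambda mu sm sp bp q' g' Q' G'.
Hypothesis qq' : forall x x', (fun n => q n x x') @ \oo --> q' x x'.
Hypothesis gg' : forall x y, (fun n => g n x y) @ \oo --> g' x y.

(** Bounded convergence at each vertex, by induction on the shape. *)
Lemma lik_cvg sh x y :
  (fun n => lik lambda (q n) (g n) sh x y) @ \oo --> lik lambda q' g' sh x y.
Proof.
elim: sh x y => [|l IHl r IHr] x y; first exact: cvg_cst.
have br sh : (forall x y, (fun n => lik lambda (q n) (g n) sh x y) @ \oo -->
      lik lambda q' g' sh x y) ->
    forall x y, (fun n => branch lambda (q n) (g n) sh x y) @ \oo -->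
      branch lambda q' g' sh x y.
  move=> IH x0 y0; rewrite (branch_integral M').
  under eq_fun do rewrite (branch_integral (M _)).
  apply: (@bounded_cvg _ _ _ _ _ _ (sp * lik_bound sh)).
  - move=> n; apply: measurable_funM; last exact: measurable_lik2 (M n) _ _.
    exact: (measurable_qx (rm_mq (M n))).
  - apply: measurable_funM; last exact: measurable_lik2 M' _ _.
    exact: (measurable_qx (rm_mq M')).
  - move=> n x'; rewrite normrM ler_pM// ?(lik_norm_le (M n))//.
    by have /andP[_ qs] := rm_q_bounds (M n) x0 x'; rewrite ger0_norm ?(rm_q0 (M n)).
  - by move=> x'; apply: cvgM => //; exact: IH.
rewrite (lik_node M'); under eq_fun do rewrite (lik_node (M _)).
by apply: cvgM; [exact: gg'|apply: cvgM; apply: br].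
Qed.

Lemma root_cvg sh y :
  (fun n => root lambda (q n) (g n) sh y) @ \oo --> root lambda q' g' sh y.
Proof.
rewrite (root_integral M'); under eq_fun do rewrite (root_integral (M _)).
apply: (@bounded_cvg _ _ _ _ _ _ (lik_bound sh)).
- by move=> n; exact: measurable_lik2 (M n) _ _.
- exact: measurable_lik2 M' _ _.
- by move=> n x; exact: lik_norm_le (M n) _ _ _.
- by move=> x; exact: lik_cvg.
Qed.

End likelihood_continuity.

(** * Growth of the log-likelihood *)

Section averages_of_observations.
Context (R : realType) (dX dY : measure_display).
Context (X : measurableType dX) (Y : measurableType dY).
Variables (lambda : probability X R) (mu : {sigma_finite_measure set Y -> \bar R}).
Variables (sm sp bp : R).
Variables (qs : X -> X -> R) (gs : X -> Y -> R).
Variables (Qs : R.-pker X ~> X) (Gs : R.-pker X ~> Y).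
Hypothesis Ms : regular_model lambda mu sm sp bp qs gs Qs Gs.
Variable pi : probability X R.
Hypothesis pi_inv : invariant_probability Qs pi.
Variables (d : measure_display) (Omega : measurableType d) (P : probability Omega R).
Variables (Xs : vertex -> {RV P >-> X}) (Ys : vertex -> {RV P >-> Y}).
Hypothesis hmm : is_extended_HMT Xs Ys Qs Gs pi.
Variables (zeta : probability X R) (d' : measure_display) (Omega' : measurableType d').
Variables (P' : probability Omega' R) (X' : seq bool -> {RV P' >-> X}).
Variable Y' : seq bool -> {RV P' >-> Y}.
Hypothesis hmm' : is_HMT X' Y' Qs Gs zeta.

Local Notation cfg := (config (seq bool) Y).
Local Notation eta := (stat_law Ys).

Lemma ge0_avg_ae_cvg n (F : cfg -> R) : (forall y, 0 <= F y) ->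
  measurable_fun setT F -> (forall y, F (trunc n y) = F y) ->
  (\int[eta]_y (F y ^+ 2)%:E < +oo)%E ->
  \forall y \ae obs_law Y', (fun m => avg F m y) @ \oo --> \int[eta]_y F y.
Proof.
move=> F0 mF Fn F2.
have jF : eta.-integrable setT (EFin \o F) by exact: integrable_of_sqr.
have mFE : measurable_fun setT (EFin \o F) by exact/measurable_EFinP.
have mF2 : measurable_fun setT (fun y => (F y ^+ 2)%:E).
  by apply/measurable_EFinP; exact: measurable_funX.
have FE0 y : (0 <= (F y)%:E)%E by rewrite lee_fin.
have FE20 y : (0 <= (F y ^+ 2)%:E)%E by rewrite lee_fin sqr_ge0.
have FEn y : (F (trunc n y))%:E = (F y)%:E by rewrite Fn.
have FE2n y : (F (trunc n y) ^+ 2)%:E = (F y ^+ 2)%:E by rewrite Fn.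
apply: (avg_ae_cvg Ms pi_inv F0 mF Fn (c2 := fine (\int[eta]_y (F y ^+ 2)%:E)%E) _ _ hmm').
- rewrite -(ge0_stat_law Ms hmm FE0 mFE FEn) fineK//.
  exact: integrable_fin_num jF.
- rewrite -(ge0_stat_law Ms hmm FE20 mF2 FE2n) fineK// ge0_fin_numE//.
  exact: integral_ge0.
Qed.

(** The law of large numbers for nonnegative functionals, applied to F + E and E. *)
Lemma avg_ae_cvg_le n (F E : cfg -> R) : measurable_fun setT F ->
  measurable_fun setT E -> (forall y, F (trunc n y) = F y) ->
  (forall y, E (trunc n y) = E y) -> (forall y, `|F y| <= E y) ->
  (\int[eta]_y (E y ^+ 2)%:E < +oo)%E ->
  \forall y \ae obs_law Y', (fun m => avg F m y) @ \oo --> \int[eta]_y F y.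
Proof.
move=> mF mE Fn En FE E2.
have E0 y : 0 <= E y by exact: le_trans (normr_ge0 _) (FE y).
have S0 y : 0 <= F y + E y.
  by have := FE y; rewrite ler_norml => /andP[? _]; lra.
have mS : measurable_fun setT (fun y => F y + E y) by exact: measurable_funD.
have Sn y : F (trunc n y) + E (trunc n y) = F y + E y by rewrite Fn En.
have S2 : (\int[eta]_y ((F y + E y) ^+ 2)%:E < +oo)%E.
  apply: (@le_lt_trans _ _ (\int[eta]_y (4 * E y ^+ 2)%:E)%E).
    apply: le_integral_EFin.
    - by move=> y; exact: sqr_ge0.
    - exact: measurable_funX.
    - by apply: measurable_funM => //; exact: measurable_funX.
    - move=> y; have := FE y; have := S0 y; rewrite ler_norml => ? /andP[_ ?].
      by nra.
  rewrite ge0_integralZl_EFin'//.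
  - by apply: lte_mul_pinfty.
  - by move=> y; exact: sqr_ge0.
  - exact: measurable_funX.
have jE : eta.-integrable setT (EFin \o E) by exact: integrable_of_sqr.
have jF : eta.-integrable setT (EFin \o F) by exact: integrable_le mF jE FE.
have := ge0_avg_ae_cvg E0 mE En E2; have := ge0_avg_ae_cvg S0 mS Sn S2.
apply: filterS2 => y cS cE.
have -> : \int[eta]_y F y = \int[eta]_y (F y + E y) - \int[eta]_y E y.
  by rewrite RintegralD// addrK.
have -> : (fun m => avg F m y) = (fun m => avg (fun y => F y + E y) m y - avg E m y).
  by apply/funext => m; rewrite avgD addrK.
exact: cvgB.
Qed.

End averages_of_observations.

Section envelope_growth.
Context (R : realType) d (Y : measurableType d) (e : Y -> R).
Local Notation cfg := (config (seq bool) Y).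
Local Notation eroot := (fun y : cfg => e (y [::])).

Lemma envelope_avg n (y : cfg) :
  envelope e n.+1 y = envelope e n y + 2 ^+ n * avg eroot n y.
Proof.
elim: n y => [|n IH] y; first by rewrite /= expr0; ring.
rewrite -[envelope e n.+2 y]/(e (y [::]) +
  (envelope e n.+1 (sub y false) + envelope e n.+1 (sub y true))).
by rewrite (IH (sub y false)) (IH (sub y true)) /= exprS; field.
Qed.

(** The envelope divided by 2^n is a weighted average of the level averages of e,
with weights concentrated on the last levels; it has the same limit. *)
Lemma envelope_eventually (y : cfg) (c : R) : 0 <= c ->
  (fun m => avg eroot m y) @ \oo --> c ->
  \forall n \near \oo, envelope e n y <= 2 ^+ n * (c + 1).
Proof.
move=> c0 cc.
have [N _ NP] : \forall m \near \oo, avg eroot m y <= c + 2^-1.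
  by apply: cvgr_le cc _ _; rewrite ltrDl.
have H j : envelope e (N + j) y <= envelope e N y + 2 ^+ (N + j) * (c + 2^-1).
  elim: j => [|j IH]; first by rewrite addn0 lerDl mulr_ge0 ?exprn_ge0 ?addr_ge0.
  rewrite addnS envelope_avg exprS.
  have := NP (N + j)%N (leq_addr _ _) => /= h.
  have p0 : 0 <= 2 ^+ (N + j) :> R by rewrite exprn_ge0.
  have := ler_wpM2l p0 h.
  by lra.
have z : (fun n => (2^-1 : R) ^+ n * (2 * envelope e N y)) @ \oo --> (0 : R).
  rewrite -[X in _ --> X](mul0r (2 * envelope e N y)); apply: cvgMr_tmp.
  by apply: cvg_expr; rewrite ger0_norm// invf_lt1// ltr1n.
near=> n.
have Nn : (N <= n)%N by near: n; exists N.
have := H (n - N)%N; rewrite subnKC// => h.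
have : (2^-1 : R) ^+ n * (2 * envelope e N y) < 1.
  by near: n; apply: cvgr_lt z _ ltr01.
have p0 : 0 < 2 ^+ n :> R by rewrite exprn_gt0.
move=> h1; have h2 : 2 * envelope e N y < 2 ^+ n.
  rewrite -[X in X < _](@mulVKf _ (2 ^+ n)) ?gt_eqF// -exprVn.
  by rewrite -[X in _ < X]mulr1 ltr_pM2l.
by lra.
Unshelve. all: by end_near.
Qed.

End envelope_growth.

Section likelihood_growth.
Context (R : realType) (dX dY : measure_display).
Context (X : measurableType dX) (Y : measurableType dY).
Variables (lambda : probability X R) (mu : {sigma_finite_measure set Y -> \bar R}).
Variables (sm sp bp : R) (q : X -> X -> R) (g : X -> Y -> R).
Variables (Q : R.-pker X ~> X) (G : R.-pker X ~> Y).
Hypothesis M : regular_model lambda mu sm sp bp q g Q G.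
Variable bm : Y -> R.
Hypothesis bm0 : forall y, 0 < bm y.
Hypothesis bm_le : forall y, ((bm y)%:E <= \int[lambda]_x (g x y)%:E)%E.

Local Notation cfg := (config (seq bool) Y).
Local Notation e := (vertex_err sm sp bp bm).
Local Notation lnlik n x y := (ln (lik lambda q g (full n) x y)).

(** The main term is the sum of flog k over the subtrees rooted at height N + 1;
the first N + 1 levels contribute at most the envelope. *)
Lemma ln_lik_growth N k x (y : cfg) :
  `|lnlik (N.+1 + k) x y - ln (g x (y [::])) - 2 ^+ N.+1 * avg (flog lambda q g k) N.+1 y|
    <= 2 * cq sm sp + envelope e N.+1 y + 2 ^+ N.+1 * cq sm sp.
Proof.
have := ln_lik_cut M bm0 bm_le N k x y; have := ln_lik_node M bm0 bm_le N x y.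
have := flog_envelope M bm0 bm_le N (sub y false).
have := flog_envelope M bm0 bm_le N (sub y true).
have := vertex_err_ge0 sm sp bp bm (y [::]).
rewrite -[envelope e N.+1 y]/(e (y [::]) +
  (envelope e N (sub y false) + envelope e N (sub y true))).
move: (avg _ _ _) (lnlik (N.+1 + k) x y) (lnlik N.+1 x y) => A L L1.
rewrite !ler_norml => ? /andP[? ?] /andP[? ?] /andP[? ?] /andP[? ?].
by apply/andP; split; lra.
Qed.

End likelihood_growth.

(** * Suprema over small neighbourhoods *)

Section local_suprema.
Context (R : realType) (dX dY : measure_display).
Context (X : measurableType dX) (Y : measurableType dY).
Variables (lambda : probability X R) (mu : {sigma_finite_measure set Y -> \bar R}).
Variables (sm sp bp : R) (bm : Y -> R).
Hypothesis bm0 : forall y, 0 < bm y.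
Hypothesis mbm : measurable_fun setT bm.
Variables (T : pseudoMetricType R) (Theta : set T).
Variables (q : T -> X -> X -> R) (g : T -> X -> Y -> R).
Variables (Q : T -> R.-pker X ~> X) (G : T -> R.-pker X ~> Y).
Hypothesis M : forall theta, Theta theta ->
  regular_model lambda mu sm sp bp (q theta) (g theta) (Q theta) (G theta).
Hypothesis bm_le : forall theta, Theta theta ->
  forall y, ((bm y)%:E <= \int[lambda]_x (g theta x y)%:E)%E.
Hypothesis q_cont : forall x x', {within Theta, continuous (fun theta => q theta x x')}.
Hypothesis g_cont : forall x y, {within Theta, continuous (fun theta => g theta x y)}.

Local Notation cfg := (config (seq bool) Y).
Local Notation flog theta := (flog lambda (q theta) (g theta)).

Lemma flog_cvg_seq (u : nat -> T) theta k y : Theta theta -> (forall n, Theta (u n)) ->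
  u @ \oo --> theta -> (fun n => flog (u n) k y) @ \oo --> flog theta k y.
Proof.
move=> Tt Tu ut.
have c : (fun n => root lambda (q (u n)) (g (u n)) (full k) y) @ \oo -->
    root lambda (q theta) (g theta) (full k) y.
  apply: (root_cvg (fun n => M (Tu n)) (M Tt)) => a b.
    exact: (within_cvg_seq (@q_cont a b) Tt Tu ut).
  exact: (within_cvg_seq (@g_cont a b) Tt Tu ut).
have cl : @ln R @ root lambda (q theta) (g theta) (full k) y --> flog theta k y.
  exact: continuous_ln (root_gt0 (M Tt) bm0 (bm_le Tt) (full k) y).
exact: cvg_comp c cl.
Qed.

Variables (t : nat -> T).
Hypothesis tT : forall n, Theta (t n).
Hypothesis t_dense : forall z eps, Theta z -> 0 < eps -> exists n, ball z eps (t n).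
Variables (theta0 : T) (k : nat).
Hypothesis Theta0 : Theta theta0.

(** The points of the dense sequence outside the ball are replaced by theta0: the
supremum below is then over a nonempty countable family, hence measurable. *)
Definition near_idx j n := if `[< ball theta0 j.+1%:R^-1 (t n) >] then t n else theta0.

Definition flog_sup j (y : cfg) : R := sup [set flog (near_idx j n) k y | n in setT].

Lemma near_idxT j n : Theta (near_idx j n).
Proof. by rewrite /near_idx; case: ifP. Qed.

Local Notation e := (vertex_err sm sp bp bm).

Let abs_le theta y : Theta theta -> `|flog theta k y| <= envelope e k y.
Proof. by move=> Tt; exact: (flog_envelope (M Tt) bm0 (bm_le Tt)). Qed.

Lemma flog_sup_has j y : has_sup [set flog (near_idx j n) k y | n in setT].
Proof.
split; first by exists (flog (near_idx j 0) k y); exists 0%N.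
exists (envelope e k y) => _ [n _ <-].
exact: le_trans (ler_norm _) (abs_le y (near_idxT j n)).
Qed.

Lemma measurable_flog_sup j : measurable_fun setT (flog_sup j).
Proof.
have -> : flog_sup j = (fun y => sups (fun n => flog (near_idx j n) k y) 0).
  apply/funext => y; congr sup; apply/seteqP; split => [_ [n _ <-]|_ [n _ <-]];
    by exists n.
apply: measurable_fun_sups => [y _|n].
  have [_ [b bP]] := flog_sup_has j y; exists b => _ [n _ <-].
  by apply: bP; exists n.
exact: (measurable_flog (M (near_idxT j n))).
Qed.

Lemma flog_sup_trunc j y : flog_sup j (trunc k y) = flog_sup j y.
Proof. by rewrite /flog_sup; under eq_fun do rewrite flog_trunc. Qed.

Lemma flog_sup_between j y a b :
  (forall n, a <= flog (near_idx j n) k y <= b) -> a <= flog_sup j y <= b.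
Proof.
move=> ab; have [ne ub] := flog_sup_has j y; apply/andP; split.
  apply: le_trans (ub_le_sup ub (x := flog (near_idx j 0) k y) _).
    by have /andP[] := ab 0%N.
  by exists 0%N.
by apply: ge_sup => // _ [n _ <-]; have /andP[] := ab n.
Qed.

Lemma flog_sup_abs j y : `|flog_sup j y| <= envelope e k y.
Proof.
rewrite ler_norml; apply: flog_sup_between => n.
by rewrite -ler_norml abs_le//; exact: near_idxT.
Qed.

(** By density and continuity the countable supremum controls the whole ball; half
the radius is given up because a ball of a pseudometric is not assumed open. *)
Lemma flog_le_sup j y theta : Theta theta ->
  ball theta0 (j.+1%:R^-1 / 2) theta -> flog theta k y <= flog_sup j y.
Proof.
move=> Tt bt.
have r0 : 0 < j.+1%:R^-1 / 2 :> R by rewrite divr_gt0// invr_gt0 ltr0n.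
have U n : exists i, ball theta (n.+1%:R^-1) (t i) /\ ball theta (j.+1%:R^-1 / 2) (t i).
  have [i iP] := t_dense Tt (eps := Num.min n.+1%:R^-1 (j.+1%:R^-1 / 2)) (ltac:(rewrite lt_min r0 andbT invr_gt0 ltr0n//)).
  exists i; split; apply: le_ball iP; by rewrite ge_min lexx ?orbT.
have [i iP] := choice U.
have ti : t \o i @ \oo --> theta.
  apply/cvg_ballP => r r1; near=> n; have [un _] := iP n.
  apply: le_ball un; apply/ltW; near: n; exact: near_infty_natSinv_lt (PosNum r1).
have c : (fun n => flog (t (i n)) k y) @ \oo --> flog theta k y.
  exact: (flog_cvg_seq Tt (fun n => tT (i n)) ti).
apply: (cvgr_to_le c); apply: nearW => n.
have [_ [b ub]] := flog_sup_has j y.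
have E : near_idx j (i n) = t (i n).
  rewrite /near_idx; case: asboolP => // H; exfalso; apply: H.
  by rewrite [X in ball _ X]splitr; apply: ball_triangle bt _; have [] := iP n.
by rewrite -E; apply: (ub_le_sup (ex_intro _ b ub)); exact: (ex_intro2 _ _ (i n) I erefl).
Unshelve. all: by end_near.
Qed.

Lemma flog_sup_cvg y : (fun j => flog_sup j y) @ \oo --> flog theta0 k y.
Proof.
apply/cvgrPdist_le => eps eps0.
have [delta delta0 dP] := @ball_of_cvg_seq R T Theta (fun theta => flog theta k y) theta0 eps
  Theta0 (fun u Tu uz => @flog_cvg_seq u theta0 k y Theta0 Tu uz) eps0.
near=> j.
rewrite distrC ler_distl; apply: flog_sup_between => n.
rewrite -ler_distl /near_idx; case: asboolP => [b|_]; last by rewrite subrr normr0 ltW.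
apply/ltW/dP => //; apply: le_ball b; apply/ltW; near: j.
exact: near_infty_natSinv_lt (PosNum delta0).
Unshelve. all: by end_near.
Qed.

End local_suprema.

(** * Separation of the parameters *)

(** Comparison of the two bounds of ln_lik_growth: p stands for 2^(N+1), A and AF are
level averages at the competitor and at the true parameter, E is the envelope, and
the gap between the stationary means a0 and as_ beats all the errors. *)
Lemma separation_arith (R : realFieldType)
    (p c lb eb gs gt L Ls a0 as_ AF AS I_ A E : R) :
  0 < p ->
  L - gt - p * A <= 2 * c + E + p * c ->
  - (2 * c + E + p * c) <= Ls - gs - p * AF ->
  lb - gs + 4 * c < p ->
  E <= p * (eb + 1) ->
  as_ - 4^-1 < AF -> AS < I_ + 4^-1 -> A <= AS ->
  a0 + (2 * c + 2 * (eb + 1) + 2) < as_ -> I_ < a0 + 2^-1 -> gt <= lb ->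
  L < Ls.
Proof.
move=> p0 up low K0p hE hF hS AS' gap gapj gb.
have key : p * (A - AF) <= p * (- (2 * c + 2 * (eb + 1) + 1)).
  by rewrite ler_pM2l//; lra.
by lra.
Qed.

Section separation.
Context (R : realType) (dX dY : measure_display).
Context (X : measurableType dX) (Y : measurableType dY).
Variables (lambda : probability X R) (mu : {sigma_finite_measure set Y -> \bar R}).
Variables (sm sp bp : R) (bm : Y -> R).
Hypothesis bm0 : forall y, 0 < bm y.
Hypothesis mbm : measurable_fun setT bm.
Variables (T : pseudoMetricType R) (Theta : set T).
Variables (q : T -> X -> X -> R) (g : T -> X -> Y -> R).
Variables (Q : T -> R.-pker X ~> X) (G : T -> R.-pker X ~> Y).
Hypothesis M : forall theta, Theta theta ->
  regular_model lambda mu sm sp bp (q theta) (g theta) (Q theta) (G theta).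
Hypothesis bm_le : forall theta, Theta theta ->
  forall y, ((bm y)%:E <= \int[lambda]_x (g theta x y)%:E)%E.
Hypothesis q_cont : forall x x', {within Theta, continuous (fun theta => q theta x x')}.
Hypothesis g_cont : forall x y, {within Theta, continuous (fun theta => g theta x y)}.
Variables (t : nat -> T).
Hypothesis tT : forall n, Theta (t n).
Hypothesis t_dense : forall z eps, Theta z -> 0 < eps -> exists n, ball z eps (t n).
Variable theta_s : T.
Hypothesis Theta_s : Theta theta_s.
Variable pi : probability X R.
Hypothesis pi_inv : invariant_probability (Q theta_s) pi.
Variables (d : measure_display) (Omega : measurableType d) (P : probability Omega R).
Variables (Xs : vertex -> {RV P >-> X}) (Ys : vertex -> {RV P >-> Y}).
Hypothesis hmm : is_extended_HMT Xs Ys (Q theta_s) (G theta_s) pi.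
Local Notation e := (vertex_err sm sp bp bm).
Hypothesis e2 : (\int[P]_w (e (Ys origin w) ^+ 2)%:E < +oo)%E.
Variables (dU : measure_display) (OmegaU : measurableType dU).
Variables (PU : probability OmegaU R) (U : nat -> {RV PU >-> bool}).
Hypothesis U_iid : iid_bernoulli_half U.
Variables (zeta : probability X R) (d' : measure_display) (Omega' : measurableType d').
Variables (P' : probability Omega' R) (X' : seq bool -> {RV P' >-> X}).
Variable Y' : seq bool -> {RV P' >-> Y}.
Hypothesis hmm' : is_HMT X' Y' (Q theta_s) (G theta_s) zeta.

Local Notation cfg := (config (seq bool) Y).
Local Notation eta := (stat_law Ys).
Local Notation flog theta := (flog lambda (q theta) (g theta)).
Local Notation alog theta := (alog lambda Ys (q theta) (g theta)).
Local Notation contrast := (contrast lambda q g U Ys).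
Local Notation lnlik theta n x y := (ln (lik lambda (q theta) (g theta) (full n) x y)).

Let clim theta (Tt : Theta theta) :
  (fun k => (2^-1) ^+ k * alog theta k) @ \oo --> contrast theta.
Proof.
exact: (contrast_lim bm0 mbm (M Theta_s) pi_inv hmm e2 U_iid (M Tt) (bm_le Tt)).
Qed.

Let half_cvg0 (C : R) : (fun k => (2^-1 : R) ^+ k * C) @ \oo --> (0 : R).
Proof.
rewrite -[X in _ --> X](mul0r C); apply: cvgMr_tmp.
by apply: cvg_expr; rewrite ger0_norm// invf_lt1// ltr1n.
Qed.

(** The additive constant in alog_le disappears after division by 2^k. *)
Lemma contrast_le theta : Theta theta -> contrast theta <= contrast theta_s.
Proof.
move=> Tt.
have c : (fun k => (2^-1) ^+ k * alog theta_s k + (2^-1) ^+ k * (sp - 1)) @ \oo -->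
    contrast theta_s + 0.
  exact: cvgD (clim Theta_s) (half_cvg0 _).
rewrite -[leRHS]addr0; apply: (ler_cvg_to (clim Tt) c).
apply: nearW => k; rewrite -mulrDr ler_wpM2l ?exprn_ge0//.
exact: (alog_le bm0 mbm (M Theta_s) (bm_le Theta_s) pi_inv hmm e2 (M Tt) (bm_le Tt)).
Qed.

(** A difference of the growth rates 2^-k a_k makes the gap between the a_k
themselves grow like 2^k. *)
Lemma block_gap theta (C : R) : Theta theta -> contrast theta < contrast theta_s ->
  exists k, alog theta k + C < alog theta_s k.
Proof.
move=> Tt lt.
have c : (fun k => (2^-1) ^+ k * alog theta k + (2^-1) ^+ k * C) @ \oo --> contrast theta + 0.
  exact: cvgD (clim Tt) (half_cvg0 _).
rewrite addr0 in c.
pose m := (contrast theta + contrast theta_s) / 2.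
have [h1 h2] := midf_lt lt; rewrite -/m in h1 h2.
have [k [k1 k2]] : exists k, (2^-1) ^+ k * alog theta k + (2^-1) ^+ k * C < m /\
    m < (2^-1) ^+ k * alog theta_s k.
  have [N1 _ H1] := cvgr_lt _ c _ h1.
  have [N2 _ H2] := cvgr_gt _ (clim Theta_s) _ h2.
  exists (maxn N1 N2); split; first exact: (H1 _ (leq_maxl _ _)).
  exact: (H2 _ (leq_maxr _ _)).
exists k; have := lt_trans k1 k2; rewrite -mulrDr ltr_pM2l.
  by [].
by rewrite exprn_gt0.
Qed.

Let me := measurable_vertex_err sm sp bp mbm.
Let jenv k := integrable_envelope (M Theta_s) pi_inv hmm me e2 k.

Let ebar_cvg : \forall y \ae obs_law Y',
  (fun m => avg (fun y : cfg => e (y [::])) m y) @ \oo --> ebar sm sp bp bm Ys.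
Proof.
apply: (ge0_avg_ae_cvg (M Theta_s) pi_inv hmm hmm' (n := 1)) => //.
- by move=> y; exact: vertex_err_ge0.
- exact: (measurableT_comp me (measurable_coord [::])).
- rewrite ge0_integral_obs_law//; first by move=> y; rewrite lee_fin sqr_ge0.
  apply/measurable_EFinP; apply: measurable_funX.
  exact: (measurableT_comp me (measurable_coord [::])).
Qed.

Section one_competitor.
Variable theta0 : T.
Hypothesis Theta0 : Theta theta0.
Local Notation flog_sup k j := (flog_sup lambda q g t theta0 k j).

Let mS k j : measurable_fun setT (flog_sup k j : cfg -> R).
Proof. exact: (measurable_flog_sup bm0 M bm_le tT k Theta0 j). Qed.

Let S_le k j y : `|flog_sup k j y| <= envelope e k y.
Proof. exact: (flog_sup_abs bm0 M bm_le tT k Theta0 j y). Qed.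

Lemma integral_flog_sup_cvg k :
  (fun j => \int[eta]_y flog_sup k j y) @ \oo --> alog theta0 k.
Proof.
have cE : \forall y \ae eta, setT y ->
    (fun j => (flog_sup k j y)%:E) @ \oo --> (flog theta0 k y)%:E.
  apply: aeW => y _; apply: cvg_EFin; first exact: nearW.
  exact: (flog_sup_cvg bm0 M bm_le q_cont g_cont tT).
have lE : \forall y \ae eta, forall j, setT y ->
    (`|(flog_sup k j y)%:E| <= (envelope e k y)%:E)%E.
  by apply: aeW => y j _; rewrite /= lee_fin; exact: S_le.
have mf : measurable_fun setT (EFin \o flog theta0 k).
  by apply/measurable_EFinP; exact: (measurable_flog (M Theta0)).
have [jf _ D] := @dominated_convergence _ _ _ eta setT measurableT
  (fun j => EFin \o flog_sup k j) _ _ (fun j => (measurable_EFinP _ _).2 (mS k j)) mf cE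
  (jenv k) lE.
apply: fine_cvg; rewrite fineK//; exact: integrable_fin_num jf.
Qed.

(** Choose k so that the gap at theta0 exceeds the cutting errors per subtree, then
the radius so that passing to the supremum over the ball costs at most 1/2. *)
Lemma local_separation x : contrast theta0 < contrast theta_s ->
  exists2 delta, 0 < delta & \forall y \ae obs_law Y', \forall n \near \oo,
    forall theta, Theta theta -> ball theta0 delta theta ->
      lnlik theta n.+1 x y < lnlik theta_s n.+1 x y.
Proof.
move=> lt.
pose eb := ebar sm sp bp bm Ys.
have eb0 : 0 <= eb by apply: Rintegral_ge0 => y _; exact: vertex_err_ge0.
(* 2 cq and 2 (eb + 1) bound the errors of both likelihoods per subtree, the
   last 2 leaves room for the fluctuations of the averages and for K0 below *)
have [k kP] := block_gap (2 * cq sm sp + 2 * (eb + 1) + 2) Theta0 lt.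
have [j jP] : exists j, \int[eta]_y flog_sup k j y < alog theta0 k + 2^-1.
  have up : alog theta0 k < alog theta0 k + 2^-1 by rewrite ltrDl.
  have [j _ jP] := cvgr_lt _ (@integral_flog_sup_cvg k) _ up.
  by exists j; exact: (jP j (leqnn j)).
exists (j.+1%:R^-1 / 2); first by rewrite divr_gt0// invr_gt0 ltr0n.
have env2 := envelope_sqr_fin (M Theta_s) pi_inv hmm me e2 k.
have menv := measurable_envelope me k.
have tS y : flog_sup k j (trunc k y) = flog_sup k j y by exact: flog_sup_trunc.
have aS := avg_ae_cvg_le (M Theta_s) pi_inv hmm hmm' (mS k j) menv tS
  (envelope_trunc e k) (S_le k j) env2.
have aF := avg_ae_cvg_le (M Theta_s) pi_inv hmm hmm' (measurable_flog (M Theta_s) k) menv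
  (flog_trunc lambda (q theta_s) (g theta_s) k) (envelope_trunc e k)
  (flog_envelope (M Theta_s) bm0 (bm_le Theta_s) k) env2.
move: aS aF ebar_cvg; apply: filterS3 => y cS cF ce.
pose K0 := ln bp - ln (g theta_s x (y [::])) + 4 * cq sm sp.
have up : \int[eta]_y flog_sup k j y < \int[eta]_y flog_sup k j y + 4^-1 by rewrite ltrDl.
have down : alog theta_s k - 4^-1 < alog theta_s k by rewrite ltrBlDr ltrDl.
have [N1 _ H1] := cvgr_lt _ cS _ up.
have [N2 _ H2] := cvgr_gt _ cF _ down.
have [N3 _ H3] := envelope_eventually eb0 ce.
have [N4 _ H4] := cvgr_lt _ (half_cvg0 K0) _ ltr01.
exists (k + maxn (maxn N1 N2) (maxn N3 N4))%N => // n nN theta Tt bt.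
have [N -> mN] : exists2 N, n.+1 = (N.+1 + k)%N &
    (maxn (maxn N1 N2) (maxn N3 N4) <= N.+1)%N.
  have kn : (k <= n)%N by apply: leq_trans nN; exact: leq_addr.
  exists (n - k)%N; first by rewrite addSn subnK.
  by apply: leqW; rewrite leq_subRL.
move: mN; rewrite !geq_max => /andP[/andP[n1 n2] /andP[n3 n4]].
have := H1 _ n1; have := H2 _ n2; have := H3 _ n3; have := H4 _ n4.
move=> /= h4 h3 h2 h1.
have p0 : 0 < 2 ^+ N.+1 :> R by rewrite exprn_gt0.
have h5 : K0 < 2 ^+ N.+1.
  rewrite -[X in X < _](@mulVKf _ (2 ^+ N.+1)) ?gt_eqF// -exprVn.
  by rewrite -[X in _ < X]mulr1 ltr_pM2l.
have a1 : avg (flog theta k) N.+1 y <= avg (flog_sup k j) N.+1 y.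
  apply: le_avg => z.
  exact: (flog_le_sup bm0 M bm_le q_cont g_cont tT t_dense k Theta0 z Tt bt).
have up' := ln_lik_growth (M Tt) bm0 (bm_le Tt) N k x y.
have low := ln_lik_growth (M Theta_s) bm0 (bm_le Theta_s) N k x y.
rewrite ler_norml in up'; rewrite ler_norml in low.
move: up' low => /andP[_ up'] /andP[low _].
have g1 : ln (g theta x (y [::])) <= ln bp.
  rewrite ler_ln ?posrE ?(rm_g_le (M Tt)) ?(rm_g_gt0 (M Tt))//.
  exact: lt_le_trans (rm_g_gt0 (M Tt) x (y [::])) (rm_g_le (M Tt) _ _).
exact: (separation_arith p0 up' low h5 h3 h2 h1 a1 kP jP g1).
Qed.
End one_competitor.
End separation.

Section uniform_separation_section.
Context (R : realType) (dX dY : measure_display).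
Context (X : measurableType dX) (Y : measurableType dY).
Variables (lambda : probability X R) (mu : {sigma_finite_measure set Y -> \bar R}).
Variables (sm sp bp : R) (bm : Y -> R).
Hypothesis bm0 : forall y, 0 < bm y.
Hypothesis mbm : measurable_fun setT bm.
Variables (T : pseudoMetricType R) (Theta : set T).
Variables (q : T -> X -> X -> R) (g : T -> X -> Y -> R).
Variables (Q : T -> R.-pker X ~> X) (G : T -> R.-pker X ~> Y).
Hypothesis M : forall theta, Theta theta ->
  regular_model lambda mu sm sp bp (q theta) (g theta) (Q theta) (G theta).
Hypothesis bm_le : forall theta, Theta theta ->
  forall y, ((bm y)%:E <= \int[lambda]_x (g theta x y)%:E)%E.
Hypothesis q_cont : forall x x', {within Theta, continuous (fun theta => q theta x x')}.
Hypothesis g_cont : forall x y, {within Theta, continuous (fun theta => g theta x y)}.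
Variables (t : nat -> T).
Hypothesis tT : forall n, Theta (t n).
Hypothesis t_dense : forall z eps, Theta z -> 0 < eps -> exists n, ball z eps (t n).
Variable theta_s : T.
Hypothesis Theta_s : Theta theta_s.
Variable pi : probability X R.
Hypothesis pi_inv : invariant_probability (Q theta_s) pi.
Variables (d : measure_display) (Omega : measurableType d) (P : probability Omega R).
Variables (Xs : vertex -> {RV P >-> X}) (Ys : vertex -> {RV P >-> Y}).
Hypothesis hmm : is_extended_HMT Xs Ys (Q theta_s) (G theta_s) pi.
Local Notation e := (vertex_err sm sp bp bm).
Hypothesis e2 : (\int[P]_w (e (Ys origin w) ^+ 2)%:E < +oo)%E.
Variables (dU : measure_display) (OmegaU : measurableType dU).
Variables (PU : probability OmegaU R) (U : nat -> {RV PU >-> bool}).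
Hypothesis U_iid : iid_bernoulli_half U.
Variables (zeta : probability X R) (d' : measure_display) (Omega' : measurableType d').
Variables (P' : probability Omega' R) (X' : seq bool -> {RV P' >-> X}).
Variable Y' : seq bool -> {RV P' >-> Y}.
Hypothesis hmm' : is_HMT X' Y' (Q theta_s) (G theta_s) zeta.

Local Notation cfg := (config (seq bool) Y).
Local Notation eta := (stat_law Ys).
Local Notation flog theta := (flog lambda (q theta) (g theta)).
Local Notation alog theta := (alog lambda Ys (q theta) (g theta)).
Local Notation contrast := (contrast lambda q g U Ys).
Local Notation lnlik theta n x y := (ln (lik lambda (q theta) (g theta) (full n) x y)).

Hypothesis cover_Theta : cover_compact Theta.
Hypothesis contrast_lt : forall theta, Theta theta -> theta <> theta_s ->
  contrast theta < contrast theta_s.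

(** A finite subcover of Theta by the ball around theta_s and the balls given by
local_separation. *)
Lemma uniform_separation x eps : 0 < eps ->
  \forall y \ae obs_law Y', \forall n \near \oo,
    forall theta, Theta theta -> ~ ball theta_s eps theta ->
      lnlik theta n.+1 x y < lnlik theta_s n.+1 x y.
Proof.
move=> eps0.
pose sep z r := 0 < r /\ (Theta z -> z <> theta_s ->
  \forall y \ae obs_law Y', \forall n \near \oo,
    forall theta, Theta theta -> ball z r theta ->
      lnlik theta n.+1 x y < lnlik theta_s n.+1 x y).
have sepz z : exists r, sep z r.
  have [[Tz zs]|Nz] := pselect (Theta z /\ z <> theta_s); last first.
    by exists 1; split => // Tz zs; exfalso; apply: Nz.
  have [r r0 rP] := local_separation bm0 mbm M bm_le q_cont g_cont tT t_dense
    Theta_s pi_inv hmm e2 U_iid hmm' Tz x (contrast_lt Tz zs).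
  by exists r; split.
have [rad radP] := choice sepz.
pose V z := if `[< z = theta_s >] then (ball theta_s eps)° else (ball z (rad z))°.
have [z _||D DT Dcov] := cover_Theta (D := Theta) (f := V).
- by rewrite /V; case: asboolP => _; exact: open_interior.
- move=> z Tz; exists z => //; rewrite /V; case: asboolP => [->|_].
    by apply: nbhs_singleton; apply: nbhs_interior; exact: nbhsx_ballx.
  apply: nbhs_singleton; apply: nbhs_interior; apply: nbhsx_ballx.
  by have [] := radP z.
have aeD : \forall y \ae obs_law Y', (\bigcap_(z in [set` D]) [set y : cfg | z <> theta_s ->
    \forall n \near \oo, forall theta, Theta theta -> ball z (rad z) theta ->
      lnlik theta n.+1 x y < lnlik theta_s n.+1 x y]) y.
  apply: filter_bigI => z zD; have Tz : Theta z by have := DT z zD; rewrite inE.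
  have [zs|zs] := pselect (z = theta_s); first by apply: aeW => y.
  have [_ /(_ Tz zs)] := radP z.
  by apply: (@filterS _ (almost_everywhere (obs_law Y'))) => y h _; exact: h.
apply: filterS aeD => y yD.
have nearD : \forall n \near \oo, (\bigcap_(z in [set` D]) [set n | z <> theta_s ->
    forall theta, Theta theta -> ball z (rad z) theta ->
      lnlik theta n.+1 x y < lnlik theta_s n.+1 x y]) n.
  apply: filter_bigI => z zD.
  have [zs|zs] := pselect (z = theta_s); first by exists 0%N => // n _ ns; case: (ns zs).
  have [N _ NP] := yD z zD zs; exists N => // n Nn _; exact: (NP n Nn).
have [N _ NP] := nearD; exists N => // n /NP nD theta Tt Nb.
have [z zD] := Dcov theta Tt; rewrite /V; case: asboolP => [_ /interior_subset //|zs].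
by move/interior_subset; exact: (nD z zD zs).
Qed.

End uniform_separation_section.

Lemma ae_obs_law (R : realType) dY (Y : measurableType dY) d (Omega : measurableType d)
    (P : probability Omega R) (V : eqType) (Yp : V -> {RV P >-> Y})
    (A : set (config V Y)) :
  (\forall y \ae obs_law Yp, A y) -> \forall w \ae P, A (fun v => Yp v w).
Proof.
move=> [B [mB B0 AB]]; exists ((fun w v => Yp v w) @^-1` B); split.
- by rewrite -[X in measurable X]setTI; apply: measurable_obs_map.
- exact: B0.
- by move=> w /= Nw; apply: AB.
Qed.

(** * Consistency *)

Section smallest_mean_density.
Context (R : realType) (dX dY : measure_display).
Context (X : measurableType dX) (Y : measurableType dY).
Variables (lambda : probability X R) (mu : {sigma_finite_measure set Y -> \bar R}).
Variables (sm sp bp : R).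
Variables (T : pseudoMetricType R) (Theta : set T).
Variables (q : T -> X -> X -> R) (g : T -> X -> Y -> R).
Variables (Q : T -> R.-pker X ~> X) (G : T -> R.-pker X ~> Y).
Hypothesis M : forall theta, Theta theta ->
  regular_model lambda mu sm sp bp (q theta) (g theta) (Q theta) (G theta).
Hypothesis q_cont : forall x x', {within Theta, continuous (fun theta => q theta x x')}.
Hypothesis g_cont : forall x y, {within Theta, continuous (fun theta => g theta x y)}.
Hypothesis g_inf : forall y, (0 < ereal_inf
     [set \int[lambda]_x (g theta x y)%:E | theta in Theta])%E.
Variables (t : nat -> T).
Hypothesis tT : forall n, Theta (t n).
Hypothesis t_dense : forall z eps, Theta z -> 0 < eps -> exists n, ball z eps (t n).

Local Notation bm := (b_minus lambda g Theta).

(** The mean of g over lambda is the likelihood of a single vertex, so that the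
continuity and measurability of likelihoods apply to it. *)
Lemma mean_g_root theta y : Theta theta ->
  (\int[lambda]_x (g theta x y)%:E)%E =
  (root lambda (q theta) (g theta) (full 1) (fun=> y))%:E.
Proof.
move=> Tt; rewrite -(rootE_root (M Tt)); apply: eq_integral => x _.
have b1 x0 (z : config (seq bool) Y) :
    branchE lambda (q theta) (g theta) Empty x0 z = 1%E.
  by rewrite /branchE; under eq_integral do rewrite mule1; exact: (rm_q1 (M Tt)).
by rewrite [full 1]/= likE_node !b1 !mule1.
Qed.

Lemma b_minusE y :
  (bm y)%:E = ereal_inf [set (\int[lambda]_x (g theta x y)%:E)%E | theta in Theta].
Proof.
rewrite fineK// fin_real//; apply/andP; split.
  by apply: lt_trans (g_inf y); exact: ltNyr.
apply: le_lt_trans (ereal_inf_lbound _) _; first by exists (t 0%N); [exact: tT|].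
by rewrite mean_g_root// ltry.
Qed.

Lemma b_minus_gt0 y : 0 < bm y.
Proof. by rewrite -lte_fin b_minusE. Qed.

Lemma b_minus_le theta : Theta theta ->
  forall y, ((bm y)%:E <= \int[lambda]_x (g theta x y)%:E)%E.
Proof. by move=> Tt y; rewrite b_minusE; apply: ereal_inf_lbound; exists theta. Qed.

Local Notation r theta y := (root lambda (q theta) (g theta) (full 1) (fun=> y)).

(** By continuity in theta the infimum may be taken over a dense sequence, which
makes b_minus measurable. *)
Lemma b_minus_infs y : bm y = infs (fun n => r (t n) y) 0.
Proof.
have lb n : bm y <= r (t n) y.
  by rewrite -lee_fin -(mean_g_root _ (tT n)); exact: b_minus_le.
have hl : has_lbound (sdrop (fun n => r (t n) y) 0) by exists (bm y) => _ [n _ <-].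
apply/eqP; rewrite eq_le; apply/andP; split.
  by apply: lb_le_inf => [|_ [n _ <-]//]; exists (r (t 0%N) y); exists 0%N.
rewrite -lee_fin b_minusE; apply: le_ereal_inf_tmp => _ [theta Tt <-].
rewrite (mean_g_root _ Tt) lee_fin.
have U n : exists i, ball theta n.+1%:R^-1 (t i).
  by apply: t_dense => //; rewrite invr_gt0 ltr0n.
have [i iP] := choice U.
have ti : t \o i @ \oo --> theta.
  apply/cvg_ballP => s s0; near=> n.
  apply: le_ball (iP n); apply/ltW; near: n; exact: near_infty_natSinv_lt (PosNum s0).
have c : (fun n => r (t (i n)) y) @ \oo --> r theta y.
  apply: (root_cvg (fun n => M (tT (i n))) (M Tt)) => a b.
    exact: (within_cvg_seq (@q_cont a b) Tt (fun n => tT (i n)) ti).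
  exact: (within_cvg_seq (@g_cont a b) Tt (fun n => tT (i n)) ti).
apply: (cvgr_to_ge c); apply: nearW => n.
by apply: (ge_inf hl); exact: (ex_intro2 _ _ (i n) isT erefl).
Unshelve. all: by end_near.
Qed.

Lemma measurable_b_minus : measurable_fun setT bm.
Proof.
have -> : bm = (fun y => infs (fun n => r (t n) y) 0) by apply/funext => y; exact: b_minus_infs.
apply: measurable_fun_infs => [y _|n].
  exists (bm y) => _ [n _ <-].
  by rewrite -lee_fin -(mean_g_root _ (tT n)); exact: b_minus_le.
apply: (measurableT_comp (measurable_root (M (tT n)) (full 1))).
by apply: measurable_to_config => w; exact: measurable_id.
Qed.

End smallest_mean_density.

Lemma vertex_err_sqr_fin (R : realType) dY (Y : measurableType dY) d
    (Omega : measurableType d) (P : probability Omega R) (Z : {RV P >-> Y})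
    (sm sp bp : R) (bm : Y -> R) : measurable_fun setT bm ->
  (\int[P]_w (ln (bm (Z w)) ^+ 2)%:E < +oo)%E ->
  (\int[P]_w (vertex_err sm sp bp bm (Z w) ^+ 2)%:E < +oo)%E.
Proof.
move=> mbm l2; pose C := 2 * cq sm sp + `|ln bp|.
have C0 : 0 <= C by rewrite addr_ge0// mulr_ge0// cq_ge0.
have ml : measurable_fun setT (fun w => ln (bm (Z w))).
  apply: (measurableT_comp (@measurable_ln R)); apply: (measurableT_comp mbm).
  exact: measurable_funPT.
have ml2 : measurable_fun setT (fun w => ln (bm (Z w)) ^+ 2) by exact: measurable_funX.
apply: (@le_lt_trans _ _ (\int[P]_w (2 * C ^+ 2 + 2 * ln (bm (Z w)) ^+ 2)%:E)%E).
  apply: le_integral_EFin.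
  - by move=> w; exact: sqr_ge0.
  - apply: measurable_funX; apply: (measurableT_comp (measurable_vertex_err sm sp bp mbm)).
    exact: measurable_funPT.
  - by apply: measurable_funD => //; exact: measurable_funM.
  - move=> w; rewrite /vertex_err -/C; set l := ln (bm _).
    rewrite -[l ^+ 2]real_normK ?num_real//; have := sqr_ge0 (C - `|l|).
    by rewrite !expr2; lra.
rewrite ge0_integralD_EFin//.
- apply: lte_add_pinfty.
    by rewrite prob_integral_cst ltry.
  rewrite ge0_integralZl_EFin'//; last by move=> w; exact: sqr_ge0.
  by apply: lte_mul_pinfty.
- by move=> w; rewrite mulr_ge0// sqr_ge0.
- by move=> w; rewrite mulr_ge0// sqr_ge0.
- exact: measurable_funM.
Qed.

Lemma log_likelihood_full (R : realType) dX dY (X : measurableType dX)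
    (Y : measurableType dY) (lambda : probability X R)
    (mu : {sigma_finite_measure set Y -> \bar R}) (sm sp bp : R) (Par : Type)
    (q : Par -> X -> X -> R) (g : Par -> X -> Y -> R) (theta : Par)
    (Q : R.-pker X ~> X) (G : R.-pker X ~> Y) n x (y : seq bool -> Y) :
  regular_model lambda mu sm sp bp (q theta) (g theta) Q G ->
  log_likelihood lambda q g n x y theta =
  ln (lik lambda (q theta) (g theta) (full n.+1) x y).
Proof.
move=> M; rewrite /log_likelihood; congr ln.
have E w : (w \in nodes (full n.+1)) = (size w <= n)%N by rewrite mem_full ltnS.
have -> : Tn n = id @` [set` nodes (full n.+1)].
  apply/seteqP; split => [w wn|_ [w wn <-]].
    by exists w => //; exact: etrans (E w) wn.
  exact: etrans (esym (E w)) wn.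
exact: (tree_likelihood_shape (rm_q0 M) (rm_g0 M) (rm_mq M) (rm_mg M) (rm_q1 M)
  (full n) (full n) x y embedding_word_parent).
Qed.

Theorem theorem1p1
  (R : realType) (X Y : pmetricType R)
  (d : nat) (Theta : set 'rV[R]_d)
  (Q : 'rV[R]_d -> R.-pker (borel X) ~> (borel X))
  (G : 'rV[R]_d -> R.-pker (borel X) ~> (borel Y))
  (theta_star : 'rV[R]_d) (theta_star_Theta : Theta theta_star)
  (* (1) *)
  (lambda : probability (borel X) R)
  (mu : {sigma_finite_measure set (borel Y) -> \bar R})
  (q : 'rV[R]_d -> borel X -> borel X -> R)
  (g : 'rV[R]_d -> borel X -> borel Y -> R)
  (q_meas : forall theta, Theta theta ->
     measurable_fun [set: borel X * borel X] (fun z => q theta z.1 z.2))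
  (g_meas : forall theta, Theta theta ->
     measurable_fun [set: borel X * borel Y] (fun z => g theta z.1 z.2))
  (Q_dominated : forall theta x (A : set (borel X)), Theta theta ->
     measurable A -> Q theta x A = (\int[lambda]_(x' in A) (q theta x x')%:E)%E)
  (G_dominated : forall theta x (B : set (borel Y)), Theta theta ->
     measurable B -> G theta x B = (\int[mu]_(y in B) (g theta x y)%:E)%E)
  (* (2) *)
  (q_bounds : exists sigma_minus sigma_plus : R,
     [/\ 0 < sigma_minus, 0 < sigma_plus &
       forall theta x x', Theta theta ->
         sigma_minus <= q theta x x' <= sigma_plus])
  (g_inf : forall y, (0 < ereal_inf
     [set \int[lambda]_x (g theta x y)%:E | theta in Theta])%E)
  (g_sup : forall y, (ereal_sup
     [set \int[lambda]_x (g theta x y)%:E | theta in Theta] < +oo)%E)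
  (g_gt0 : forall theta x y, Theta theta -> 0 < g theta x y)
  (* the stationary process under the true parameter, extended to the tree
     with an infinite line of ancestors *)
  (pi_star : probability (borel X) R)
  (pi_star_inv : invariant_probability (Q theta_star) pi_star)
  (dO : measure_display) (Omega : measurableType dO) (P : probability Omega R)
  (Xs : vertex -> {RV P >-> borel X}) (Ys : vertex -> {RV P >-> borel Y})
  (XYs_HMT : is_extended_HMT Xs Ys (Q theta_star) (G theta_star) pi_star)
  (* the random left/right choices along the line of ancestors *)
  (dU : measure_display) (OmegaU : measurableType dU)
  (PU : probability OmegaU R) (U : nat -> {RV PU >-> bool})
  (U_iid : iid_bernoulli_half U)
  (* (3) *)
  (b_plus_fin : (maxe 1 (ereal_sup
     [set b | exists theta x y, Theta theta /\ b = (g theta x y)%:E]) < +oo)%E)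
  (log_b_minus : (\int[P]_w
     (`| ln (b_minus lambda g Theta (Ys origin w)) |)%:E < +oo)%E)
  (* (4) *)
  (log_b_minus2 : (\int[P]_w
     (ln (b_minus lambda g Theta (Ys origin w)) ^+ 2)%:E < +oo)%E)
  (* (5) *)
  (q_cont : forall x x', {within Theta, continuous (fun theta => q theta x x')})
  (g_cont : forall x y, {within Theta, continuous (fun theta => g theta x y)})
  (* (6) *)
  (Theta_compact : compact Theta)
  (contrast_max : exists! theta, is_argmax Theta (contrast lambda q g U Ys) theta)
  (* the possibly non-stationary observed process *)
  (zeta : probability (borel X) R)
  (dO' : measure_display) (Omega' : measurableType dO')
  (P' : probability Omega' R)
  (X' : seq bool -> {RV P' >-> borel X}) (Y' : seq bool -> {RV P' >-> borel Y})
  (XY'_HMT : is_HMT X' Y' (Q theta_star) (G theta_star) zeta)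
  (* the maximum likelihood estimator, as a measurable function of Y'_{T_n} *)
  (x : borel X)
  (theta_hat : nat -> (seq bool -> borel Y) -> 'rV[R]_d)
  (theta_hat_meas : forall n (B : set 'rV[R]_d), <<s (@open 'rV[R]_d) >> B ->
     coord_sigma (Tn n) (theta_hat n @^-1` B))
  (theta_hat_max : forall n w, is_argmax Theta
     (log_likelihood lambda q g n x (fun u => Y' u w))
     (theta_hat n (fun u => Y' u w))) :
  \forall w \ae P',
    (fun n => theta_hat n (fun u => Y' u w)) @ \oo --> theta_star.
Proof.
have [sm [sp [sm0 sp0 qb]]] := q_bounds.
pose gs := [set b | exists theta x y, Theta theta /\ b = (g theta x y)%:E].
pose bp := fine (maxe 1 (ereal_sup gs))%E.
have bpE : (maxe 1 (ereal_sup gs) = bp%:E)%E.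
  rewrite fineK// fin_real// b_plus_fin andbT.
  by apply: (@lt_le_trans _ _ 1%E); [exact: ltNyr|rewrite le_max lexx].
have M theta : Theta theta ->
    regular_model lambda mu sm sp bp (q theta) (g theta) (Q theta) (G theta).
  move=> Tt; split.
  - exact: sm0.
  - by move=> a b; exact: qb.
  - by move=> a b; exact: g_gt0.
  - move=> a b; rewrite -lee_fin -bpE le_max; apply/orP; right.
    by apply: ereal_sup_ubound; exists theta, a, b.
  - exact: q_meas.
  - exact: g_meas.
  - by move=> a A mA; exact: Q_dominated.
  - by move=> a A mA; exact: G_dominated.
have cT : cover_compact Theta by rewrite -compact_cover.
have [t [tT t_dense]] := compact_dense_seq cT theta_star_Theta.
have bm0 := b_minus_gt0 M g_inf tT.
have bm_le := b_minus_le M g_inf tT.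
have mbm := measurable_b_minus M q_cont g_cont g_inf tT t_dense.
have e2 := vertex_err_sqr_fin sm sp bp mbm log_b_minus2.
have cle := contrast_le bm0 mbm M bm_le theta_star_Theta pi_star_inv XYs_HMT e2 U_iid.
have star_max : is_argmax Theta (contrast lambda q g U Ys) theta_star by split.
(* the unique maximiser of the contrast is theta_star, by contrast_le *)
have clt theta : Theta theta -> theta <> theta_star ->
    contrast lambda q g U Ys theta < contrast lambda q g U Ys theta_star.
  move=> Tt ne; rewrite lt_neqAle (cle _ Tt) andbT; apply/eqP => E; apply: ne.
  have [z [_ zu]] := contrast_max.
  have tmax : is_argmax Theta (contrast lambda q g U Ys) theta.
    split; first exact: Tt.
    by move=> theta' Tt'; rewrite E; exact: cle.
  exact: etrans (esym (zu _ tmax)) (zu _ star_max).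
have sep j : \forall y \ae obs_law Y', \forall n \near \oo,
    forall theta, Theta theta -> ~ ball theta_star (j.+1%:R^-1 : R) theta ->
      ln (lik lambda (q theta) (g theta) (full n.+1) x y) <
      ln (lik lambda (q theta_star) (g theta_star) (full n.+1) x y).
  apply: (uniform_separation bm0 mbm M bm_le q_cont g_cont tT t_dense
    theta_star_Theta pi_star_inv XYs_HMT e2 U_iid XY'_HMT cT clt x).
  by rewrite invr_gt0 ltr0n.
have all_sep := ae_obs_law (ae_foralln sep).
move: all_sep; apply: filterS => w wsep.
apply/cvg_ballP => eps eps0.
have [j jP] : exists j : nat, j.+1%:R^-1 < eps.
  have [//|j jP] := @ltr_add_invr R 0 eps; last by exists j; rewrite add0r in jP.
have [N _ NP] := wsep j; exists N => // n Nn.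
have [hT hmax] := theta_hat_max n w.
apply: (le_ball (ltW jP)); apply: contrapT => Nb.
have := NP n Nn _ hT Nb; have := hmax _ theta_star_Theta.
rewrite (log_likelihood_full _ _ _ (M _ hT)) (log_likelihood_full _ _ _ (M _ theta_star_Theta)).
by move=> h1 h2; have := lt_le_trans h2 h1; rewrite ltxx.
Qed.
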